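(* Assume that $$\operatorname*{ess\,sup}_X\int p_X^2\,d\nu<+\infty\quad\text{and}\quad\operatorname*{ess\,sup}_X\int\log(p_X)^2\,d\nu<+\infty.$$ Put $$R=\inf_{q\in\mathbb{L}^1_{+,1}(\nu)}\operatorname*{ess\,sup}_X\mathcal{K}(q,p_X),\quad B=\operatorname*{ess\,sup}_X\Bigl(\int p_X^2\,d\nu\Bigr)^{1/2}\exp(R),\quad C=\operatorname*{ess\,sup}_X\Bigl(\int\log(p_X)^2\,d\nu\Bigr)^{1/2},$$ and $$\mathcal{Q}_B=\Bigl\{q\in\mathbb{L}^1_{+,1}(\nu)\cap\mathbb{L}^2(\nu):\int q^2\,d\nu\le B^2\Bigr\}.$$ Let $k\ge2$, $n\ge2k$, and let $(X_1,\dots,X_n)$ be a sample made of $n$ independent copies of $X$. (1) For any $\delta\in(0,1)$, with probability at least $1-\delta$, for any $q\in\mathcal{Q}_B^k$, $$\bigl(\mathbb{P}_X-\overline{\mathbb{P}}_X\bigr)\Bigl(\min_{1\le j\le k}\mathcal{K}(q_j,p_X)\Bigr)\le\Biggl(\frac{\log(n/k)}{\log2}\sqrt{\frac{8k\log k}{n}}+2\sqrt{\frac{k\log k}{n}}+\sqrt{\frac{(\sqrt2+1)k(3+2\log k)}{n}}+\sqrt{\frac{\log(\delta^{-1})}{2n}}\Biggr)\bigl(BC+2\log B\bigr).$$ (2) Let $\epsilon\ge0$ and let $\widehat q=\widehat q(X_1,\dots,X_n)\in\mathcal{Q}_B^k$ satisfy $$\overline{\mathbb{P}}_X\Bigl(\min_{1\le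 j\le k}\mathcal{K}(\widehat q_j,p_X)\Bigr)\le\inf_{q\in\mathcal{Q}_B^k}\overline{\mathbb{P}}_X\Bigl(\min_{1\le j\le k}\mathcal{K}(q_j,p_X)\Bigr)+\epsilon.$$ For any $\delta\in(0,1)$, with probability at least $1-\delta$, $$\mathbb{P}_X\Bigl(\min_{1\le j\le k}\mathcal{K}(\widehat q_j,p_X)\Bigr)\le\inf_{q\in(\mathbb{L}^1_{+,1}(\nu))^k}\mathbb{P}_X\Bigl(\min_{1\le j\le k}\mathcal{K}(q_j,p_X)\Bigr)+\Biggl(\frac{\log(n/k)}{\log2}\sqrt{\frac{8k\log k}{n}}+2\sqrt{\frac{k\log k}{n}}+\sqrt{\frac{(\sqrt2+1)k(3+2\log k)}{n}}+\sqrt{\frac{2\log(\delta^{-1})}{n}}\Biggr)\bigl(BC+2\log B\bigr)+\epsilon.$$ (3) Moreover, in expectation, $$\mathbb{P}_{X_1,\dots,X_n}\Bigl[\mathbb{P}_X\Bigl(\min_{1\le j\le k}\mathcal{K}(\widehat q_j,p_X)\Bigr)\Bigr]\le\inf_{q\in(\mathbb{L}^1_{+,1}(\nu))^k}\mathbb{P}_X\Bigl(\min_{1\le j\le k}\mathcal{K}(q_j,p_X)\Bigr)+\Biggl(\frac{\log(n/k)}{\log2}\sqrt{\frac{8k\log k}{n}}+2\sqrt{\frac{k\log k}{n}}+\sqrt{\frac{(\sqrt2+1)k(3+2\log k)}{n}}\Biggr)\bigl(BC+2\log B\bigr)+\epsilon.$$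
   Context: $(X,Y)$ is a couple of random variables in $\mathcal{X}\times\mathcal{Y}$, where $\mathcal{X},\mathcal{Y}$ are complete separable metric spaces, with regular conditional law $\mathbb{P}_{Y\mid X}$ of $Y$ given $X$. There is a reference probability measure $\nu$ on $\mathcal{Y}$ with $\mathbb{P}(\mathbb{P}_{Y\mid X}\ll\nu)=1$, and $p_X=d\mathbb{P}_{Y\mid X}/d\nu$. $\mathbb{L}^1_{+,1}(\nu)=\{q\in\mathbb{L}^1(\nu):q\ge0,\int q\,d\nu=1\}$. For densities, $\mathcal{K}(q,p)=\int q\log(q/p)\,d\nu$ if $\int q\,\mathbf{1}(p=0)\,d\nu=0$ and $+\infty$ otherwise. $\operatorname{ess\,sup}_X$ is the essential supremum with respect to the law of $X$. $\mathbb{P}_X(f(X))$ is the expectation under the law of $X$ (sample held fixed), $\overline{\mathbb{P}}_X=\frac1n\sum_{i=1}^n\delta_{X_i}$ the empirical measure, $\mathbb{P}_{X_1,\dots,X_n}$ the expectation over the sample. *)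

(* Defs.v *)
From HB Require Import structures.
From mathcomp Require Import all_boot all_order all_algebra.
From mathcomp Require Import all_classical all_reals all_analysis.
From mathcomp Require Import ess_sup_inf.

Set Implicit Arguments.
Unset Strict Implicit.
Unset Printing Implicit Defensive.

Import Order.TTheory GRing.Theory Num.Theory.
Import numFieldNormedType.Exports.

Local Open Scope classical_set_scope.
Local Open Scope ring_scope.
Local Open Scope charge_scope.
Local Open Scope ereal_scope.

#[short(type="completeMetricType")]
HB.structure Definition CompleteMetric (R : realType) :=
  { T of Complete T & Metric R T & Pointed T }.

Definition separable (T : topologicalType) :=
  exists2 D : set T, countable D & dense D.

Notation borel T := (g_sigma_algebraType (@open T)).

(* kappa x alone is only inferred to be a measure, whereas the Radon-Nikodym
   derivative requires a finite one. *)
Section kernel_probability.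
Context d d' (S : measurableType d) (T : measurableType d') (R : realType).
Variables (kappa : R.-pker S ~> T) (x : S).

Definition kernel_probability : set T -> \bar R := kappa x.

HB.instance Definition _ := Measure.copy kernel_probability (kappa x).
HB.instance Definition _ :=
  Measure_isProbability.Build _ _ _ kernel_probability (prob_kernel x).

End kernel_probability.

Section information_kmeans.
Context (R : realType).

(* Inner probability at least r; for measurable A this is r%:E <= P A. *)
Definition with_proba_ge d (T : measurableType d) (P : probability T R)
    (r : R) (A : set T) :=
  exists E, [/\ measurable E, E `<=` A & r%:E <= P E].

(* The product rule over the full family covers every subfamily, as some of
   the A i may be setT. *)
Definition mutually_independent d d' (T : measurableType d)
    (S : measurableType d') (P : probability T R) n
    (Xs : 'I_n -> {RV P >-> S}) :=
  forall A : 'I_n -> set S, (forall i, measurable (A i)) ->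
    P (\bigcap_(i in [set: 'I_n]) (Xs i @^-1` A i)) =
    \prod_(i < n) P (Xs i @^-1` A i).

Definition independent_copies d d' (T : measurableType d)
    (S : measurableType d') (P : probability T R) (X : {RV P >-> S}) n
    (Xs : 'I_n -> {RV P >-> S}) :=
  mutually_independent Xs /\
  (forall i A, measurable A -> distribution P (Xs i) A = distribution P X A).

Definition regular_conditional_law d d1 d2 (T : measurableType d)
    (S1 : measurableType d1) (S2 : measurableType d2) (P : probability T R)
    (X : {RV P >-> S1}) (Y : {RV P >-> S2}) (kappa : R.-pker S1 ~> S2) :=
  forall A B, measurable A -> measurable B ->
    P (X @^-1` A `&` Y @^-1` B) = \int[distribution P X]_(x in A) kappa x B.

Definition powset (U : Type) k (Q : set U) : set ('I_k -> U) :=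
  [set q | forall j, Q (q j)].

Section divergence.
Context d (T : measurableType d) (nu : probability T R).

(* L^1_{+,1}(nu), through representatives of the classes *)
Definition densities : set (T -> R) :=
  [set q | [/\ q \in Lfun nu 1, {ae nu, forall y, (0 <= q y)%R}
             & \int[nu]_y (q y)%:E = 1]].

(* As ln 0 = 0 and a / 0 = 0, the integrand is 0 wherever q = 0; in the first
   branch the points where p = 0 < q form a nu-null set. *)
Definition KL (q p : T -> R) : \bar R :=
  if \int[nu]_y (q y * \1_[set z | p z = 0%R] y)%:E == 0
  then \int[nu]_y (q y * ln (q y / p y))%:E
  else +oo.

Definition min_KL k (q : 'I_k -> T -> R) (p : T -> R) : \bar R :=
  \big[mine/+oo]_(j < k) KL (q j) p.

End divergence.

Section model.
Context dX dY (S : measurableType dX) (T : measurableType dY).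
Context (mu : probability S R) (nu : probability T R).

Definition conditional_density (kappa : R.-pker S ~> T) (x : S) (y : T) : R :=
  fine ('d (charge_of_finite_measure (kernel_probability kappa x)) '/d nu y).

Variable p : S -> T -> R.

Definition sq_mass (x : S) : \bar R := \int[nu]_y (p x y ^+ 2)%:E.

(* lne rather than ln: log 0 = -oo, hence the integrand is +oo where p x = 0. *)
Definition sq_log_mass (x : S) : \bar R := \int[nu]_y (lne (p x y)%:E ^+ 2).

Definition radius : \bar R :=
  ereal_inf [set ess_sup mu (fun x => KL nu q (p x)) | q in densities nu].

Definition constB : \bar R :=
  ess_sup mu (fun x => sq_mass x `^ 2^-1) * expeR radius.

Definition constC : \bar R := ess_sup mu (fun x => sq_log_mass x `^ 2^-1).

Definition ballQ : set (T -> R) :=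
  [set q | [/\ densities nu q, q \in Lfun nu 2%:E
             & \int[nu]_y (q y ^+ 2)%:E <= constB ^+ 2]].

Definition risk k (q : 'I_k -> T -> R) : \bar R :=
  \int[mu]_x min_KL nu q (p x).

(* Integral against the empirical measure, written as a sum so that it does
   not depend on the measurability of x |-> min_KL nu q (p x). *)
Definition empirical_risk k n (xs : 'I_n -> S) (q : 'I_k -> T -> R) : \bar R :=
  (n%:R^-1)%:E * \sum_(i < n) min_KL nu q (p (xs i)).

Definition empirical_minimizer k n (eps : R) (xs : 'I_n -> S)
    (q : 'I_k -> T -> R) :=
  powset ballQ q /\
  empirical_risk xs q <=
    ereal_inf [set empirical_risk xs q' | q' in powset (k:=k) ballQ] + eps%:E.

End model.

Local Open Scope ring_scope.

Definition rate (n k : nat) : R :=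
  ln (n%:R / k%:R) / ln 2 * Num.sqrt (8 * k%:R * ln k%:R / n%:R)
  + 2 * Num.sqrt (k%:R * ln k%:R / n%:R)
  + Num.sqrt ((Num.sqrt 2 + 1) * k%:R * (3 + 2 * ln k%:R) / n%:R).

End information_kmeans.

(* Main.v *)
Require Import Defs.
From HB Require Import structures.
From mathcomp Require Import all_boot all_order all_algebra.
From mathcomp Require Import all_classical all_reals all_analysis.
From mathcomp Require Import ess_sup_inf measurable_realfun.
From mathcomp Require Import ring lra.

(** Write [kl q x] for the divergence of the density [q] from the conditional density at
    [x]. When [q] is square-integrable, [kl q x = ent q - <q, log p_x>], where the
    entropy [ent q] lies between 0 and [2 log B] on the ball of radius [B], and the
    bracket is the inner product of the space of square-integrable functions, of size
    at most [B * C] by the Cauchy-Schwarz inequality. So the divergence is affine in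
    the center, and the loss of [k] centers is a minimum of [k] affine functionals of
    bounded vectors of a Hilbert space, with values between 0 and [B * C + 2 log B].
    The bounds are then deviation bounds for minima of affine functionals, together with
    the fact that the best centers belong to the ball.

    Rademacher sums of such minima ([rademacher_min_affine]). Finitely many points are
    involved, so the vectors have coordinates (Cholesky factorisation of a Gram matrix).
    The minimum is smoothed by replacing each coordinate of the centers by the mean of
    several independent signs of that mean. Smoothed minima are expectations under a
    product of biased signs, whose relative entropy to fair signs is about half the sum
    of the squared biases, so Gibbs' variational inequality bounds their Rademacher sums
    uniformly in the centers ([pac_bayes_rademacher]). Doubling the number of signs
    doubles the entropy and halves the squared increment, so that each scale costs the
    same, of order [sqrt (n * k * log k)]; [log2 (n / k)] scales make the smoothing error
    of that order too. The constants are those of [rate] ([chaining_le_rate]): a rate of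
    at least 1 is trivial, and otherwise there are at least eight scales, at each of
    which the entropy constant 7/12 saves enough to pay for the coarsest one.

    Deviations ([uniform_tail], [expected_supremum]). For variables with finitely many
    values, symmetrization and the bounded differences inequality turn the Rademacher
    bound into bounds in expectation and in probability. Finitely many bounded functions
    are nearly constant on the cells of a finite partition, which gives general
    variables, and monotone limits give countably many functions. A countable family
    of centers is enough ([countable_centers]): on a bounded set of square-integrable
    functions, convergence of the integrals over a countable pi-system is weak
    convergence, and it passes to the divergences once the entropies converge too.

    Reduction to the ball ([centroid_update]). For an averaging law over the points, the
    mean divergence of [q] from the family is the divergence of [q] from the normalised
    geometric mean of the family, minus the logarithm of the mass of the geometric mean
    ([centroid_pythagoras]). Applied to each cell of a Voronoi partition,
    this shows that centroids do at least as well as any centers. The mass is at least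
    [exp (- R)], because some density is at divergence close to [R] from the whole
    family, and the square of the geometric mean is at most the mean square, so that
    centroids belong to the ball.

    Excess risk. Deviations are measured relatively to a fixed competitor in the ball
    whose risk is within [1 / (i + 1)] of the infimum; that costs a factor 2 in the
    range of the differences but nothing in expectation. Letting [i] grow, infinitely
    many of the corresponding events hold together with the required probability.

    Two facts deal with measurability. The density at [x] is chosen separately for each
    [x], but almost surely it agrees with a section of a jointly measurable function
    ([joint_density]), which can be corrected on a null set to have all its properties
    at every point ([regular_density]). And the integral of a function that need not be
    measurable is a supremum over simple functions, which is still monotone and
    insensitive to null sets ([ae_eq_lower_integral]). *)

Set Implicit Arguments.
Unset Strict Implicit.
Unset Printing Implicit Defensive.

Import Order.TTheory GRing.Theory Num.Theory.
Import numFieldNormedType.Exports.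

Local Open Scope classical_set_scope.
Local Open Scope ring_scope.

(** * Elementary inequalities *)


Section real_inequalities.
Context {R : realType}.
Implicit Types (x h p t : R).

Lemma ln_le_subr1 x : 0 < x -> ln x <= x - 1.
Proof. by move=> x0; have := @le_ln1Dx R (x - 1); rewrite (addrC 1) subrK; apply; lra. Qed.

(** A function that decreases up to 0 and increases afterwards is least at 0. *)
Lemma le_at0_of_derive_sign (f df : R -> R) (a b : R) :
  (forall x, x \in `]a, b[ -> is_derive x 1 f (df x)) ->
  (forall x, x \in `]a, b[ -> 0 <= x * df x) ->
  0 \in `]a, b[ -> forall x, x \in `]a, b[ -> f 0 <= f x.
Proof.
move=> fd fs; rewrite in_itv/= => /andP[a0 b0] x; rewrite in_itv/= => /andP[ax xb].
have cont u v : a < u -> v < b -> {within `[u, v], continuous f}.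
  move=> au vb; apply: derivable_within_continuous => y; rewrite in_itv/= => /andP[uy yv].
  by apply: ex_derive; apply: fd; rewrite in_itv/= (lt_le_trans au uy) (le_lt_trans yv vb).
have [x0|x0|<-//] := ltgtP x 0.
- have fd' c : c \in `]x, 0[ -> is_derive c 1 f (df c).
    rewrite in_itv/= => /andP[xc c0]; apply: fd.
    by rewrite in_itv/= (lt_trans ax xc) (lt_trans c0 b0).
  have [c] := MVT x0 fd' (cont _ _ ax b0).
  rewrite in_itv/= => /andP[xc c0] E.
  have := fs c; rewrite in_itv/= (lt_trans ax xc) (lt_trans c0 b0) => /(_ isT) cs.
  rewrite nmulr_rge0// in cs.
  by rewrite -subr_le0 E sub0r mulrN oppr_le0 mulr_le0// ltW.
- have fd' c : c \in `]0, x[ -> is_derive c 1 f (df c).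
    rewrite in_itv/= => /andP[xc c0]; apply: fd.
    by rewrite in_itv/= (lt_trans a0 xc) (lt_trans c0 xb).
  have [c] := MVT x0 fd' (cont _ _ a0 xb).
  rewrite in_itv/= => /andP[xc c0] E.
  have := fs c; rewrite in_itv/= (lt_trans a0 xc) (lt_trans c0 xb) => /(_ isT) cs.
  rewrite pmulr_rge0// in cs.
  by rewrite -subr_ge0 E subr0 mulr_ge0// ltW.
Qed.

Lemma ln1p_le3 x : -1 < x -> ln (1 + x) <= x - x ^+ 2 / 2 + x ^+ 3 / 3.
Proof.
move=> x1.
pose f y := y - y ^+ 2 / 2 + y ^+ 3 / 3 - ln (1 + y) : R.
have H : forall y, y \in `](-1), (`|x| + 1)[ -> 
   is_derive y 1 f (y ^+ 3 / (1 + y)).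
  move=> y; rewrite in_itv/= => /andP[y1 _].
  have y1' : 0 < 1 + y by rewrite -ltrBlDl sub0r.
  have := is_derive1_ln y1' => D.
  rewrite /f; apply: is_derive_eq.
  rewrite /GRing.scale/=. field. lra.
have xl := ler_norm x.
have := le_at0_of_derive_sign H _ _ (x := x).
rewrite /f addr0 ln1 !expr0n/= !mul0r !subr0 addr0 subr_ge0; apply.
- move=> y; rewrite in_itv/= => /andP[y1 _].
  rewrite mulrA -exprS divr_ge0//; last lra.
  by rewrite -[4%N]/(2 * 2)%N exprM sqr_ge0.
- by rewrite in_itv/=; have := normr_ge0 x; lra.
- by rewrite in_itv/= x1; lra.
Qed.

(** The variance of a Bernoulli variable is at most 1/4, so the second derivative
    of its centred log-Laplace transform is at most 1/4. *)
Lemma hoeffding_bernoulli p h : 0 <= p <= 1 ->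
  (1 - p) + p * expR h <= expR (p * h + h ^+ 2 / 8).
Proof.
move=> /andP[p0 p1].
pose D (y : R) : R := (1 - p) + p * expR y.
have D0 (y : R) : 0 < D y.
  rewrite /D; have [->|pn0] := eqVneq p 0; first by rewrite mul0r; lra.
  have : 0 < p * expR y by rewrite mulr_gt0 ?expR_gt0// lt0r pn0.
  by have := p1; lra.
have dD (y : R) : is_derive y 1 D (p * expR y).
  rewrite /D; apply: is_derive_eq; rewrite /GRing.scale/=; ring.
pose g (y : R) : R := p + y / 4 - p * expR y / D y.
have dg (y : R) : is_derive y 1 g ((4^-1 - (p * expR y / D y) * (1 - p * expR y / D y))).
  rewrite /g.
  have dDV := is_deriveV (lt0r_neq0 (D0 y)) (dD y).
  apply: is_derive_eq; rewrite /GRing.scale/=.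
  have : D y != 0 by rewrite gt_eqF.
  by move=> D1; field.
pose f (y : R) : R := p * y + y ^+ 2 / 8 - ln (D y).
have df (y : R) : is_derive y 1 f (g y).
  rewrite /f.
  have dl := is_derive1_comp (is_derive1_ln (D0 y)) (dD y).
  by apply: is_derive_eq; rewrite /g /GRing.scale/=; field; rewrite gt_eqF.
have D00 : D 0 = 1 by rewrite /D expR0; ring.
have gs (y : R) : 0 <= y * g y.
  have g0 : g 0 = 0 by rewrite /g D00 expR0; field.
  have dg0 (z : R) : 0 <= (4^-1 - (p * expR z / D z) * (1 - p * expR z / D z)).
    set u := p * expR z / D z.
    have -> : 4^-1 - u * (1 - u) = (u - 2^-1) ^+ 2 by field.
    exact: sqr_ge0.
  have cg (u v : R) : {within `[u, v], continuous g}.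
    apply: derivable_within_continuous => z _; exact: ex_derive.
  have [y0|y0|->] := ltgtP y 0; last by rewrite mul0r.
  - have [c _] := MVT y0 (fun z _ => dg z) (cg _ _).
    rewrite g0 !sub0r => E.
    by rewrite nmulr_rge0// -oppr_ge0 E mulr_ge0// oppr_ge0 ltW.
  - have [c _] := MVT y0 (fun z _ => dg z) (cg _ _).
    rewrite g0 !subr0 => ->.
    by rewrite mulr_ge0 ?mulr_ge0// ltW.
have := @le_at0_of_derive_sign f g (- (`|h| + 1)) (`|h| + 1) (fun y _ => df y)
   (fun y _ => gs y) _ h.
have f0 : f 0 = 0 by rewrite /f D00 ln1 mulr0 expr0n/=; ring.
rewrite f0 => /(_ _ _)/wrap[]; rewrite ?in_itv/=.
- by have := normr_ge0 h; lra.
- have := ler_norm h; have := ler_norm (- h); rewrite normrN; lra.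
rewrite /f subr_ge0 => le.
by rewrite -[leLHS]lnK ?posrE; [rewrite ler_expR|exact: D0].
Qed.

(** The relative entropy of the law of a random sign of mean t with respect to the
    fair one is t^2/2 to leading order. *)
Lemma sign_entropy_le t : `|t| <= 2^-1 ->
  (1 + t) / 2 * ln (1 + t) + (1 - t) / 2 * ln (1 - t) <= 7 / 12 * t ^+ 2.
Proof.
move=> ht; have := ler_norm t; have := ler_norm (- t); rewrite normrN => t1 t2.
have h1 := @ln1p_le3 t; have h2 := @ln1p_le3 (- t).
have {}h1 : (1 + t) / 2 * ln (1 + t) <= (1 + t) / 2 * (t - t ^+ 2 / 2 + t ^+ 3 / 3).
  by rewrite ler_wpM2l ?h1//; lra.
have {}h2 : (1 - t) / 2 * ln (1 - t) <= (1 - t) / 2 * (- t - (- t) ^+ 2 / 2 + (- t) ^+ 3 / 3).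
  by rewrite ler_wpM2l ?h2//; lra.
apply: le_trans (lerD h1 h2) _.
have tt : t ^+ 2 <= 4^-1.
  rewrite -real_normK ?num_real//.
  have -> : 4^-1 = 2^-1 ^+ 2 :> R by field.
  by rewrite lerXn2r ?nnegrE//; lra.
have -> : (1 + t) / 2 * (t - t ^+ 2 / 2 + t ^+ 3 / 3) +
  (1 - t) / 2 * (- t - (- t) ^+ 2 / 2 + (- t) ^+ 3 / 3) = t ^+ 2 * (1/2 + t ^+ 2 / 3) by field.
rewrite mulrC ler_wpM2r ?sqr_ge0//; lra.
Qed.

End real_inequalities.


(** * Finite expectations *)


Section finite_expectation.
Context {R : realType}.

Definition Ex (T : finType) (w : T -> R) (phi : T -> R) : R :=
  \sum_t w t * phi t.

Definition is_dist (T : finType) (w : T -> R) :=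
  (forall t, 0 <= w t) /\ \sum_t w t = 1.

Definition prodw (I V : finType) (w : I -> V -> R) (f : {ffun I -> V}) : R :=
  \prod_i w i (f i).

Section basics.
Context (T : finType) (w : T -> R).
Implicit Types phi psi : T -> R.

Lemma eq_Ex phi psi : phi =1 psi -> Ex w phi = Ex w psi.
Proof. by move=> e; apply: eq_bigr => t _; rewrite e. Qed.

Lemma ExD phi psi : Ex w (fun t => phi t + psi t) = Ex w phi + Ex w psi.
Proof. by rewrite -big_split; apply: eq_bigr => t _; rewrite mulrDr. Qed.

Lemma ExZ a phi : Ex w (fun t => a * phi t) = a * Ex w phi.
Proof. by rewrite /Ex mulr_sumr; apply: eq_bigr => t _; rewrite mulrCA. Qed.

Lemma ExN phi : Ex w (fun t => - phi t) = - Ex w phi.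
Proof. by rewrite /Ex -sumrN; apply: eq_bigr => t _; rewrite mulrN. Qed.

Lemma ExB phi psi : Ex w (fun t => phi t - psi t) = Ex w phi - Ex w psi.
Proof. by rewrite ExD ExN. Qed.

Lemma Ex_sum (I : Type) (r : seq I) (P : pred I) (phi : I -> T -> R) :
  Ex w (fun t => \sum_(i <- r | P i) phi i t) = \sum_(i <- r | P i) Ex w (phi i).
Proof.
rewrite /Ex exchange_big; apply: eq_bigr => t _.
by rewrite mulr_sumr.
Qed.

Lemma Ex_exchange (T' : finType) (w' : T' -> R) (phi : T -> T' -> R) :
  Ex w (fun t => Ex w' (phi t)) = Ex w' (fun t' => Ex w (phi^~ t')).
Proof.
rewrite /Ex; under eq_bigr do rewrite mulr_sumr.
rewrite exchange_big; apply: eq_bigr => t' _ /=.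
by rewrite mulr_sumr; apply: eq_bigr => t _; rewrite mulrCA.
Qed.

Hypothesis dw : is_dist w.

Lemma Ex_cst c : Ex w (fun=> c) = c.
Proof. by rewrite /Ex -mulr_suml dw.2 mul1r. Qed.

Lemma le_Ex phi psi : (forall t, phi t <= psi t) -> Ex w phi <= Ex w psi.
Proof. by move=> le; apply: ler_sum => t _; rewrite ler_wpM2l ?dw.1. Qed.

Lemma Ex_ge0 phi : (forall t, 0 <= phi t) -> 0 <= Ex w phi.
Proof. by move=> ge0; rewrite -(Ex_cst 0) le_Ex. Qed.

Lemma Ex_le_cst phi c : (forall t, phi t <= c) -> Ex w phi <= c.
Proof. by move=> le; rewrite -[leRHS]Ex_cst le_Ex. Qed.

Lemma Ex_gt0 phi : (forall t, 0 < phi t) -> 0 < Ex w phi.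
Proof.
move=> pos; rewrite lt0r Ex_ge0 ?andbT; last by move=> t; exact: ltW.
apply/eqP => /psumr_eq0P e.
have {}e t : w t = 0.
  have /eqP := e (fun t _ => mulr_ge0 (dw.1 t) (ltW (pos t))) t isT.
  by rewrite mulf_eq0 (gt_eqF (pos t)) orbF => /eqP.
by have := dw.2; rewrite big1// => /eqP; rewrite eq_sym oner_eq0.
Qed.

(** Jensen's inequality for the logarithm. *)
Lemma Ex_ln_le phi : (forall t, 0 < phi t) ->
  Ex w (fun t => ln (phi t)) <= ln (Ex w phi).
Proof.
move=> pos.
have Epos := Ex_gt0 pos.
have -> : ln (Ex w phi) = Ex w (fun t => ln (Ex w phi) + (phi t / Ex w phi - 1)).
  rewrite ExD ExB !Ex_cst.
  rewrite (@eq_Ex (fun t => phi t / Ex w phi) (fun t => (Ex w phi)^-1 * phi t)); last by move=> t; rewrite mulrC.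
  by rewrite ExZ mulVf ?gt_eqF// subrr addr0.
apply: le_Ex => t.
have q0 : 0 < phi t / Ex w phi by rewrite divr_gt0.
rewrite -lerBlDl -ln_div ?posrE//.
exact: ln_le_subr1.
Qed.

End basics.

Section product.
Context (I V : finType).
Implicit Types w : I -> V -> R.

Lemma Ex_prodw_prod w (g : I -> V -> R) :
  Ex (prodw w) (fun f => \prod_i g i (f i)) = \prod_i Ex (w i) (g i).
Proof.
rewrite /Ex bigA_distr_bigA; apply: eq_bigr => f _.
by rewrite /prodw -big_split.
Qed.

Lemma is_dist_prodw w : (forall i, is_dist (w i)) -> is_dist (prodw w).
Proof.
move=> dw; split => [f|]; first by apply: prodr_ge0 => i _; exact: (dw i).1.
by rewrite /prodw -bigA_distr_bigA big1// => i _; exact: (dw i).2.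
Qed.

(** The law of the coordinates selected by an injection is again a product. *)
Lemma Ex_prodw_restrict (J : finType) (w : I -> V -> R) (sel : J -> I)
    (phi : {ffun J -> V} -> R) :
  (forall i, is_dist (w i)) -> injective sel ->
  Ex (prodw w) (fun f => phi [ffun j => f (sel j)]) =
  Ex (prodw (fun j => w (sel j))) phi.
Proof.
move=> dw inj_sel.
rewrite /Ex (partition_big (fun f : {ffun I -> V} => [ffun j => f (sel j)]) predT)//=.
apply: eq_bigr => g _.
under eq_bigr => f /eqP -> do [].
rewrite -mulr_suml; congr (_ * _).
pose F i : pred V := [pred v | [forall j, (sel j == i) ==> (v == g j)]].
rewrite (eq_bigl (fun f => f \in family F)); last first.
  move=> f; apply/eqP/familyP => [/ffunP fg i|fF].
    rewrite inE; apply/forallP => j; apply/implyP => /eqP <-.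
    by have := fg j; rewrite ffunE => ->.
  apply/ffunP => j; rewrite ffunE; have := fF (sel j); rewrite inE => /forallP /(_ j).
  by rewrite eqxx => /eqP.
rewrite /prodw -bigA_distr_big_dep/=.
rewrite (bigID (fun i => i \in codom sel))/= [X in _ * X]big1 ?mulr1; last first.
  move=> i ni; rewrite -[RHS](dw i).2; apply: eq_bigl => v.
  apply/forallP => j; apply/implyP => /eqP e; move: ni; rewrite -e codom_f//.
rewrite (eq_bigl (fun i => i \in sel @: [set: J]%SET)); last first.
  move=> i; apply/codomP/imsetP => [[j ->]|[j _ ->]]; last by exists j.
  by exists j; rewrite ?inE.
rewrite big_imset/=; last by move=> ? ? _ _; exact: inj_sel.
rewrite (eq_bigl predT) => [|j]; last by rewrite inE.
apply: eq_bigr => j _.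
rewrite (eq_bigl (pred1 (g j))) ?big_pred1_eq// => v /=.
apply/forallP/eqP => [/(_ j)|-> j']; first by rewrite eqxx => /eqP.
by apply/implyP => /eqP /inj_sel ->.
Qed.

Lemma Ex_prodw_coord w (i : I) (phi : V -> R) : (forall i, is_dist (w i)) ->
  Ex (prodw w) (fun f => phi (f i)) = Ex (w i) phi.
Proof.
move=> dw; pose g j v := if j == i then phi v else 1.
rewrite [LHS](_ : _ = Ex (prodw w) (fun f => \prod_j g j (f j))).
  rewrite Ex_prodw_prod (bigD1 i)//= big1 ?mulr1.
    by apply: eq_Ex => v; rewrite /g eqxx.
  move=> j /negbTE ji; rewrite -[RHS](Ex_cst (dw j)).
  by apply: eq_Ex => v; rewrite /g ji.
apply: eq_Ex => f; rewrite (bigD1 i)//= big1 ?mulr1; first by rewrite /g eqxx.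
by move=> j /negbTE ji; rewrite /g ji.
Qed.

End product.

(** Gibbs' variational inequality, from [ln x <= x - 1] under [rho]. *)
Lemma gibbs_le (T : finType) (pi rho : T -> R) (phi : T -> R) :
  is_dist pi -> (forall t, 0 < pi t) -> is_dist rho ->
  Ex rho phi <= Ex rho (fun t => ln (rho t / pi t)) + ln (Ex pi (fun t => expR (phi t))).
Proof.
move=> dpi pi0 drho; set Z := Ex pi _.
have Z0 : 0 < Z.
  have [t _] : exists t : T, true.
    apply: contrapT => no; have := dpi.2; rewrite big1 ?(eqP (oner_neq0 _))//.
      by move/eqP; rewrite eq_sym oner_eq0.
    by move=> t _; case: no; exists t.
  rewrite /Z /Ex (bigD1 t)//= ltr_wpDr ?mulr_gt0 ?expR_gt0//.
  by apply: sumr_ge0 => s _; rewrite mulr_ge0 ?expR_ge0 ?ltW.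
rewrite -[ln Z](Ex_cst drho) -ExD -subr_le0 -ExB.
have -> : 0 = \sum_t (pi t * expR (phi t) / Z - rho t).
  by rewrite sumrB drho.2 -mulr_suml -/(Ex pi (fun t => expR (phi t))) -/Z divff ?subrr ?gt_eqF.
apply: ler_sum => t _.
have := drho.1 t; rewrite le_eqVlt => /predU1P[<-|r0].
  by rewrite mul0r subr0 divr_ge0 ?mulr_ge0 ?expR_ge0 ?ltW.
have -> : pi t * expR (phi t) / Z - rho t = rho t * (pi t * expR (phi t) / Z / rho t - 1).
  by field; rewrite !gt_eqF.
rewrite ler_pM2l//.
have u0 : 0 < pi t * expR (phi t) / Z / rho t by rewrite !divr_gt0 ?mulr_gt0 ?expR_gt0.
apply: le_trans (ln_le_subr1 u0).
have pr0 : 0 < rho t / pi t by rewrite divr_gt0.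
rewrite (_ : pi t * expR (phi t) / Z / rho t = expR (phi t) / (rho t / pi t) / Z); last first.
  by field; rewrite !gt_eqF.
rewrite !ln_div ?posrE ?divr_gt0 ?expR_gt0// expRK; lra.
Qed.

(** The right-hand side is the value at the best [l], which exists only when [a] and
    [b] are positive. *)
Lemma le_sqrt_of_forall (a b y : R) : 0 <= a -> 0 <= b ->
  (forall l, 0 < l -> y <= a / l + l * b / 2) -> y <= Num.sqrt (2 * a * b).
Proof.
move=> a0 b0 H.
have [y0|y0] := leP y 0; first exact: le_trans y0 (sqrtr_ge0 _).
have [E|an0] := eqVneq a 0.
  suff : y <= y / 2 by lra.
  have B : 0 < b + 1 by lra.
  have := H (y / (b + 1)) _; rewrite divr_gt0// => /(_ isT) /le_trans; apply.
  rewrite E mul0r add0r ler_pM2r// -mulrA ger_pMr//.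
  by rewrite mulrC ler_pdivrMr//; lra.
have {an0}a1 : 0 < a by rewrite lt0r an0.
have [E|bn0] := eqVneq b 0.
  suff : y <= y / 2 by lra.
  have := H (2 * a / y); rewrite divr_gt0 ?mulr_gt0// => /(_ isT) /le_trans; apply.
  rewrite E mulr0 mul0r addr0 le_eqVlt; apply/orP; left; apply/eqP; field.
  by rewrite !gt_eqF.
have {bn0}b1 : 0 < b by rewrite lt0r bn0.
set s := Num.sqrt _.
have s0 : 0 < s by rewrite sqrtr_gt0 !mulr_gt0.
have ss : s ^+ 2 = 2 * a * b by rewrite sqr_sqrtr// !mulr_ge0.
apply: le_trans (H (s / b) _) _; first by rewrite divr_gt0.
rewrite le_eqVlt; apply/orP; left; apply/eqP.
have -> : a / (s / b) = s ^+ 2 / 2 / s by rewrite ss; field; rewrite !gt_eqF.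
by field; rewrite !gt_eqF.
Qed.

(** A maximum is at most a soft maximum, whose mean Jensen's inequality bounds. *)
Lemma Ex_max_subgaussian (T : finType) (w : T -> R) (k : nat)
    (X : 'I_k -> T -> R) (M : T -> R) (v : R) :
  is_dist w -> (0 < k)%N -> 0 <= v ->
  (forall l j, 0 < l -> Ex w (fun t => expR (l * X j t)) <= expR (l ^+ 2 * v / 2)) ->
  (forall t, exists j, M t <= X j t) ->
  Ex w M <= Num.sqrt (2 * ln k%:R * v).
Proof.
move=> dw k0 v0 sg MX.
have k1 : 1 <= k%:R :> R by rewrite ler1n.
apply: le_sqrt_of_forall => // [|l l0]; first exact: ln_ge0.
rewrite -(ler_pM2l l0) mulrDr mulrCA divff ?gt_eqF// mulr1.
rewrite -ExZ.
have P t : 0 < \sum_j expR (l * X j t).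
  case: k k0 X {sg MX k1} => // k _ X.
  rewrite big_ord_recl ltr_wpDr ?expR_gt0//.
  by apply: sumr_ge0 => ? _; exact: expR_ge0.
apply: (@le_trans _ _ (Ex w (fun t => ln (\sum_j expR (l * X j t))))).
  apply: le_Ex => // t; rewrite -ler_expR lnK ?posrE//.
  have [j Mj] := MX t; apply: (@le_trans _ _ (expR (l * X j t))).
    by rewrite ler_expR ler_pM2l.
  by rewrite (bigD1 j)//= lerDl sumr_ge0// => ? _; exact: expR_ge0.
apply: le_trans (Ex_ln_le dw P) _.
have EP := Ex_gt0 dw P.
rewrite -ler_expR lnK ?posrE// expRD lnK ?posrE ?ltr0n//.
rewrite Ex_sum (_ : l * (l * v / 2) = l ^+ 2 * v / 2); last by field.
apply: le_trans (ler_sum _ (fun j _ => sg l j l0)) _.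
by rewrite sumr_const card_ord mulr_natl.
Qed.

End finite_expectation.


(** * Signs and the PAC-Bayes inequality *)


Section random_signs.
Context {R : realType}.

Definition sg (b : bool) : R := if b then 1 else -1.

Definition signw (I : finType) (t : I -> R) (i : I) (b : bool) : R :=
  (1 + sg b * t i) / 2.

Definition signd (I : finType) (t : I -> R) : {ffun I -> bool} -> R :=
  prodw (signw t).

Section product_of_signs.
Context (I : finType).
Implicit Types (t c : I -> R).

Lemma Ex_signw t i phi : Ex (signw t i) phi =
  (1 + t i) / 2 * phi true + (1 - t i) / 2 * phi false.
Proof. by rewrite /Ex big_bool/= /signw /sg mul1r mulN1r. Qed.

Lemma signw_dist t : (forall i, `|t i| <= 1) -> forall i, is_dist (signw t i).
Proof.
move=> t1 i; have := ler_norm (t i); have := ler_norm (- t i); rewrite normrN.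
have := t1 i => ? ? ?; split; last by rewrite big_bool/= /signw /sg; field.
by case; rewrite /signw /sg; lra.
Qed.

Lemma signd_dist t : (forall i, `|t i| <= 1) -> is_dist (signd t).
Proof. by move=> t1; apply: is_dist_prodw; exact: signw_dist. Qed.

Lemma signd_dist0 : is_dist (signd (fun=> 0 : R) : {ffun I -> bool} -> R).
Proof. by apply: signd_dist => i; rewrite normr0. Qed.

Lemma Ex_sign t i : (forall i, `|t i| <= 1) ->
  Ex (signd t) (fun xi => sg (xi i)) = t i.
Proof.
by move=> t1; rewrite (Ex_prodw_coord i (fun b => sg b) (signw_dist t1)) Ex_signw /sg; field.
Qed.

(** A sign ranges over an interval of length 2, hence the variance proxy 1. *)
Lemma signd_mgf t c : (forall i, `|t i| <= 1) ->
  Ex (signd t) (fun xi => expR (\sum_i (sg (xi i) - t i) * c i)) <=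
  expR (\sum_i c i ^+ 2 / 2).
Proof.
move=> t1; rewrite expR_sum.
rewrite (eq_Ex _ (psi := fun xi : {ffun I -> bool} => \prod_i expR ((sg (xi i) - t i) * c i))); last first.
  by move=> xi; rewrite expR_sum.
rewrite (Ex_prodw_prod _ (fun i b => expR ((sg b - t i) * c i))).
apply: ler_prod => i _; apply/andP; split.
  by apply: Ex_ge0 => [|b]; [exact: signw_dist|exact: expR_ge0].
rewrite Ex_signw /sg.
have := t1 i; rewrite ler_norml => /andP[? ?].
have := @hoeffding_bernoulli R ((1 + t i) / 2) (2 * c i).
move=> /(_ _)/wrap[]; first lra.
rewrite (_ : (1 + t i) / 2 * (2 * c i) + (2 * c i) ^+ 2 / 8 = (1 + t i) * c i + c i ^+ 2 / 2); last by field.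
rewrite expRD => le; rewrite -(ler_pM2l (expR_gt0 ((1 + t i) * c i))); apply: le_trans le.
rewrite mulrDr !(mulrCA (expR _)) -!expRD.
rewrite (_ : (1 + t i) * c i + (1 - t i) * c i = 2 * c i); last by ring.
rewrite (_ : (1 + t i) * c i + (-1 - t i) * c i = 0); last by ring.
by rewrite expR0 le_eqVlt; apply/orP; left; apply/eqP; field.
Qed.

(** The entropy of independent signs is the sum of theirs. *)
Lemma signd_entropy t : (forall i, `|t i| <= 2^-1) ->
  Ex (signd t) (fun xi => ln (signd t xi / signd (fun=> 0) xi)) <=
  7 / 12 * \sum_i t i ^+ 2.
Proof.
move=> t2; have t1 i : `|t i| <= 1 by apply: le_trans (t2 i) _; lra.
have pos i b : 0 < 1 + sg b * t i.
  have := t2 i; rewrite ler_norml => /andP[? ?].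
  by case: b; rewrite /sg ?mul1r ?mulN1r; lra.
rewrite (eq_Ex _ (psi := fun xi : {ffun I -> bool} => \sum_i ln (1 + sg (xi i) * t i))); last first.
  move=> xi; rewrite /signd /prodw -prodf_div.
  rewrite (eq_bigr (fun i => expR (ln (1 + sg (xi i) * t i)))); last first.
    by move=> i _; rewrite lnK ?posrE// /signw mulr0 addr0; field.
  by rewrite -expR_sum expRK.
rewrite Ex_sum mulr_sumr; apply: ler_sum => i _.
rewrite (Ex_prodw_coord i (fun b => ln (1 + sg b * t i)) (signw_dist t1)) Ex_signw /sg.
by rewrite mul1r mulN1r; exact: sign_entropy_le.
Qed.

Lemma signd0_gt0 (xi : {ffun I -> bool}) : 0 < signd (fun=> 0 : R) xi.
Proof. by apply: prodr_gt0 => i _; rewrite /signw mulr0 addr0 divr_gt0. Qed.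

End product_of_signs.

Definition rad (I : finType) : {ffun I -> bool} -> R := signd (fun=> 0).

Lemma rad_mgf (I : finType) (c : I -> R) :
  Ex (@rad I) (fun e => expR (\sum_i sg (e i) * c i)) <=
  expR (\sum_i c i ^+ 2 / 2).
Proof.
have := @signd_mgf I (fun=> 0) c.
move=> /(_ _)/wrap[]; first by move=> i; rewrite normr0.
by under eq_Ex => e do under eq_bigr do rewrite subr0.
Qed.

(** PAC-Bayesian bound for Rademacher sums: the quadratic term is kept inside the
    exponential, so that only its mean under each posterior has to be bounded. *)
Lemma pac_bayes_rademacher (T I : finType) (A : Type) (pi : T -> R)
    (rho : A -> T -> R) (Z : T -> I -> R) (K V : R)
    (alpha : {ffun I -> bool} -> A) :
  is_dist pi -> (forall t, 0 < pi t) -> (forall a, is_dist (rho a)) ->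
  0 <= K -> 0 <= V ->
  (forall a, Ex (rho a) (fun t => ln (rho a t / pi t)) <= K) ->
  (forall a, Ex (rho a) (fun t => \sum_i Z t i ^+ 2) <= V) ->
  Ex (@rad I) (fun e => Ex (rho (alpha e)) (fun t => \sum_i sg (e i) * Z t i)) <=
  Num.sqrt (2 * K * V).
Proof.
move=> dpi pi0 drho K0 V0 HK HV; apply: le_sqrt_of_forall => // l l0.
have drad := @signd_dist0 I.
pose phi (e : {ffun I -> bool}) t := l * (\sum_i sg (e i) * Z t i) - l ^+ 2 / 2 * (\sum_i Z t i ^+ 2).
pose G (e : {ffun I -> bool}) := Ex pi (fun t => expR (phi e t)).
have G0 e : 0 < G e by apply: Ex_gt0 => // t; exact: expR_gt0.
have EG : Ex (@rad I) G <= 1.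
  rewrite /G Ex_exchange; apply: Ex_le_cst => // t.
  rewrite (eq_Ex _ (psi := fun e : {ffun I -> bool} => expR (- (l ^+ 2 / 2 * (\sum_i Z t i ^+ 2))) *
     expR (\sum_i sg (e i) * (l * Z t i)))); last first.
    move=> e; rewrite -expRD /phi addrC; congr (expR (_ + _)).
    by rewrite mulr_sumr; apply: eq_bigr => i _; rewrite mulrCA.
  rewrite ExZ expRN mulrC ler_pdivrMr ?expR_gt0// mul1r.
  apply: le_trans (rad_mgf _) _; rewrite ler_expR mulr_sumr.
  by apply: ler_sum => i _; rewrite exprMn; lra.
have EG0 := Ex_gt0 drad G0.
apply: (@le_trans _ _ (Ex (@rad I) (fun e => (K / l + l * V / 2) + l^-1 * ln (G e)))).
  apply: le_Ex => // e; rewrite -(ler_pM2l l0) mulrDr mulrDr mulrCA divff ?gt_eqF// mulr1.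
  rewrite (mulrA l l^-1) divff ?gt_eqF// mul1r -ExZ.
  have := gibbs_le (phi e) dpi pi0 (drho (alpha e)); rewrite -/(G e).
  rewrite {1}/phi ExB [X in _ - X]ExZ => le.
  have hk := HK (alpha e).
  have hv : l ^+ 2 / 2 * Ex (rho (alpha e)) (fun t => \sum_i Z t i ^+ 2) <= l ^+ 2 / 2 * V.
    by rewrite ler_wpM2l// divr_ge0 ?sqr_ge0.
  have -> : l * (l * V / 2) = l ^+ 2 / 2 * V by field.
  lra.
rewrite ExD Ex_cst// ExZ gerDl pmulr_rle0 ?invr_gt0//.
by apply: le_trans (Ex_ln_le drad G0) _; exact: ln_le0.
Qed.

End random_signs.


(** * Smoothing minima by replicated signs *)


Section vector_min.
Context {R : realType} (k : nat).
Implicit Types f g : 'I_k.+1 -> R.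

Definition vmin f : R := \big[Num.min/f ord0]_(j < k.+1) f j.

Lemma vmin_le f j : vmin f <= f j.
Proof. exact: bigmin_le. Qed.

Lemma vmin_ex f : exists j, vmin f = f j.
Proof.
rewrite /vmin; elim/big_ind: _ => [|x y [i ->] [j ->]|j _]; [by exists ord0| |by exists j].
by rewrite minElt; case: ifP => _; [exists i|exists j].
Qed.

Lemma eq_vmin f g : f =1 g -> vmin f = vmin g.
Proof. by move=> /funext ->. Qed.

Lemma le_vmin f c : (forall j, c <= f j) -> c <= vmin f.
Proof. by have [j ->] := vmin_ex f. Qed.

Lemma vmin_sub_le f g : exists j, vmin f - vmin g <= f j - g j.
Proof. by have [j ->] := vmin_ex g; exists j; rewrite lerD2r vmin_le. Qed.

Lemma Ex_vmin_le (T : finType) (w : T -> R) (f : T -> 'I_k.+1 -> R) :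
  is_dist w -> Ex w (fun t => vmin (f t)) <= vmin (fun j => Ex w (f^~ j)).
Proof. by move=> dw; apply: le_vmin => j; apply: le_Ex => // t; exact: vmin_le. Qed.

Lemma vminZ c f : 0 <= c -> vmin (fun j => c * f j) = c * vmin f.
Proof.
move=> c0; apply/eqP; rewrite eq_le; apply/andP; split.
  have [j ->] := vmin_ex f; exact: vmin_le.
by apply: le_vmin => j; rewrite ler_wpM2l// vmin_le.
Qed.

End vector_min.

Section perturbed_min.
Context {R : realType} (k N : nat).
Local Notation I P := ('I_k.+1 * 'I_N * P)%type.
Implicit Types (theta : 'I_k.+1 -> 'I_N -> R) (W : 'I_N -> R).

Definition dot (u W : 'I_N -> R) : R := \sum_b u b * W b.

Definition sqnorm (u : 'I_N -> R) : R := \sum_b u b ^+ 2.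

Definition bias (P : finType) theta (x : I P) : R := theta x.1.1 x.1.2.

Definition average (P : finType) (xi : {ffun I P -> bool}) (j : 'I_k.+1) (b : 'I_N) : R :=
  (\sum_p sg (xi (j, b, p))) / #|P|%:R.

(** A discrete analogue of the Gaussian smoothing of the criterion: each coordinate
    of theta is replaced by the mean of #|P| independent signs of that mean. *)
Definition smooth (P : finType) theta W : R :=
  Ex (signd (@bias P theta)) (fun xi => vmin (fun j => dot (average xi j) W)).

Lemma dotB u v W : dot u W - dot v W = \sum_b (u b - v b) * W b.
Proof. by rewrite /dot -sumrB; apply: eq_bigr => b _; rewrite mulrBl. Qed.

Lemma sqnormZ c u : sqnorm (fun b => c * u b) = c ^+ 2 * sqnorm u.
Proof. by rewrite /sqnorm mulr_sumr; apply: eq_bigr => b _; rewrite exprMn. Qed.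

Lemma sqnorm_ge0 u : 0 <= sqnorm u.
Proof. by apply: sumr_ge0 => b _; exact: sqr_ge0. Qed.

Lemma sum_I (P : finType) (F : I P -> R) :
  \sum_x F x = \sum_j \sum_b \sum_p F (j, b, p).
Proof.
rewrite pair_bigA/= pair_bigA/=; apply: eq_bigr => -[[j b] p] _ //.
Qed.

Lemma sum_bias_sqr (P : finType) theta :
  \sum_x @bias P theta x ^+ 2 = #|P|%:R * \sum_j sqnorm (theta j).
Proof.
rewrite sum_I mulr_sumr; apply: eq_bigr => j _; rewrite /sqnorm mulr_sumr.
apply: eq_bigr => b _; rewrite /bias/=.
by rewrite sumr_const mulr_natl.
Qed.

(** Weights on the index set that turn a linear form in the signs attached to the
    j-th vector into a form on all signs. *)
Definition row_weight (P : finType) (j : 'I_k.+1) W (x : I P) : R :=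
  if x.1.1 == j then W x.1.2 / #|P|%:R else 0.

Lemma sum_row_weight (P : finType) j W (F : I P -> R) :
  \sum_x F x * row_weight j W x = \sum_b (\sum_p F (j, b, p)) / #|P|%:R * W b.
Proof.
rewrite sum_I (bigD1 j)//= [X in _ + X]big1 ?addr0; last first.
  move=> i /negbTE ij; rewrite big1// => b _; rewrite big1// => p _.
  by rewrite /row_weight/= ij mulr0.
apply: eq_bigr => b _; rewrite -mulrA mulr_suml; apply: eq_bigr => p _.
by rewrite /row_weight/= eqxx (mulrC (W b)).
Qed.

Lemma sum_row_weight_sqr (P : finType) j W : (0 < #|P|)%N ->
  \sum_(x : I P) row_weight j W x ^+ 2 = sqnorm W / #|P|%:R.
Proof.
move=> P0; under eq_bigr do rewrite expr2.
rewrite sum_row_weight /sqnorm mulr_suml; apply: eq_bigr => b _.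
under eq_bigr do rewrite /row_weight/= eqxx.
rewrite sumr_const -mulr_natr; field.
by rewrite pnatr_eq0 -lt0n.
Qed.

Lemma bias_le2 (P : finType) theta : (forall j, sqnorm (theta j) <= 4^-1) ->
  forall x, `|@bias P theta x| <= 2^-1.
Proof.
move=> th [[j b] p]; rewrite /bias/= -(@ler_pXn2r _ 2)// ?nnegrE ?invr_ge0//.
rewrite real_normK ?num_real// exprVn (_ : 2 ^+ 2 = 4 :> R); last by rewrite expr2; lra.
apply: le_trans (th j); rewrite /sqnorm (bigD1 b)//= lerDl.
by apply: sumr_ge0 => *; exact: sqr_ge0.
Qed.

Section one_scale.
Variables (P : finType) (theta : 'I_k.+1 -> 'I_N -> R) (W : 'I_N -> R).
Hypothesis P0 : (0 < #|P|)%N.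
Hypothesis th1 : forall x, `|@bias P theta x| <= 1.

Let m0 : #|P|%:R != 0 :> R. Proof. by rewrite pnatr_eq0 -lt0n. Qed.

Lemma Ex_average j b : Ex (signd (@bias P theta)) (fun xi => average xi j b) = theta j b.
Proof.
rewrite /average; under eq_Ex do rewrite mulrC.
rewrite ExZ Ex_sum (eq_bigr (fun=> theta j b)); last by move=> p _; rewrite Ex_sign.
by rewrite sumr_const -(mulr_natr (theta j b)) mulrCA mulVf ?mulr1.
Qed.

Lemma noise_mgf l j :
  Ex (signd (@bias P theta)) (fun xi => expR (l * (dot (average xi j) W - dot (theta j) W)))
  <= expR (l ^+ 2 * (sqnorm W / #|P|%:R) / 2).
Proof.
have := signd_mgf (fun x => row_weight j (fun b => l * W b) x) th1.
rewrite -mulr_suml sum_row_weight_sqr// sqnormZ -(mulrA (l ^+ 2)).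
apply: le_trans; rewrite le_eqVlt; apply/orP; left; apply/eqP.
apply: eq_Ex => xi; congr expR; rewrite sum_row_weight dotB mulr_sumr.
apply: eq_bigr => b _; rewrite /average sumrB/= /bias/= sumr_const -(mulr_natr (theta j b)).
by field.
Qed.

(** The minimum is concave, so smoothing decreases it, by no more than the expected
    maximum of [k + 1] centred sub-Gaussian variables. *)
Lemma smooth_remainder : 0 <= vmin (fun j => dot (theta j) W) - smooth P theta W <=
  Num.sqrt (2 * ln k.+1%:R * (sqnorm W / #|P|%:R)).
Proof.
have dw := signd_dist th1.
have sq0 : 0 <= sqnorm W / #|P|%:R by rewrite divr_ge0 ?sumr_ge0// => *; exact: sqr_ge0.
apply/andP; split.
  rewrite subr_ge0 /smooth; apply: le_trans (Ex_vmin_le _ dw) _.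
  rewrite le_eqVlt; apply/orP; left; apply/eqP; apply: eq_vmin => j.
  rewrite /dot Ex_sum; apply: eq_bigr => b _.
  by rewrite -[in RHS](Ex_average j b) mulrC -ExZ; apply: eq_Ex => xi; rewrite mulrC.
rewrite /smooth -[X in X - _](Ex_cst dw) -ExB.
apply: (Ex_max_subgaussian (X := fun j xi => dot (theta j) W - dot (average xi j) W)) => //.
  move=> l j _; rewrite -sqrrN; apply: le_trans (noise_mgf _ _).
  by apply: le_Ex => // xi; rewrite mulNr -mulrN opprB.
by move=> xi; exact: vmin_sub_le.
Qed.

(** A square is at most a constant plus an exponential of rate [l]; the condition on
    [l] pays for summing the exponentials over both signs of the [k + 1] values. *)
Lemma smooth_second_moment l : sqnorm W <= #|P|%:R ->
  (forall j, `|dot (theta j) W| <= 1) ->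
  0 < l -> 2 * k.+1%:R * expR (- (l ^+ 2 / 2)) <= 1 -> 1 <= l ->
  Ex (signd (@bias P theta)) (fun xi => vmin (fun j => dot (average xi j) W) ^+ 2) <=
  (1 + l) ^+ 2 + 2 + 2 / l.
Proof.
move=> W1 d1 l0 hl l1; have dw := signd_dist th1.
(* this C gives both sides of quad the same derivative at tau *)
pose tau := 1 + l; pose C := 2 * tau / l.
have C0 : 0 <= C by rewrite /C /tau; apply: divr_ge0 => //; lra.
have CE : C = 2 + 2 / l by rewrite /C /tau; field; rewrite gt_eqF.
have quad y : 0 <= y -> y ^+ 2 <= tau ^+ 2 + C * expR (l * (y - tau)).
  move=> y0; have [yt|yt] := leP y tau.
    apply: (@le_trans _ _ (tau ^+ 2)); last by rewrite lerDl mulr_ge0 ?expR_ge0.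
    by rewrite ler_pXn2r// nnegrE; rewrite /tau; lra.
  set z := l * (y - tau).
  have z0 : 0 <= z by rewrite mulr_ge0 ?subr_ge0 ?ltW.
  have ez : (1 + z / 2) ^+ 2 <= expR z.
    have -> : expR z = expR (z / 2) ^+ 2 by rewrite -expRM_natl; congr expR; field.
    by rewrite ler_pXn2r ?nnegrE ?expR_ge0 ?expR_ge1Dx//; lra.
  apply: (@le_trans _ _ (tau ^+ 2 + C * (1 + z / 2) ^+ 2)); last first.
    by rewrite lerD2l ler_wpM2l.
  have -> : y ^+ 2 = tau ^+ 2 + 2 * tau * (y - tau) + (y - tau) ^+ 2 by ring.
  have -> : C * (1 + z / 2) ^+ 2 = C + 2 * tau * (y - tau) + tau * l / 2 * (y - tau) ^+ 2.
    by rewrite /C /z; field; rewrite gt_eqF.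
  have : 1 * (y - tau) ^+ 2 <= tau * l / 2 * (y - tau) ^+ 2.
    rewrite ler_wpM2r ?sqr_ge0//; have : 2 * 1 <= tau * l by rewrite ler_pM /tau//; lra.
    lra.
  rewrite mul1r; lra.
pose S j (xi : {ffun I P -> bool}) := expR (l * (dot (average xi j) W - dot (theta j) W)) +
  expR (- l * (dot (average xi j) W - dot (theta j) W)).
have hS xi : vmin (fun j => dot (average xi j) W) ^+ 2 <=
    tau ^+ 2 + C * expR (l * (1 - tau)) * \sum_j S j xi.
  have [j ->] := vmin_ex (fun j => dot (average xi j) W).
  set y := dot _ _; rewrite -real_normK ?num_real//.
  apply: le_trans (quad _ (normr_ge0 _)) _; rewrite lerD2l -mulrA ler_wpM2l//.
  apply: (@le_trans _ _ (expR (l * (1 - tau)) * S j xi)); last first.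
    rewrite ler_wpM2l ?expR_ge0// (bigD1 j)//= lerDl sumr_ge0// => i _.
    by rewrite addr_ge0// expR_ge0.
  rewrite /S -/y (mulrDr (expR _)) -!expRD.
  have := d1 j; rewrite ler_norml => /andP[da db].
  case: (ler0P y) => y0.
    rewrite ler_wpDl ?expR_ge0// ler_expR (_ : l * (1 - tau) + _ = l * (- y + (1 + dot (theta j) W) - tau)); last by ring.
    by rewrite ler_pM2l//; lra.
  rewrite ler_wpDr ?expR_ge0// ler_expR (_ : l * (1 - tau) + _ = l * (y + (1 - dot (theta j) W) - tau)); last by ring.
  by rewrite ler_pM2l//; lra.
apply: (@le_trans _ _ (tau ^+ 2 + C)); last by rewrite CE /tau; lra.
apply: le_trans (le_Ex dw hS) _; rewrite ExD Ex_cst// lerD2l ExZ -mulrA ler_piMr//.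
rewrite Ex_sum; apply: (@le_trans _ _ (expR (l * (1 - tau)) * \sum_(j < k.+1) (2 * expR (l ^+ 2 / 2)))).
  rewrite ler_wpM2l ?expR_ge0//; apply: ler_sum => j _; rewrite ExD mulr_natl mulr2n.
  have W2 : l ^+ 2 * (sqnorm W / #|P|%:R) / 2 <= l ^+ 2 / 2.
    rewrite ler_pM2r// ler_piMr ?sqr_ge0// ler_pdivrMr ?mul1r// ltr0n//.
  apply: lerD; first by apply: le_trans (noise_mgf _ _) _; rewrite ler_expR.
  by apply: le_trans (noise_mgf _ _) _; rewrite ler_expR sqrrN.
apply: (le_trans _ hl).
have -> : expR (- (l ^+ 2 / 2)) = expR (l * (1 - tau)) * expR (l ^+ 2 / 2).
  by rewrite -expRD; congr expR; rewrite /tau; field.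
rewrite sumr_const card_ord -(mulr_natr (2 * expR (l ^+ 2 / 2))).
by rewrite le_eqVlt; apply/orP; left; apply/eqP; ring.
Qed.

End one_scale.
End perturbed_min.


(** * Chaining over the number of replicas *)


Lemma sum_ord_le (R : realType) n (F : 'I_n -> R) c :
  (forall i, F i <= c) -> \sum_i F i <= n%:R * c.
Proof.
move=> le; apply: le_trans (ler_sum _ (fun i _ => le i)) _.
by rewrite sumr_const card_ord mulr_natl.
Qed.

Section doubling.
Context {R : realType} (k N : nat).
Local Notation I P := ('I_k.+1 * 'I_N * P)%type.
Implicit Types (theta : 'I_k.+1 -> 'I_N -> R) (W : 'I_N -> R).

Section one_doubling.
Variable P : finType.
Hypothesis P0 : (0 < #|P|)%N.

Definition pick_half (xi : {ffun I (P * bool) -> bool}) (s : {ffun I P -> bool}) :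
  {ffun I P -> bool} := [ffun x => xi (x.1, (x.2, s x))].

(** Loss of the minimum caused by halving the number of signs at random. It does not
    involve theta, and it is bounded for every value of the signs. *)
Definition halving_loss (xi : {ffun I (P * bool) -> bool}) W : R :=
  vmin (fun j => dot (average xi j) W) -
  Ex (@rad R (I P)) (fun s => vmin (fun j => dot (average (pick_half xi s) j) W)).

(** The signs kept out of independent pairs have the law of the smaller family. *)
Lemma smooth_doubling theta W : (forall j b, `|theta j b| <= 1) ->
  smooth (P * bool)%type theta W - smooth P theta W =
  Ex (signd (@bias R k N (P * bool)%type theta)) (fun xi => halving_loss xi W).
Proof.
move=> th1; rewrite /halving_loss ExB; congr (_ - _).
rewrite Ex_exchange (eq_Ex _ (psi := fun=> smooth P theta W)); last first.
  move=> s; pose sel (x : I P) : I (P * bool) := (x.1, (x.2, s x)).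
  have inj_sel : injective sel by move=> [x p] [y q] [-> ->].
  have dw : forall x, is_dist (signw (@bias R k N (P * bool)%type theta) x).
    by apply: signw_dist => -[[j b] p]; exact: th1.
  exact: (Ex_prodw_restrict (fun f => vmin (fun j => dot (average f j) W)) dw inj_sel).
by rewrite Ex_cst//; exact: signd_dist0.
Qed.

Lemma average_pick_half (xi : {ffun I (P * bool) -> bool}) s j b :
  average (pick_half xi s) j b - average xi j b =
  (\sum_p sg (s (j, b, p)) * ((sg (xi (j, b, (p, true))) - sg (xi (j, b, (p, false)))) / 2))
  / #|P|%:R :> R.
Proof.
have m0 : #|P|%:R != 0 :> R by rewrite pnatr_eq0 -lt0n.
rewrite /average card_prod card_bool natrM.
have -> : \sum_(p : P * bool) sg (xi (j, b, p)) =
  \sum_(p : P) (sg (xi (j, b, (p, true))) + sg (xi (j, b, (p, false)))) :> R.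
  rewrite (eq_bigr (fun p : P * bool => sg (xi (j, b, (p.1, p.2))))) => [|[p c] _]//.
  rewrite -(pair_bigA _ (fun p c => sg (xi (j, b, (p, c)))))/=.
  by apply: eq_bigr => p _; rewrite big_bool.
rewrite [X in X - _](_ : _ = (\sum_p 2 * sg (pick_half xi s (j, b, p))) / (#|P|%:R * 2)); last first.
  by rewrite -mulr_sumr; field.
rewrite -mulrBl -sumrB [in RHS]mulr_suml mulr_suml; apply: eq_bigr => p _.
by rewrite ffunE/=; case: (s (j, b, p)); rewrite /sg; field.
Qed.

Lemma halving_loss_bound xi W : 0 <= halving_loss xi W <=
  Num.sqrt (2 * ln k.+1%:R * (sqnorm W / #|P|%:R)).
Proof.
have dw := @signd_dist0 R (I P).
have sq0 : 0 <= sqnorm W / #|P|%:R by rewrite divr_ge0 ?sqnorm_ge0.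
have mgf (l : R) j : Ex (@rad R (I P)) (fun s => expR (l *
    (dot (average xi j) W - dot (average (pick_half xi s) j) W))) <=
    expR (l ^+ 2 * (sqnorm W / #|P|%:R) / 2).
  pose d (x : I P) : R := (sg (xi (x.1, (x.2, true))) - sg (xi (x.1, (x.2, false)))) / 2.
  have d1 x : d x ^+ 2 <= 1.
    by rewrite /d expr2; case: (xi _); case: (xi _); rewrite /sg; lra.
  pose c (x : I P) : R := - l * (d x * row_weight j W x).
  have mg := @rad_mgf R (I P) c.
  have le : \sum_x c x ^+ 2 / 2 <= l ^+ 2 * (sqnorm W / #|P|%:R) / 2.
    rewrite -mulr_suml ler_pM2r// -(@sum_row_weight_sqr R k N P j W)// mulr_sumr.
    apply: ler_sum => x _; rewrite /c exprMn sqrrN ler_wpM2l ?sqr_ge0//.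
    by rewrite exprMn ler_piMl ?sqr_ge0.
  rewrite -ler_expR in le; apply: le_trans (le_trans _ (le_trans mg le)) (lexx _).
  rewrite le_eqVlt; apply/orP; left; apply/eqP.
  apply: eq_Ex => s; congr expR.
  rewrite (eq_bigr (fun x => - l * (sg (s x) * d x * row_weight j W x))); last first.
    by move=> x _; rewrite /c; ring.
  rewrite -mulr_sumr sum_row_weight mulNr -mulrN; congr (l * _).
  rewrite -opprB dotB; congr (- _); apply: eq_bigr => b _; rewrite average_pick_half.
  by [].
have Exp j : dot (average xi j) W = Ex (@rad R (I P)) (fun s => dot (average (pick_half xi s) j) W).
  apply/eqP; rewrite eq_sym -subr_eq0 -[X in _ - X](Ex_cst dw) -ExB; apply/eqP.
  rewrite (eq_Ex _ (psi := fun s : {ffun I P -> bool} => \sum_b \sum_p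
     ((sg (xi (j, b, (p, true))) - sg (xi (j, b, (p, false)))) / 2 / #|P|%:R * W b) * sg (s (j, b, p)))).
    rewrite Ex_sum big1// => b _; rewrite Ex_sum big1// => p _.
    by rewrite ExZ Ex_sign ?mulr0// => *; rewrite normr0.
  move=> s; rewrite dotB; apply: eq_bigr => b _; rewrite average_pick_half.
  by rewrite !mulr_suml; apply: eq_bigr => p _; rewrite mulrC !mulrA; ring.
apply/andP; split.
  rewrite /halving_loss subr_ge0; apply: le_trans (Ex_vmin_le _ dw) _.
  by rewrite (eq_vmin Exp).
rewrite /halving_loss -[X in X - _](Ex_cst dw) -ExB.
apply: (Ex_max_subgaussian
  (X := fun j s => dot (average xi j) W - dot (average (pick_half xi s) j) W)) => //.
by move=> xi'; exact: vmin_sub_le.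
Qed.

End one_doubling.
End doubling.

Section chaining.
Context {R : realType} (k N n : nat).
Local Notation I P := ('I_k.+1 * 'I_N * P)%type.
Variables (A : Type) (theta : A -> 'I_k.+1 -> 'I_N -> R) (W W' : 'I_n -> 'I_N -> R).
Hypothesis th4 : forall a j, sqnorm (theta a j) <= 4^-1.
Hypothesis W4 : forall i, sqnorm (W i) <= 4.
Hypothesis W'4 : forall i, sqnorm (W' i) <= 4.
Hypothesis d1 : forall a j i, `|dot (theta a j) (W i)| <= 1.
Hypothesis d1' : forall a j i, `|dot (theta a j) (W' i)| <= 1.
Variable alpha : {ffun 'I_n -> bool} -> A.
Hypothesis k2 : (1 <= k)%N.

(** The parameter is a function of the signs: this stands for a supremum over all
    parameters without having to attain or even define it. *)
Definition rademacher (F : ('I_k.+1 -> 'I_N -> R) -> ('I_N -> R) -> R) : R :=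
  Ex (@rad R 'I_n) (fun e => \sum_i sg (e i) * (F (theta (alpha e)) (W' i) - F (theta (alpha e)) (W i))).

Lemma rademacher_sub F G : rademacher (fun t w => F t w - G t w) = rademacher F - rademacher G.
Proof.
rewrite /rademacher -ExB; apply: eq_Ex => e; rewrite -sumrB.
by apply: eq_bigr => i _; ring.
Qed.

Let lnk0 : 0 <= ln k.+1%:R :> R.
Proof. by rewrite ln_ge0// ler1n. Qed.

(** The cost of one scale: the entropy grows like #|P| while the squared range of the
    loss decreases like 1 / #|P|, so that the bound is the same at all scales. *)
Lemma rademacher_doubling (P : finType) : (0 < #|P|)%N ->
  rademacher (smooth (P * bool)%type) - rademacher (smooth P) <=
  Num.sqrt (14 / 3 * k.+1%:R * n%:R * ln k.+1%:R).
Proof.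
move=> P0; rewrite -rademacher_sub.
have th1 a x : `|@bias R k N (P * bool)%type (theta a) x| <= 2^-1 by apply: bias_le2.
have th1' a x : `|@bias R k N (P * bool)%type (theta a) x| <= 1.
  by apply: le_trans (th1 a x) _; lra.
have m0 : 0 < #|P|%:R :> R by rewrite ltr0n.
pose D2 : R := 2 * ln k.+1%:R * (4 / #|P|%:R).
have D20 : 0 <= D2 by rewrite !mulr_ge0 ?invr_ge0// ltW.
have loss (w : 'I_N -> R) (xi : {ffun I (P * bool) -> bool}) : sqnorm w <= 4 -> 0 <= halving_loss xi w <= Num.sqrt D2.
  move=> w4; have /andP[-> /le_trans->]// := @halving_loss_bound R k N P P0 xi w.
  by rewrite ler_wsqrtr// ler_wpM2l ?mulr_ge0// ler_pM2r ?invr_gt0.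
pose Z (xi : {ffun I (P * bool) -> bool}) i : R := halving_loss xi (W' i) - halving_loss xi (W i).
have := @pac_bayes_rademacher R {ffun I (P * bool) -> bool} 'I_n A (signd (fun=> 0))
  (fun a => signd (@bias R k N (P * bool)%type (theta a))) Z
  (7 / 12 * k.+1%:R * #|P|%:R / 2) (n%:R * D2) alpha (signd_dist0 _) (@signd0_gt0 _ _)
  (fun a => signd_dist (th1' a)).
rewrite (_ : 2 * (7 / 12 * k.+1%:R * #|P|%:R / 2) * (n%:R * D2) =
  14 / 3 * k.+1%:R * n%:R * ln k.+1%:R); last by rewrite /D2; field; rewrite gt_eqF.
move=> /(_ _ _ _ _)/wrap[||||].
- by rewrite !mulr_ge0// ?invr_ge0 ?ltW.
- by rewrite mulr_ge0.
- move=> a; apply: le_trans (signd_entropy (th1 a)) _.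
  rewrite sum_bias_sqr card_prod card_bool natrM.
  have : \sum_j sqnorm (theta a j) <= k.+1%:R / 4.
    apply: le_trans (ler_sum _ (fun j _ => th4 a j)) _.
    by rewrite sumr_const card_ord mulr_natl.
  move=> h; rewrite (_ : 7 / 12 * k.+1%:R * #|P|%:R / 2 =
    7 / 12 * (#|P|%:R * 2 * (k.+1%:R / 4))); last by field.
  by rewrite ler_wpM2l// ler_wpM2l// mulr_ge0 ?ltW.
- move=> a; apply: Ex_le_cst => [|xi]; first exact: signd_dist.
  apply: sum_ord_le => i.
  rewrite -[leRHS](sqr_sqrtr D20) -real_normK ?num_real// ler_pXn2r ?nnegrE ?sqrtr_ge0//.
  have /andP[? ?] := loss _ xi (W4 i); have /andP[? ?] := loss _ xi (W'4 i).
  by rewrite /Z ler_norml; apply/andP; split; lra.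
apply: le_trans; rewrite le_eqVlt; apply/orP; left; apply/eqP.
apply: eq_Ex => e; rewrite Ex_sum; apply: eq_bigr => i _.
have thb j b : `|theta (alpha e) j b| <= 1.
  have [p _] : exists p, p \in P by apply/card_gt0P.
  exact: (th1' (alpha e) (j, b, (p, true))).
by rewrite !smooth_doubling// -ExB -ExZ.
Qed.

(** The coarsest scale has no finer increment to exploit: the second moment of the
    perturbed minimum itself is used. *)
Lemma rademacher_base (P : finType) l : #|P| = 4 ->
  2 * k.+1%:R * expR (- (l ^+ 2 / 2)) <= 1 -> 1 <= l ->
  rademacher (smooth P) <=
  Num.sqrt (14 / 3 * k.+1%:R * n%:R * ((1 + l) ^+ 2 + 2 + 2 / l)).
Proof.
move=> P4 hl l1.
have l0 : 0 < l by lra.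
have th1 a x : `|@bias R k N P (theta a) x| <= 2^-1 by apply: bias_le2.
have th1' a x : `|@bias R k N P (theta a) x| <= 1.
  by apply: le_trans (th1 a x) _; lra.
pose v : R := (1 + l) ^+ 2 + 2 + 2 / l.
have v0 : 0 <= v by rewrite !addr_ge0 ?sqr_ge0// divr_ge0// ltW.
pose Z (xi : {ffun I P -> bool}) i : R := vmin (fun j => dot (average xi j) (W' i))
  - vmin (fun j => dot (average xi j) (W i)).
have := @pac_bayes_rademacher R {ffun I P -> bool} 'I_n A (signd (fun=> 0))
  (fun a => signd (@bias R k N P (theta a))) Z
  (7 / 12 * k.+1%:R) (n%:R * (4 * v)) alpha (signd_dist0 _) (@signd0_gt0 _ _)
  (fun a => signd_dist (th1' a)).
rewrite (_ : 2 * (7 / 12 * k.+1%:R) * (n%:R * (4 * v)) = 14 / 3 * k.+1%:R * n%:R * v); last by field.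
move=> /(_ _ _ _ _)/wrap[||||].
- by rewrite mulr_ge0.
- by rewrite !mulr_ge0.
- move=> a; apply: le_trans (signd_entropy (th1 a)) _.
  rewrite sum_bias_sqr P4.
  have : \sum_j sqnorm (theta a j) <= k.+1%:R / 4.
    apply: le_trans (ler_sum _ (fun j _ => th4 a j)) _.
    by rewrite sumr_const card_ord mulr_natl.
  by move=> h; lra.
- move=> a; rewrite Ex_sum; apply: sum_ord_le => i.
  have dw := signd_dist (th1' a).
  have P0 : (0 < #|P|)%N by rewrite P4.
  have s2 (w : 'I_N -> R) : sqnorm w <= 4 -> (forall j, `|dot (theta a j) w| <= 1) ->
     Ex (signd (@bias R k N P (theta a))) (fun xi => vmin (fun j => dot (average xi j) w) ^+ 2) <= v.
    by move=> w4 dw1; apply: smooth_second_moment => //; rewrite P4.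
  apply: (@le_trans _ _ (Ex (signd (@bias R k N P (theta a)))
     (fun xi => 2 * vmin (fun j => dot (average xi j) (W' i)) ^+ 2 +
                2 * vmin (fun j => dot (average xi j) (W i)) ^+ 2))).
    apply: le_Ex => // xi; rewrite /Z; set x := vmin _; set y := vmin _.
    by rewrite -subr_ge0 (_ : _ - _ = (x + y) ^+ 2) ?sqr_ge0//; ring.
  rewrite ExD !ExZ.
  have h := s2 _ (W4 i) (d1 a ^~ i); have h' := s2 _ (W'4 i) (d1' a ^~ i).
  by lra.
apply: le_trans; rewrite le_eqVlt; apply/orP; left; apply/eqP.
apply: eq_Ex => e; rewrite Ex_sum; apply: eq_bigr => i _.
by rewrite /smooth -ExB -ExZ.
Qed.

(** Four signs per coordinate to begin with, so that vectors of squared norm at most 4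
    have unit noise. *)
Fixpoint replicas (l : nat) : finType :=
  if l is l'.+1 then (replicas l' * bool)%type else (bool * bool)%type.

Lemma card_replicas l : #|replicas l| = (4 * 2 ^ l)%N.
Proof.
elim: l => [|l IH]; first by rewrite card_prod card_bool.
by rewrite card_prod card_bool IH expnSr mulnA.
Qed.

(** Telescoping over [L] doublings; the last term is the error of the finest scale. *)
Lemma rademacher_vmin (L : nat) l :
  2 * k.+1%:R * expR (- (l ^+ 2 / 2)) <= 1 -> 1 <= l ->
  rademacher (fun t w => vmin (fun j => dot (t j) w)) <=
  Num.sqrt (14 / 3 * k.+1%:R * n%:R * ((1 + l) ^+ 2 + 2 + 2 / l)) +
  L%:R * Num.sqrt (14 / 3 * k.+1%:R * n%:R * ln k.+1%:R) +
  n%:R * Num.sqrt (2 * ln k.+1%:R / 2 ^+ L).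
Proof.
move=> hl l1.
have chain : rademacher (smooth (replicas L)) <=
  Num.sqrt (14 / 3 * k.+1%:R * n%:R * ((1 + l) ^+ 2 + 2 + 2 / l)) +
  L%:R * Num.sqrt (14 / 3 * k.+1%:R * n%:R * ln k.+1%:R).
  elim: L => [|L IH].
    by rewrite mul0r addr0; apply: rademacher_base => //; exact: (card_replicas 0).
  have P0 : (0 < #|replicas L|)%N by rewrite card_replicas muln_gt0 expn_gt0.
  have : rademacher (smooth (replicas L.+1)) - rademacher (smooth (replicas L)) <= _ :=
    rademacher_doubling P0.
  by rewrite -[L.+1%:R]natr1 (mulrDl L%:R) mul1r; lra.
have P0 : (0 < #|replicas L|)%N by rewrite card_replicas muln_gt0 expn_gt0.
suff : rademacher (fun t w => vmin (fun j => dot (t j) w)) - rademacher (smooth (replicas L)) <=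
    n%:R * Num.sqrt (2 * ln k.+1%:R / 2 ^+ L) by lra.
rewrite -rademacher_sub; apply: Ex_le_cst => [|e]; first exact: signd_dist0.
apply: sum_ord_le => i.
set a := alpha e.
have th1 x : `|@bias R k N (replicas L) (theta a) x| <= 1.
  by apply: le_trans (bias_le2 (th4 a) x) _; lra.
have bd (w : 'I_N -> R) : sqnorm w <= 4 -> 0 <= vmin (fun j => dot (theta a j) w) - smooth (replicas L) (theta a) w <=
    Num.sqrt (2 * ln k.+1%:R / 2 ^+ L).
  move=> w4; have /andP[-> /le_trans->]// := smooth_remainder w P0 th1.
  rewrite ler_wsqrtr// ler_wpM2l ?mulr_ge0// card_replicas natrM natrX.
  by rewrite ler_pdivrMr ?mulr_gt0 ?exprn_gt0// mulrC -mulrA divff ?mulr1 ?expf_neq0.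
have /andP[? ?] := bd _ (W4 i); have /andP[? ?] := bd _ (W'4 i).
by rewrite /sg; case: (e i); lra.
Qed.

End chaining.


Section rate_of_convergence.
Context {R : realType}.

Lemma sqr_le_cancel (u v : R) : 0 <= v -> u ^+ 2 <= v ^+ 2 -> u <= v.
Proof.
move=> v0 uv; have [u0|u0] := leP 0 u; last exact: le_trans (ltW u0) v0.
by move: uv; rewrite ler_pXn2r.
Qed.

Lemma ln2_lower : 56 / 85 <= ln 2 :> R.
Proof.
have h : ln (78 / 85 : R) <= - (7 / 85).
  by apply: le_trans (ln_le_subr1 _) _; lra.
have : ln (2^-1 : R) <= ln ((78 / 85) ^+ 8 : R).
  by rewrite ler_ln ?posrE ?exprn_gt0 ?invr_gt0// !exprS expr0; lra.
rewrite lnV ?posrE// lnXn; last lra.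
rewrite -[ln _ *+ 8]mulr_natl; lra.
Qed.

Lemma few_scales (i : nat) : (1 <= i)%N -> (i < 8)%N ->
  i%:R ^+ 2 * (448 / 85) < 2 ^+ i.+1 :> R -> False.
Proof. by case: i => [|[|[|[|[|[|[|[|i]]]]]]]]// _ _; rewrite !exprS !expr0; lra. Qed.

(** All three terms of the rate scale as the square root of [k / n]. *)
Lemma rate_factor (k n : nat) : (0 < n)%N ->
  rate R n k.+1 = Num.sqrt (k.+1%:R / n%:R) *
    (ln (n%:R / k.+1%:R) / ln 2 * (Num.sqrt 8 * Num.sqrt (ln k.+1%:R)) +
     2 * Num.sqrt (ln k.+1%:R) +
     Num.sqrt ((Num.sqrt 2 + 1) * (3 + 2 * ln k.+1%:R))).
Proof.
move=> n0; rewrite /rate; set y := _ / ln 2; clearbody y.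
have K1 : 1 <= k.+1%:R :> R by rewrite ler1n.
have M0 : n%:R != 0 :> R by rewrite pnatr_eq0 -lt0n.
have := ln_ge0 K1; move: K1; set K : R := k.+1%:R; set M : R := n%:R in M0 *.
move=> K1 l0; set l := ln K in l0 *; clearbody l.
have K0 : 0 <= K by exact: le_trans ler01 K1.
have sM (u : R) : 0 <= u -> Num.sqrt (u * (K / M)) = Num.sqrt (K / M) * Num.sqrt u.
  by move=> u0; rewrite sqrtrM// mulrC.
rewrite (_ : 8 * K * l / M = 8 * l * (K / M)); last by field.
rewrite (_ : K * l / M = l * (K / M)); last by field.
rewrite (_ : (Num.sqrt 2 + 1) * K * (3 + 2 * l) / M = (Num.sqrt 2 + 1) * (3 + 2 * l) * (K / M)); last by field.
rewrite !sM ?mulr_ge0// ?addr_ge0 ?mulr_ge0 ?sqrtr_ge0// (sqrtrM l (ler0n R 8)).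
by ring.
Qed.

Lemma number_of_scales (s x a K M : R) (L : nat) : 0 < K -> 0 < M -> 0 < s -> 0 <= x -> 0 <= a ->
  s ^+ 2 = K / M -> a ^+ 2 = 8 -> 56 / 85 <= x ^+ 2 -> (1 <= L)%N -> M / K < 2 ^+ L.+1 ->
  s * (L%:R * (a * x)) < 1 -> (8 <= L)%N.
Proof.
move=> K0 M0 s0 x0 a0 s2 a2 xx L1 Llt h1.
rewrite leqNgt; apply/negP => L7.
have h2 : (s * (L%:R * (a * x))) ^+ 2 < 1.
  by rewrite expr_lt1// !mulr_ge0// ltW.
have h3 : L%:R ^+ 2 * (8 * x ^+ 2) < M / K.
  move: h2; rewrite !exprMn s2 a2 => h2.
  rewrite -(@ltr_pM2l _ (K / M)) ?divr_gt0// (_ : K / M * (M / K) = 1) //.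
  by field; rewrite !gt_eqF.
apply: (few_scales L1 L7); apply: le_lt_trans (lt_trans h3 Llt).
rewrite ler_wpM2l ?sqr_ge0//; move: xx; clear; lra.
Qed.

(** The coarsest scale is paid by what eight finer scales leave of their budget. *)
Lemma coarsest_scale (x l t a b : R) : 81 / 100 <= x -> 8 / 5 <= l -> l <= 2 * x ->
  8 / 3 <= t -> 12 / 5 * (3 + 2 * x ^+ 2) <= t ^+ 2 -> 26 / 5 <= 8 * (a - b) ->
  0 <= b -> b ^+ 2 = 14 / 3 ->
  b * Num.sqrt ((1 + l) ^+ 2 + 2 + 2 / l) <= 8 * (a - b) * x + t.
Proof.
move=> x0 l0 l2x Tl T2 D b0 b2; set v := _ + 2 / l.
have x00 : 0 <= x by apply: le_trans x0.
have t00 : 0 <= t by apply: le_trans Tl.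
have l00 : 0 < l by apply: lt_le_trans l0.
have v0 : 0 <= v by rewrite !addr_ge0 ?sqr_ge0// divr_ge0// ltW.
have h1 : 2 / l <= 5 / 4 by rewrite ler_pdivrMr//; move: l0; clear; lra.
have h2 : (1 + l) ^+ 2 <= 1 + 4 * x + 4 * x ^+ 2.
  rewrite (_ : _ + 4 * x ^+ 2 = (1 + 2 * x) ^+ 2); last by ring.
  by rewrite ler_pXn2r ?nnegrE ?addr_ge0 ?mulr_ge0 ?(ltW l00)// lerD2l.
have vx : v <= 4 * x ^+ 2 + 4 * x + 17 / 4 by rewrite /v; move: h1 h2; clear; lra.
apply: (@le_trans _ _ (26 / 5 * x + t)); last by rewrite lerD2r ler_wpM2r.
have xT : x * (8 / 3) <= x * t by rewrite ler_wpM2l.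
apply: sqr_le_cancel; first by rewrite addr_ge0 ?mulr_ge0.
rewrite exprMn b2 sqr_sqrtr//; clearbody v.
rewrite (_ : (26 / 5 * x + t) ^+ 2 = 676 / 25 * x ^+ 2 + 52 / 5 * (x * t) + t ^+ 2); last by field.
have xx : 81 / 100 * x <= x ^+ 2 by rewrite expr2 ler_wpM2r.
by move: vx xT T2 xx x0; clear; lra.
Qed.

(** When the rate is below 1, at least eight scales are summed, and the entropy bound
    7/12 gains enough over 1 at each of them to pay for the coarsest scale. *)
Lemma chaining_le_rate (k n : nat) : (1 <= k)%N -> (2 * k.+1 <= n)%N ->
  rate R n k.+1 < 1 ->
  exists L l, [/\ 2 * k.+1%:R * expR (- (l ^+ 2 / 2)) <= 1, 1 <= l &
  Num.sqrt (14 / 3 * k.+1%:R * n%:R * ((1 + l) ^+ 2 + 2 + 2 / l)) +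
  L%:R * Num.sqrt (14 / 3 * k.+1%:R * n%:R * ln k.+1%:R) +
  n%:R * Num.sqrt (2 * ln k.+1%:R / 2 ^+ L) <= n%:R * rate R n k.+1].
Proof.
move=> k1 kn; have n0 : (0 < n)%N by apply: leq_trans kn; rewrite muln_gt0.
rewrite (rate_factor k n0).
set K : R := k.+1%:R; set M : R := n%:R.
have K2 : 2 <= K by rewrite /K ler_nat.
have K0 : 0 < K by apply: lt_le_trans K2.
have M0 : 0 < M by rewrite /M ltr0n.
have lnKge : 56 / 85 <= ln K by apply: (le_trans ln2_lower); rewrite ler_ln ?posrE.
have lnK0 : 0 <= ln K by apply: le_trans lnKge.
set x := Num.sqrt (ln K); set s := Num.sqrt (K / M).
set a : R := Num.sqrt 8; pose b : R := Num.sqrt (14 / 3).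
set t := Num.sqrt (_ * _); set y := ln (M / K) / ln 2.
have x2 : x ^+ 2 = ln K by rewrite sqr_sqrtr.
have s2 : s ^+ 2 = K / M by rewrite sqr_sqrtr// divr_ge0 ?ltW.
have s0 : 0 < s by rewrite sqrtr_gt0 divr_gt0.
have a0 : 0 <= a by exact: sqrtr_ge0.
have b0 : 0 <= b by exact: sqrtr_ge0.
have a2 : a ^+ 2 = 8 by rewrite sqr_sqrtr.
have b2 : b ^+ 2 = 14 / 3 by rewrite sqr_sqrtr// divr_ge0.
have x0 : 81 / 100 <= x.
  apply: sqr_le_cancel; first exact: sqrtr_ge0.
  by rewrite x2 expr2; move: lnKge; clear; lra.
have x00 : 0 <= x by exact: sqrtr_ge0.
have D : 26 / 5 <= 8 * (a - b).
  have : 141 / 50 <= a.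
    by apply: sqr_le_cancel => //; rewrite a2 expr2; clear; lra.
  have : b <= 13 / 6.
    by apply: sqr_le_cancel; rewrite ?b2 ?expr2; clear; lra.
  by clear; lra.
have T2 : 12 / 5 * (3 + 2 * x ^+ 2) <= t ^+ 2.
  have sqrt2 : 7 / 5 <= Num.sqrt 2 :> R.
    apply: sqr_le_cancel; first exact: sqrtr_ge0.
    by rewrite sqr_sqrtr// expr2; clear; lra.
  have q0 : 0 <= 3 + 2 * ln K by rewrite addr_ge0// mulr_ge0.
  rewrite x2 [leRHS]sqr_sqrtr; last by rewrite mulr_ge0// addr_ge0// sqrtr_ge0.
  rewrite ler_wpM2r//.
  by move: sqrt2; clear; lra.
have Tl : 8 / 3 <= t.
  apply: sqr_le_cancel; first exact: sqrtr_ge0.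
  by apply: le_trans T2; rewrite x2 expr2; move: lnKge; clear; lra.
have xE : Num.sqrt (ln K) = x by [].
clearbody t b.
pose L := trunc_log 2 (n %/ k.+1).
have nk2 : (2 <= n %/ k.+1)%N by rewrite leq_divRL.
have L1 : (1 <= L)%N by rewrite /L trunc_log_gt0//.
have /andP[Lle Llt] := @trunc_log_bounds 2 (n %/ k.+1) isT (ltnW nk2).
have Lle' : 2 ^+ L <= M / K.
  rewrite ler_pdivlMr// /K /M -natrX -natrM ler_nat.
  by rewrite -leq_divRL.
have Llt' : M / K < 2 ^+ L.+1.
  rewrite ltr_pdivrMr// /K /M -natrX -natrM ltr_nat.
  by rewrite -ltn_divLR.
have yL : L%:R <= y.
  rewrite /y ler_pdivlMr ?ln_gt0 ?ltr1n//.
  by rewrite mulr_natl -lnXn// ler_ln// ?posrE ?exprn_gt0// divr_gt0.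
clearbody y L.
have yx : L%:R * (a * x) <= y * (a * x) by rewrite ler_wpM2r// mulr_ge0.
move=> r1.
have L8 : (8 <= L)%N.
  apply: (number_of_scales K0 M0 s0 x00 a0 s2 a2 _ L1 Llt'); first by rewrite x2.
  apply: le_lt_trans r1; rewrite ler_pM2l//.
  by rewrite -addrA (le_trans yx)// lerDl addr_ge0 ?mulr_ge0// (le_trans _ Tl).
pose l := Num.sqrt (2 * ln (2 * K)).
have lnKK : ln (2 * K) = ln 2 + ln K by rewrite lnM ?posrE.
have ln2K : ln 2 <= ln K by rewrite ler_ln ?posrE.
have l2 : l ^+ 2 = 2 * ln (2 * K).
  by rewrite sqr_sqrtr// mulr_ge0// lnKK addr_ge0// ln_ge0// ler1n.
have l0 : 8 / 5 <= l.
  apply: sqr_le_cancel; first exact: sqrtr_ge0.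
  by rewrite l2 lnKK expr2; move: (ln2_lower) lnKge; clear; lra.
have l2x : l <= 2 * x.
  apply: sqr_le_cancel; first by rewrite mulr_ge0.
  by rewrite l2 lnKK exprMn x2; move: ln2K; clear; lra.
exists L, l; split.
- rewrite l2 (_ : 2 * ln (2 * K) / 2 = ln (2 * K)); last by field.
  by rewrite expRN lnK ?posrE ?mulr_gt0// -/K divff// mulf_neq0// gt_eqF.
- by apply: le_trans l0; rewrite ler_pdivlMr// mul1r ler_nat.
have bv := coarsest_scale x0 l0 l2x Tl T2 D b0 b2.
move: bv; set v := _ + 2 / l => bv.
have v0 : 0 <= v by rewrite !addr_ge0 ?sqr_ge0// divr_ge0// sqrtr_ge0.
have -> : M * (s * (y * (a * x) + 2 * x + t)) = M * s * (y * (a * x)) + M * s * t + M * (s * (2 * x)) by ring.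
apply: lerD; last first.
  rewrite ler_pM2l//; apply: sqr_le_cancel; first by rewrite !mulr_ge0// ltW.
  rewrite sqr_sqrtr; last by rewrite divr_ge0 ?mulr_ge0 ?exprn_ge0.
  rewrite !exprMn s2 x2 -[2 ^+ 2]/(2 * 2) ler_pdivrMr ?exprn_gt0//.
  rewrite exprS in Llt'.
  have : M / K * (K / M) <= 2 * 2 ^+ L * (K / M) by rewrite ler_wpM2r ?divr_ge0 ?ltW.
  rewrite (_ : M / K * (K / M) = 1) => [h|]; last by field; rewrite !gt_eqF.
  have : 1 * (2 * ln K) <= 2 * 2 ^+ L * (K / M) * (2 * ln K) by rewrite ler_wpM2r// mulr_ge0.
  rewrite mul1r => /le_trans; apply; rewrite le_eqVlt; apply/orP; left; apply/eqP; ring.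
have sq (u : R) : 0 <= u -> Num.sqrt (14 / 3 * K * M * u) = M * s * (b * Num.sqrt u).
  move=> u0; have -> : 14 / 3 * K * M * u = (M * s * b) ^+ 2 * u.
    by rewrite !exprMn s2 b2; field; rewrite gt_eqF.
  rewrite (sqrtrM u (sqr_ge0 (M * s * b))) sqrtr_sqr ger0_norm ?mulrA//.
  by rewrite !mulr_ge0// ltW.
rewrite !sq// xE.
have -> : M * s * (b * Num.sqrt v) + L%:R * (M * s * (b * x)) = M * s * (b * Num.sqrt v + L%:R * (b * x)) by ring.
rewrite -mulrDr ler_pM2l ?mulr_gt0//.
have L8' : 8 <= L%:R :> R by rewrite (ler_nat _ 8).
have h2 : 8 * ((a - b) * x) <= L%:R * ((a - b) * x).
  by rewrite ler_wpM2r// mulr_ge0//; move: D; clear; lra.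
by move: bv yx h2; clear; lra.
Qed.

End rate_of_convergence.


(** * Coordinates in a space with a positive form *)


Section gram_matrices.
Context {R : realType}.

Definition psd (J : finType) (G : J -> J -> R) :=
  forall c : J -> R, 0 <= \sum_i \sum_j c i * c j * G i j.

Lemma sum_ord_recl2 m (F : 'I_m.+1 -> 'I_m.+1 -> R) :
  \sum_i \sum_j F i j = F ord0 ord0 + \sum_j F ord0 (lift ord0 j) +
    \sum_i F (lift ord0 i) ord0 + \sum_i \sum_j F (lift ord0 i) (lift ord0 j).
Proof.
rewrite big_ord_recl [X in X + _]big_ord_recl.
rewrite [X in _ + X](eq_bigr (fun i => F (lift ord0 i) ord0 + \sum_j F (lift ord0 i) (lift ord0 j))).
  by rewrite big_split/= addrA.
by move=> i _; rewrite big_ord_recl.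
Qed.

(** Elimination of the first vector. A vanishing pivot of a positive form has a
    vanishing row, so that dividing by it with [x / 0 = 0] remains correct. *)
Lemma cholesky_ord m (G : 'I_m -> 'I_m -> R) :
  (forall i j, G i j = G j i) -> psd G ->
  exists r : 'I_m -> 'I_m -> R, forall i j, G i j = \sum_b r i b * r j b.
Proof.
elim: m G => [|m IH] G Gs Gp; first by exists (fun _ _ => 0) => -[].
pose a := G ord0 ord0; pose g i := G (lift ord0 i) ord0.
have split_sum (c0 : R) (c : 'I_m -> R) :
    0 <= c0 ^+ 2 * a + 2 * c0 * (\sum_i c i * g i) +
      \sum_i \sum_j c i * c j * G (lift ord0 i) (lift ord0 j).
  have := Gp (fun i => oapp c c0 (unlift ord0 i)).
  rewrite sum_ord_recl2 unlift_none/= -/a.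
  rewrite (eq_bigr (fun j => c0 * (c j * g j))); last first.
    by move=> j _; rewrite liftK/= Gs -/(g _) mulrA.
  rewrite [X in _ + _ + X + _](eq_bigr (fun j => c0 * (c j * g j))); last first.
    by move=> j _; rewrite liftK/= -/(g _); ring.
  rewrite [X in _ + _ + X](eq_bigr (fun i => \sum_j c i * c j * G (lift ord0 i) (lift ord0 j))); last first.
    by move=> i _; apply: eq_bigr => j _; rewrite !liftK.
  rewrite -!mulr_sumr.
  by move=> h; apply: le_trans h _; rewrite le_eqVlt; apply/orP; left; apply/eqP; ring.
have a0 : 0 <= a.
  have := split_sum 1 (fun=> 0); rewrite expr1n mul1r big1 => [|i _]; last by rewrite mul0r.
  by rewrite mulr0 addr0 big1 ?addr0// => i _; rewrite big1// => j _; rewrite !mul0r.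
have g0 i : a = 0 -> g i = 0.
  move=> az; apply: contrapT => /eqP gi.
  pose c0 := - (G (lift ord0 i) (lift ord0 i) + 1) / (2 * g i).
  have := split_sum c0 (fun j => (j == i)%:R).
  rewrite az mulr0 add0r (bigD1 i)//= big1 => [|j /negbTE ->]; last by rewrite mul0r.
  rewrite eqxx mul1r addr0 (bigD1 i)//= [X in _ + (_ + X)]big1 => [|j /negbTE ->]; last first.
    by rewrite big1// => *; rewrite !mul0r.
  rewrite addr0 (bigD1 i)//= big1 => [|j /negbTE ->]; last by rewrite mulr0 mul0r.
  rewrite eqxx !mul1r addr0 (_ : 2 * c0 * g i = - (G (lift ord0 i) (lift ord0 i) + 1)).
    by lra.
  by rewrite /c0; field.
pose G' i j := G (lift ord0 i) (lift ord0 j) - g i * g j / a.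
have [||r rE] := IH G'.
- by move=> i j; rewrite /G' Gs (mulrC (g i)).
- move=> c; set s := \sum_i c i * g i.
  have := split_sum (- s / a) c; rewrite -/s => h.
  apply: le_trans h _.
  rewrite [leRHS](_ : _ = (\sum_i \sum_j c i * c j * G (lift ord0 i) (lift ord0 j)) - s * s / a).
    have [->|an0] := eqVneq a 0; first by rewrite invr0 le_eqVlt; apply/orP; left; apply/eqP; ring.
    by rewrite le_eqVlt; apply/orP; left; apply/eqP; field.
  rewrite /s !mulr_suml -sumrB; apply: eq_bigr => i _.
  rewrite mulr_sumr mulr_suml -sumrB; apply: eq_bigr => j _.
  by rewrite /G'; ring.
pose r' i b := oapp (fun b' => oapp (fun i' => r i' b') 0 (unlift ord0 i))
  (G i ord0 / Num.sqrt a) (unlift ord0 b).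
have sa : Num.sqrt a * Num.sqrt a = a by rewrite -expr2 sqr_sqrtr.
have sag i j : G i ord0 / Num.sqrt a * (G j ord0 / Num.sqrt a) = G i ord0 * G j ord0 / a.
  by rewrite mulrACA -invfM sa.
exists r' => i j; rewrite big_ord_recl /r' unlift_none/= sag.
rewrite (eq_bigr (fun b => oapp (r ^~ b) 0 (unlift ord0 i) * oapp (r ^~ b) 0 (unlift ord0 j))); last first.
  by move=> b _; rewrite liftK.
have [i' ->|->] := unliftP ord0 i; have [j' ->|->] := unliftP ord0 j.
- by rewrite /= -rE /G' -/(g i') -/(g j') addrC subrK.
- rewrite /= big1 => [|b _]; last by rewrite mulr0.
  rewrite addr0 -/(g i') -/a; have [az|an0] := eqVneq a 0; last by rewrite mulfK.
  by rewrite g0// !mul0r.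
- rewrite /= big1 => [|b _]; last by rewrite mul0r.
  rewrite addr0 Gs -/(g j') -/a; have [az|an0] := eqVneq a 0; last by rewrite mulrAC divff ?mul1r.
  by rewrite g0// mulr0 mul0r.
- rewrite /= big1 => [|b _]; last by rewrite mulr0.
  rewrite addr0 -/a; have [->|an0] := eqVneq a 0; last by rewrite mulfK.
  by rewrite !mul0r.
Qed.

Lemma cholesky (J : finType) (G : J -> J -> R) :
  (forall i j, G i j = G j i) -> psd G ->
  exists N (r : J -> 'I_N -> R), forall i j, G i j = \sum_b r i b * r j b.
Proof.
move=> Gs Gp.
have [||r rE] := @cholesky_ord #|J| (fun i j => G (enum_val i) (enum_val j)).
- by move=> i j; exact: Gs.
- move=> c; apply: le_trans (Gp (fun i => c (enum_rank i))) _.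
  rewrite (reindex (@enum_val J J))/=; last by apply: onW_bij; exact: enum_val_bij.
  rewrite le_eqVlt; apply/orP; left; apply/eqP; apply: eq_bigr => i _.
  rewrite (reindex (@enum_val J J))/=; last by apply: onW_bij; exact: enum_val_bij.
  by apply: eq_bigr => j _; rewrite !enum_valK.
exists #|J|, (fun i => r (enum_rank i)) => i j.
by rewrite -rE !enum_rankK.
Qed.

End gram_matrices.


Section rademacher_hilbert.
Context {R : realType} (V : Type) (form : V -> V -> R).
Hypothesis formC : forall u v, form u v = form v u.
Hypothesis form_psd : forall (J : finType) (v : J -> V), psd (fun i j => form (v i) (v j)).

Lemma dot_le1 N (u w : 'I_N -> R) : sqnorm u <= 4^-1 -> sqnorm w <= 4 -> `|dot u w| <= 1.
Proof.
move=> u4 w4.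
have h (c : R) : c ^+ 2 = 1 -> c * dot u w <= 1.
  move=> c2; apply: (@le_trans _ _ (\sum_b (2 * u b ^+ 2 + 8^-1 * w b ^+ 2))).
    rewrite /dot mulr_sumr; apply: ler_sum => b _; rewrite -subr_ge0.
    rewrite (_ : _ - _ = 2 * (u b - c / 4 * w b) ^+ 2 + (1 - c ^+ 2) / 8 * w b ^+ 2); last by field.
    by rewrite c2 subrr !mul0r addr0 mulr_ge0// sqr_ge0.
  by rewrite big_split/= -!mulr_sumr; rewrite /sqnorm in u4 w4; lra.
rewrite ler_norml -lerN2 opprK; apply/andP; split.
  by have := h (-1); rewrite sqrrN expr1n mulN1r; apply.
by have := h 1; rewrite expr1n mul1r; apply.
Qed.

(** Maximal deviation of minima of affine functionals of bounded vectors, in any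
    space with a positive form. Only finitely many vectors are involved, so they have
    coordinates; the constant part is one more coordinate. *)
Lemma rademacher_min_affine (k n : nat) (A : Type)
    (q : A -> 'I_k.+1 -> V) (h : A -> 'I_k.+1 -> R) (u u' : 'I_n -> V)
    (B C H : R) (alpha : {ffun 'I_n -> bool} -> A) :
  0 < B -> 0 < C -> 0 < H ->
  (forall a j, form (q a j) (q a j) <= B ^+ 2) ->
  (forall a j, `|h a j| <= H) ->
  (forall i, form (u i) (u i) <= C ^+ 2) ->
  (forall i, form (u' i) (u' i) <= C ^+ 2) ->
  (1 <= k)%N -> (2 * k.+1 <= n)%N -> rate R n k.+1 < 1 ->
  Ex (@rad R 'I_n) (fun e => \sum_i sg (e i) *
    (vmin (fun j => h (alpha e) j - form (q (alpha e) j) (u' i)) -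
     vmin (fun j => h (alpha e) j - form (q (alpha e) j) (u i)))) <=
  n%:R * rate R n k.+1 * (B * C + H).
Proof.
move=> B0 C0 H0 qB hH uC u'C k1 kn r1.
pose J := ((({ffun 'I_n -> bool} * 'I_k.+1) + ('I_n * bool))%type : finType).
pose v (x : J) : V := match x with
  | inl (e, j) => q (alpha e) j | inr (i, b) => if b then u' i else u i end.
have [N [r rE]] := cholesky (fun i j => formC (v i) (v j)) (form_psd v).
pose M := B * C + H.
have M0 : 0 < M by rewrite addr_gt0// mulr_gt0.
(* the weight of the constant coordinate for which the product of the norms of the two
   families is least, namely M *)
pose beta := Num.sqrt (B / (C * H)).
have beta2 : beta ^+ 2 = B / (C * H) by rewrite sqr_sqrtr// divr_ge0 ?mulr_ge0// ltW.
have beta0 : 0 < beta by rewrite sqrtr_gt0 divr_gt0// mulr_gt0.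
pose S := Num.sqrt (B * M / C).
have S2 : S ^+ 2 = B * M / C by rewrite sqr_sqrtr// divr_ge0 ?mulr_ge0// ltW.
have S0 : 0 < S by rewrite sqrtr_gt0 divr_gt0// mulr_gt0.
pose theta (e : {ffun 'I_n -> bool}) (j : 'I_k.+1) (b : 'I_N.+1) : R :=
  (2 * S)^-1 * oapp (r (inl (e, j))) (beta * h (alpha e) j) (unlift ord0 b).
pose W (c : bool) (i : 'I_n) (b : 'I_N.+1) : R :=
  (2 * S / M) * oapp (fun b' => - r (inr (i, c)) b') beta^-1 (unlift ord0 b).
have sq_oapp N' (x : R) (y : 'I_N' -> R) :
    sqnorm (fun b : 'I_N'.+1 => oapp y x (unlift ord0 b)) = x ^+ 2 + sqnorm y.
  rewrite /sqnorm big_ord_recl unlift_none/=; congr (_ + _).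
  by apply: eq_bigr => b _; rewrite liftK.
have th4 e j : sqnorm (theta e j) <= 4^-1.
  rewrite /theta sqnormZ sq_oapp exprMn beta2.
  have -> : sqnorm (r (inl (e, j))) = form (q (alpha e) j) (q (alpha e) j).
    by rewrite (rE (inl (e, j)) (inl (e, j))); apply: eq_bigr => b _; rewrite expr2.
  rewrite exprVn exprMn S2 mulrC ler_pdivrMr; last first.
    by rewrite mulr_gt0// ?divr_gt0 ?mulr_gt0// exprn_gt0.
  have h2 : h (alpha e) j ^+ 2 <= H ^+ 2.
    by rewrite -real_normK ?num_real// ler_pXn2r ?nnegrE ?(ltW H0).
  have : B / (C * H) * h (alpha e) j ^+ 2 <= B / (C * H) * H ^+ 2.
    by rewrite ler_wpM2l// divr_ge0 ?mulr_ge0// ltW.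
  have := qB (alpha e) j.
  have -> : 4^-1 * (2 ^+ 2 * (B * M / C)) = B / (C * H) * H ^+ 2 + B ^+ 2.
    by rewrite /M; field; rewrite !gt_eqF.
  lra.
have W4 c i : sqnorm (W c i) <= 4.
  rewrite /W sqnormZ sq_oapp exprVn beta2.
  have -> : sqnorm (fun b' => - r (inr (i, c)) b') = form (if c then u' i else u i) (if c then u' i else u i).
    rewrite (rE (inr (i, c)) (inr (i, c))); apply: eq_bigr => b _.
    by rewrite sqrrN expr2.
  have uu : form (if c then u' i else u i) (if c then u' i else u i) <= C ^+ 2 by case: c.
  rewrite exprMn exprVn exprMn S2.
  apply: (@le_trans _ _ (2 ^+ 2 * (B * M / C) * M ^- 2 * ((B / (C * H))^-1 + C ^+ 2))).
    rewrite ler_wpM2l ?lerD2l// !mulr_ge0 ?invr_ge0 ?exprn_ge0// ltW//.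
  by rewrite le_eqVlt; apply/orP; left; apply/eqP; rewrite /M; field; rewrite !gt_eqF.
have dotE e j c i : h (alpha e) j - form (q (alpha e) j) (if c then u' i else u i) =
    M * dot (theta e j) (W c i).
  rewrite /dot big_ord_recl /theta /W unlift_none/=.
  rewrite (eq_bigr (fun b => - M^-1 * (r (inl (e, j)) b * r (inr (i, c)) b))); last first.
    by move=> b _; rewrite liftK/=; field; rewrite !gt_eqF.
  rewrite -mulr_sumr -(rE (inl (e, j)) (inr (i, c)))/=.
  by field; rewrite !gt_eqF.
have [L [l [hl l1 Hle]]] := chaining_le_rate k1 kn r1.
have := rademacher_vmin th4 (W4 false) (W4 true) 
  (fun e j i => dot_le1 (th4 e j) (W4 false i)) (fun e j i => dot_le1 (th4 e j) (W4 true i)) id L hl l1.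
move=> /le_trans/(_ Hle); rewrite -(ler_pM2l M0) -/M [leRHS]mulrC.
apply: le_trans; rewrite /rademacher -ExZ le_eqVlt; apply/orP; left; apply/eqP.
apply: eq_Ex => e; rewrite mulr_sumr; apply: eq_bigr => i _.
rewrite mulrCA (mulrBr M) -!vminZ ?(ltW M0)//; congr (_ * (_ - _)); apply: eq_vmin => j.
  exact: (dotE e j true i).
exact: (dotE e j false i).
Qed.

End rademacher_hilbert.


(** * Deviations on finite product spaces *)


Section vector_max.
Context {R : realType} (k : nat).
Implicit Types f g : 'I_k.+1 -> R.

Definition vmax f : R := - vmin (fun j => - f j).

Lemma vmax_ge f j : f j <= vmax f.
Proof. by rewrite /vmax lerNr vmin_le. Qed.

Lemma vmax_ex f : exists j, vmax f = f j.
Proof. by have [j E] := vmin_ex (fun j => - f j); exists j; rewrite /vmax E opprK. Qed.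

Lemma vmax_le f c : (forall j, f j <= c) -> vmax f <= c.
Proof. by have [j ->] := vmax_ex f. Qed.

Lemma vmax_lip f g c : (forall j, f j - g j <= c) -> vmax f - vmax g <= c.
Proof.
have [j ->] := vmax_ex f => h; apply: le_trans (h j).
by rewrite lerD2l lerN2 vmax_ge.
Qed.

Lemma vmax_Ex_le (T : finType) (w : T -> R) (f : T -> 'I_k.+1 -> R) :
  is_dist w -> vmax (fun j => Ex w (f^~ j)) <= Ex w (fun t => vmax (f t)).
Proof. by move=> dw; apply: vmax_le => j; apply: le_Ex => // t; exact: vmax_ge. Qed.

End vector_max.

Section concentration.
Context {R : realType} (V : finType) (w : V -> R).
Hypothesis dw : is_dist w.

Local Notation pw n := (prodw (fun _ : 'I_n => w)).

(** Convexity of the exponential. *)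
Lemma expR_chord (p h : R) : 0 <= p <= 1 -> expR (p * h) <= (1 - p) + p * expR h.
Proof.
move=> /andP[p0 p1].
have e1 : expR (p * h) * (1 + (1 - p) * h) <= expR h.
  rewrite -[in leRHS](_ : p * h + (1 - p) * h = h); last by ring.
  by rewrite expRD ler_pM2l ?expR_gt0// expR_ge1Dx.
have e2 : expR (p * h) * (1 + - (p * h)) <= 1.
  rewrite -[leRHS](_ : expR (p * h) * expR (- (p * h)) = 1); last by rewrite -expRD subrr expR0.
  by rewrite ler_pM2l ?expR_gt0// expR_ge1Dx.
have {}e1 := ler_wpM2l p0 e1.
have p1' : 0 <= 1 - p by lra.
have {}e2 := ler_wpM2l p1' e2.
have := lerD e1 e2; set X := expR (p * h); set Y := expR h.
rewrite (_ : p * (X * (1 + (1 - p) * h)) + (1 - p) * (X * (1 + - (p * h))) = X); last by ring.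
by rewrite mulr1 addrC.
Qed.

(** By convexity the extreme case is a variable with two values. *)
Lemma hoeffding_mgf (phi : V -> R) (c l : R) :
  (forall x y, phi x - phi y <= c) ->
  Ex w (fun x => expR (l * (phi x - Ex w phi))) <= expR (l ^+ 2 * c ^+ 2 / 8).
Proof.
move=> osc.
have [v0 _] : exists v : V, true.
  apply: contrapT => no; have := dw.2; rewrite big1.
    by move/eqP; rewrite eq_sym oner_eq0.
  by move=> t _; case: no; exists t.
have [m _ mmin] := @arg_minP _ R V v0 xpredT phi isT.
have c0 : 0 <= c by have := osc m m; rewrite subrr.
have [c00|cn0] := eqVneq c 0.
  rewrite c00 expr0n mulr0 mul0r expR0; apply: Ex_le_cst => // x.
  have E y : phi y = phi m.
    by have := osc y m; have := mmin y isT; rewrite c00; lra.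
  by rewrite E (eq_Ex _ E) Ex_cst// subrr mulr0 expR0.
have {cn0}c1 : 0 < c by rewrite lt0r cn0.
pose p x := (phi x - phi m) / c.
have p01 x : 0 <= p x <= 1.
  rewrite /p divr_ge0 ?subr_ge0 ?mmin//= ler_pdivrMr// mul1r; exact: osc.
have phiE x : phi x = phi m + p x * c by rewrite /p; field; rewrite gt_eqF.
pose pb := Ex w p.
have pb01 : 0 <= pb <= 1.
  rewrite /pb Ex_ge0 ?Ex_le_cst// => x; by case/andP: (p01 x).
have Ephi : Ex w phi = phi m + pb * c.
  rewrite (eq_Ex _ phiE) ExD Ex_cst// /pb; congr (_ + _).
  by rewrite (eq_Ex _ (psi := fun x => c * p x)) ?ExZ 1?mulrC// => x; rewrite mulrC.
have := hoeffding_bernoulli (l * c) pb01.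
have le : Ex w (fun x => expR (p x * (l * c))) <= 1 - pb + pb * expR (l * c).
  apply: (@le_trans _ _ (Ex w (fun x => 1 + (expR (l * c) - 1) * p x))).
    apply: le_Ex => // x; apply: le_trans (expR_chord (l * c) (p01 x)) _.
    by rewrite le_eqVlt; apply/orP; left; apply/eqP; ring.
  by rewrite ExD Ex_cst// ExZ -/pb; lra.
move=> /(le_trans le) h.
rewrite (eq_Ex _ (psi := fun x => expR (- (pb * (l * c))) * expR (p x * (l * c)))); last first.
  by move=> x; rewrite -expRD Ephi phiE; congr expR; ring.
rewrite ExZ; apply: le_trans (ler_wpM2l (expR_ge0 _) h) _.
by rewrite -expRD addKr exprMn.
Qed.

Definition fcons n (v : V) (f : {ffun 'I_n -> V}) : {ffun 'I_n.+1 -> V} :=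
  [ffun i => oapp f v (unlift ord0 i)].

Lemma Ex_fcons n (phi : {ffun 'I_n.+1 -> V} -> R) :
  Ex (pw n.+1) phi = Ex w (fun v => Ex (pw n) (fun f => phi (fcons v f))).
Proof.
rewrite /Ex; under [RHS]eq_bigr do rewrite mulr_sumr.
rewrite pair_bigA/= (reindex (fun u : V * {ffun 'I_n -> V} => fcons u.1 u.2))/=; last first.
  exists (fun f => (f ord0, [ffun i => f (lift ord0 i)])) => [[v f] _|f _]/=.
    rewrite ffunE unlift_none/=; congr (_, _).
    by apply/ffunP => i; rewrite !ffunE liftK.
  apply/ffunP => i; rewrite ffunE; have [j ->|->] := unliftP ord0 i; last by [].
  by rewrite /= ffunE.
apply: eq_bigr => -[v f] _ /=; rewrite mulrA; congr (_ * _).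
rewrite /prodw big_ord_recl ffunE unlift_none/=; congr (_ * _).
by apply: eq_bigr => i _; rewrite ffunE liftK.
Qed.

Lemma pw_dist n : is_dist (pw n).
Proof. by apply: is_dist_prodw. Qed.

(** The mean over the remaining coordinates varies by at most [c] with the first one:
    Hoeffding's lemma applies to one coordinate after the other. *)
Lemma mcdiarmid_mgf n (phi : {ffun 'I_n -> V} -> R) (c l : R) :
  (forall (f g : {ffun 'I_n -> V}) i, (forall j, j != i -> f j = g j) -> phi f - phi g <= c) ->
  Ex (pw n) (fun f => expR (l * (phi f - Ex (pw n) phi))) <= expR (n%:R * (l ^+ 2 * c ^+ 2 / 8)).
Proof.
elim: n phi => [|n IH] phi bd.
  rewrite mul0r expR0; apply: Ex_le_cst => [|f]; first exact: pw_dist.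
  have E g : phi g = phi f by congr phi; apply/ffunP => -[].
  by rewrite (eq_Ex _ E) Ex_cst ?subrr ?mulr0 ?expR0//; exact: pw_dist.
pose psi v := Ex (pw n) (fun f => phi (fcons v f)).
have Epsi : Ex (pw n.+1) phi = Ex w psi by rewrite Ex_fcons.
rewrite Ex_fcons Epsi.
apply: (@le_trans _ _ (Ex w (fun v => expR (n%:R * (l ^+ 2 * c ^+ 2 / 8)) * expR (l * (psi v - Ex w psi))))).
  apply: le_Ex => // v.
  have := IH (fun f => phi (fcons v f)); rewrite -/(psi v) => /(_ _)/wrap[].
    move=> f g i fg; apply: (bd _ _ (lift ord0 i)) => j ji; rewrite !ffunE.
    have [j' E|_//] := unliftP ord0 j; apply: fg; apply: contra ji => /eqP j'i.
    by rewrite E j'i.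
  move=> h; rewrite (eq_Ex _ (psi := fun f => expR (l * (psi v - Ex w psi)) * expR (l * (phi (fcons v f) - psi v)))).
    by rewrite ExZ mulrC ler_wpM2r// expR_ge0.
  by move=> f; rewrite -expRD; congr expR; ring.
rewrite ExZ -[n.+1%:R]natr1 mulrDl expRD mul1r ler_wpM2l ?expR_ge0//.
apply: hoeffding_mgf => x y; rewrite /psi -ExB; apply: Ex_le_cst => [|f]; first exact: pw_dist.
apply: (bd _ _ ord0) => j j0; rewrite !ffunE; have [//|E] := unliftP ord0 j.
by rewrite E eqxx in j0.
Qed.

Lemma mcdiarmid_tail n (phi : {ffun 'I_n -> V} -> R) (c t : R) :
  (0 < n)%N -> 0 < c -> 0 <= t ->
  (forall (f g : {ffun 'I_n -> V}) i, (forall j, j != i -> f j = g j) -> phi f - phi g <= c) ->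
  Ex (pw n) (fun f => (Ex (pw n) phi + t < phi f)%R%:R) <= expR (- (2 * t ^+ 2 / (n%:R * c ^+ 2))).
Proof.
move=> n0 c0 t0 bd.
have N0 : 0 < n%:R :> R by rewrite ltr0n.
pose l := 4 * t / (n%:R * c ^+ 2).
have l0 : 0 <= l by apply: divr_ge0; apply: mulr_ge0; rewrite ?sqr_ge0 ?(ltW N0).
have := mcdiarmid_mgf l bd.
rewrite -(ler_pM2l (expR_gt0 (- (l * t)))) -expRD -ExZ.
rewrite (_ : - (l * t) + _ = - (2 * t ^+ 2 / (n%:R * c ^+ 2))); last first.
  by rewrite /l; field; rewrite !gt_eqF.
apply: le_trans; apply: le_Ex => [|f]; first exact: pw_dist.
case: (ltP (_ + t)) => h; last by rewrite mulr_ge0 ?expR_ge0.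
rewrite -expRD -[X in X <= _]expR0 ler_expR.
rewrite (_ : _ + _ = l * (phi f - Ex (pw n) phi - t)); last by ring.
by rewrite mulr_ge0//; lra.
Qed.

(** Symmetrisation: replacing the mean by an independent copy and exchanging the two
    copies at random reduces the mean deviation to Rademacher sums at fixed points. *)
Lemma symmetrization n N (f : 'I_N.+1 -> V -> R) (rho : R) :
  (forall (x x' : 'I_n -> V) (alpha : {ffun 'I_n -> bool} -> 'I_N.+1),
    Ex (@rad R 'I_n) (fun e => \sum_i sg (e i) * (f (alpha e) (x' i) - f (alpha e) (x i))) <= rho) ->
  Ex (pw n) (fun v => vmax (fun a => \sum_i (Ex w (f a) - f a (v i)))) <= rho.
Proof.
move=> hrho; have dp := pw_dist n.
pose G (v v' : {ffun 'I_n -> V}) := vmax (fun a => \sum_i (f a (v' i) - f a (v i))).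
apply: (@le_trans _ _ (Ex (pw n) (fun v => Ex (pw n) (fun v' => G v v')))).
  apply: le_Ex => // v; apply: le_trans (vmax_Ex_le _ dp).
  apply: vmax_le => a.
  rewrite (_ : \sum_i _ = Ex (pw n) (fun v' => \sum_i (f a (v' i) - f a (v i)))); first exact: vmax_ge.
  rewrite Ex_sum; apply: eq_bigr => i _; rewrite ExB Ex_cst//; congr (_ - _).
  by rewrite Ex_prodw_coord.
pose swap (e : {ffun 'I_n -> bool}) (u : {ffun 'I_n -> V} * {ffun 'I_n -> V}) :=
  ([ffun i => if e i then u.1 i else u.2 i], [ffun i => if e i then u.2 i else u.1 i]).
have swapK e : involutive (swap e).
  by move=> [v v']; congr (_, _); apply/ffunP => i; rewrite !ffunE/=; case: (e i).
have inv e : Ex (pw n) (fun v => Ex (pw n) (fun v' => G v v')) =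
    Ex (pw n) (fun v => Ex (pw n) (fun v' => G (swap e (v, v')).1 (swap e (v, v')).2)).
  rewrite /Ex; under eq_bigr do rewrite mulr_sumr.
  under [RHS]eq_bigr do rewrite mulr_sumr.
  rewrite !pair_bigA/= (reindex_inj (inv_inj (swapK e)))/=.
  apply: eq_bigr => -[v v'] _ /=; rewrite !mulrA; congr (_ * _).
  rewrite /prodw -!big_split/=; apply: eq_bigr => i _.
  by rewrite !ffunE/=; case: (e i) => //; rewrite mulrC.
have drad := @signd_dist0 R 'I_n.
rewrite -[leLHS](Ex_cst drad) (eq_Ex _ inv) Ex_exchange.
apply: Ex_le_cst => // v; rewrite Ex_exchange; apply: Ex_le_cst => // v'.
have hex e : exists a, G (swap e (v, v')).1 (swap e (v, v')).2 =
    \sum_i sg (e i) * (f a (v' i) - f a (v i)).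
  have [a E] := vmax_ex (fun a => \sum_i (f a ((swap e (v, v')).2 i) - f a ((swap e (v, v')).1 i))).
  exists a; rewrite /G E; apply: eq_bigr => i _.
  by rewrite !ffunE/= /sg; case: (e i); rewrite ?mul1r ?mulN1r ?opprB.
have [alpha alphaE] := choice hex.
by rewrite (eq_Ex _ alphaE); exact: hrho.
Qed.

End concentration.

Section deviations.
Context {R : realType} (V : finType) (w : V -> R) (n N : nat).
Variables (f : 'I_N.+1 -> V -> R) (g : V -> R) (M M' rho : R).
Hypothesis dw : is_dist w.
Hypothesis n0 : (0 < n)%N.
Hypothesis fM : forall a x, 0 <= f a x <= M.
Hypothesis gM : forall x, 0 <= g x <= M'.
Hypothesis frho : forall (x x' : 'I_n -> V) (alpha : {ffun 'I_n -> bool} -> 'I_N.+1),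
  Ex (@rad R 'I_n) (fun e => \sum_i sg (e i) * (f (alpha e) (x' i) - f (alpha e) (x i))) <= rho.

Local Notation pw := (prodw (fun _ : 'I_n => w)).

Definition deviation (v : {ffun 'I_n -> V}) : R :=
  vmax (fun a => Ex w (f a) - (\sum_i f a (v i)) / n%:R) + ((\sum_i g (v i)) / n%:R - Ex w g).

Let N0 : 0 < n%:R :> R. Proof. by rewrite ltr0n. Qed.

Lemma Ex_deviation : Ex pw deviation <= rho / n%:R.
Proof.
rewrite /deviation ExD [X in _ + X](_ : _ = 0) ?addr0; last first.
  rewrite ExB Ex_cst; last exact: pw_dist.
  rewrite (eq_Ex _ (psi := fun v : {ffun 'I_n -> V} => n%:R^-1 * \sum_i g (v i))); last by move=> v; rewrite mulrC.
  rewrite ExZ Ex_sum (eq_bigr (fun=> Ex w g)); last by move=> i _; rewrite Ex_prodw_coord.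
  by rewrite sumr_const card_ord -[Ex w g *+ n]mulr_natl mulKf ?subrr ?gt_eqF.
rewrite ler_pdivlMr// mulrC -ExZ; apply: le_trans (symmetrization dw frho).
apply: le_Ex => [|v]; first exact: pw_dist.
have [a ->] := vmax_ex (fun a => Ex w (f a) - (\sum_i f a (v i)) / n%:R).
apply: le_trans (vmax_ge _ a); rewrite sumrB sumr_const card_ord -[Ex w (f a) *+ n]mulr_natl.
by rewrite mulrBr mulrC [X in _ - X]mulrC divfK// gt_eqF.
Qed.

Lemma deviation_tail t : 0 < M + M' -> 0 <= t ->
  Ex pw (fun v => (rho / n%:R + t < deviation v)%R%:R) <=
  expR (- (2 * n%:R * t ^+ 2 / (M + M') ^+ 2)).
Proof.
move=> MM t0; pose c := (M + M') / n%:R.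
have c0 : 0 < c by rewrite divr_gt0.
have := @mcdiarmid_tail R V w dw n deviation c t n0 c0 t0.
rewrite (_ : 2 * t ^+ 2 / (n%:R * c ^+ 2) = 2 * n%:R * t ^+ 2 / (M + M') ^+ 2); last first.
  by rewrite /c; field; rewrite !gt_eqF.
move=> /(_ _)/wrap[].
  move=> u v i uv; rewrite /deviation.
  have single (h : V -> R) K : (forall x, 0 <= h x <= K) ->
      (\sum_j h (u j)) / n%:R - (\sum_j h (v j)) / n%:R <= K / n%:R.
    move=> hK; rewrite -mulrBl ler_pM2r ?invr_gt0// (bigD1 i)//= [X in _ - X](bigD1 i)//=.
    rewrite (eq_bigr (fun j => h (v j))) => [|j ji]; last by rewrite uv.
    have /andP[_ ?] := hK (u i); have /andP[? _] := hK (v i); lra.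
  have single' (h : V -> R) K : (forall x, 0 <= h x <= K) ->
      (\sum_j h (v j)) / n%:R - (\sum_j h (u j)) / n%:R <= K / n%:R.
    move=> hK; rewrite -mulrBl ler_pM2r ?invr_gt0// (bigD1 i)//= [X in _ - X](bigD1 i)//=.
    rewrite (eq_bigr (fun j => h (u j))) => [|j ji]; last by rewrite uv.
    have /andP[_ ?] := hK (v i); have /andP[? _] := hK (u i); lra.
  have := single g M' gM.
  have : vmax (fun a => Ex w (f a) - (\sum_i f a (u i)) / n%:R) -
         vmax (fun a => Ex w (f a) - (\sum_i f a (v i)) / n%:R) <= M / n%:R.
    by apply: vmax_lip => a; have := single' (f a) M (fM a); lra.
  by rewrite /c mulrDl; lra.
apply: le_trans; apply: le_Ex => [|v]; first exact: pw_dist.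
case: (ltP (_ + t)) => h //=.
have -> // : (Ex pw deviation + t < deviation v) = true.
by apply: le_lt_trans h; rewrite lerD2r Ex_deviation.
Qed.

End deviations.


(** * Deviations for general samples *)


Section finite_valued.
Context {R : realType} d (T : measurableType d) (Q : probability T R).
Variables (V : finType) (Y : T -> V).
Hypothesis mY : forall v, measurable (Y @^-1` [set v]).

Definition law (v : V) : R := fine (Q (Y @^-1` [set v])).

Lemma measurable_finite_preimage (A : set V) : measurable (Y @^-1` A).
Proof.
rewrite (_ : Y @^-1` A = \bigcup_(v in A) Y @^-1` [set v]); last first.
  by apply/seteqP; split => [x Ax|x [v Av e]]; [by exists (Y x)|by rewrite /preimage/= e].
by apply: fin_bigcup_measurable => //; exact: finite_finset.
Qed.

Lemma finite_valuedE (Psi : V -> R) x : Psi (Y x) = \sum_v Psi v * \1_(Y @^-1` [set v]) x.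
Proof.
rewrite (bigD1 (Y x))//= big1 => [|v vY].
  by rewrite addr0 indicE mem_set ?mulr1.
by rewrite indicE memNset ?mulr0//= => e; rewrite e eqxx in vY.
Qed.

Lemma finite_valued_integrable (Psi : V -> R) :
  Q.-integrable [set: T] (EFin \o (fun x => Psi (Y x))).
Proof.
rewrite (_ : _ \o _ = fun x => (\sum_v (Psi v)%:E * (\1_(Y @^-1` [set v]) x)%:E)%E); last first.
  by apply/funext => x /=; rewrite finite_valuedE -sumEFin; apply: eq_bigr => v _; rewrite EFinM.
apply: integrable_sum => // v _; apply: integrableZl => //.
exact: integrable_indic.
Qed.

Lemma finite_valued_integral (Psi : V -> R) :
  \int[Q]_x Psi (Y x) = Ex law Psi.
Proof.
rewrite /Rintegral (eq_integral (fun x => \sum_v (Psi v)%:E * (\1_(Y @^-1` [set v]) x)%:E)%E); last first.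
  by move=> x _; rewrite finite_valuedE -sumEFin; apply: eq_bigr => v _; rewrite EFinM.
rewrite integral_sum//; last first.
  by move=> v; apply: integrableZl => //; exact: integrable_indic.
rewrite (eq_bigr (fun v => (law v * Psi v)%:E)) => [|v _]; first by rewrite sumEFin.
rewrite integralZl//; last exact: integrable_indic.
by rewrite integral_indic// setIT /law EFinM fineK ?fin_num_measure// muleC.
Qed.

Lemma law_dist : is_dist law.
Proof.
split => [v|]; first by rewrite fine_ge0.
rewrite -[LHS](_ : Ex law (fun=> 1) = _); last by apply: eq_bigr => v _; rewrite mulr1.
rewrite -finite_valued_integral /Rintegral integral_cst// mul1e.
exact: (congr1 fine (probability_setT Q)).
Qed.

Lemma finite_valued_proba (b : V -> bool) :
  Q [set x | b (Y x)] = (Ex law (fun v => (b v)%:R))%:E.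
Proof.
have mb : measurable [set x | b (Y x)] by exact: (measurable_finite_preimage [set v | b v]).
rewrite -finite_valued_integral /Rintegral.
rewrite (eq_integral (fun x => (\1_[set x | b (Y x)] x)%:E)); last first.
  move=> x _; rewrite indicE; have [h|h] := boolP (b (Y x)); first by rewrite mem_set.
  by rewrite memNset//=; exact/negP.
by rewrite integral_indic// setIT fineK ?fin_num_measure.
Qed.

End finite_valued.

Section finite_sample.
Context {R : realType} d (Om : measurableType d) dS (S : measurableType dS).
Context (P : probability Om R) (X : {RV P >-> S}) (n : nat) (Xs : 'I_n -> {RV P >-> S}).
Hypothesis iid : independent_copies X Xs.
Variables (V : finType) (phi : S -> V).
Hypothesis mphi : forall v, measurable (phi @^-1` [set v]).

Definition codes (om : Om) : {ffun 'I_n -> V} := [ffun i => phi (Xs i om)].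

Lemma codes_preimage v : codes @^-1` [set v] =
  \bigcap_(i in [set: 'I_n]) (Xs i @^-1` (phi @^-1` [set v i])).
Proof.
apply/seteqP; split => [om /= <- i _ /=|om h]; first by rewrite ffunE.
by apply/ffunP => i; rewrite ffunE; exact: h.
Qed.

Lemma measurable_codes v : measurable (codes @^-1` [set v]).
Proof.
rewrite codes_preimage; apply: fin_bigcap_measurable; first exact: finite_finset.
by move=> i _; exact: measurable_funPTI.
Qed.

Lemma law_codes v : law P codes v = prodw (fun _ : 'I_n => law (distribution P X) phi) v.
Proof.
have [ind idd] := iid.
rewrite /law codes_preimage ind => [|i]; last exact: mphi.
have E i : P (Xs i @^-1` (phi @^-1` [set v i])) = (fine (distribution P X (phi @^-1` [set v i])))%:E.
  by rewrite -(idd i _ (mphi (v i))) fineK ?fin_num_measure//; exact: measurable_funPTI.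
have -> : (\prod_(i < n) P (Xs i @^-1` (phi @^-1` [set v i])) =
    (\prod_(i < n) law (distribution P X) phi (v i))%R%:E)%E.
  elim/big_rec2: _ => // i y1 y2 _ ->.
  by rewrite E EFinM.
by [].
Qed.

End finite_sample.


Lemma prob_bounded_integrable d (T : measurableType d) (R : realType)
    (Q : probability T R) (f : T -> R) (M : R) :
  measurable_fun [set: T] f -> (forall x, `|f x| <= M) ->
  Q.-integrable [set: T] (EFin \o f).
Proof.
move=> mf fM; apply: (le_integrable measurableT _ _ (finite_measure_integrable_cst Q M measurableT)).
  exact/measurable_EFinP.
by move=> x _ /=; rewrite lee_fin (le_trans (fM x))// ler_norm.
Qed.

Lemma integrable_EFinB d (T : measurableType d) (R : realType)
    (Q : {measure set T -> \bar R}) (f g : T -> R) :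
  Q.-integrable [set: T] (EFin \o f) -> Q.-integrable [set: T] (EFin \o g) ->
  Q.-integrable [set: T] (EFin \o (fun x => f x - g x)).
Proof. by move=> fi gi; have := integrableB measurableT fi gi. Qed.

Lemma measurable_gt_set d (T : measurableType d) (R : realType) (f : T -> R) c :
  measurable_fun [set: T] f -> measurable [set x | c < f x].
Proof.
move=> mf; rewrite (_ : [set _ | _] = [set: T] `&` f @^-1` [set` `]c, +oo[]).
  exact: mf.
by rewrite setTI; apply/seteqP; split => x /=; rewrite in_itv/= andbT.
Qed.

Lemma measurable_vmin d (T : measurableType d) (R : realType) k (f : 'I_k.+1 -> T -> R) :
  (forall j, measurable_fun [set: T] (f j)) ->
  measurable_fun [set: T] (fun x => vmin (f ^~ x)).
Proof.
move=> mf; rewrite /vmin.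
elim: (index_enum _) => [|j r IH].
  by apply: (eq_measurable_fun (f ord0)) => // x _; rewrite big_nil.
apply: (eq_measurable_fun (fun x => Num.min (f j x)
  (\big[Num.min/f ord0 x]_(i <- r) f i x))) => [x _|]; first by rewrite big_cons.
exact: measurable_minr.
Qed.

Lemma measurable_vmax d (T : measurableType d) (R : realType) k (f : 'I_k.+1 -> T -> R) :
  (forall j, measurable_fun [set: T] (f j)) ->
  measurable_fun [set: T] (fun x => vmax (f ^~ x)).
Proof.
move=> mf; rewrite /vmax; apply: measurableT_comp => //.
by apply: measurable_vmin => j; exact: measurableT_comp.
Qed.

Section discretization.
Context {R : realType} d (S : measurableType d) (m : nat) (H : 'I_m -> S -> R) (K : R).
Hypothesis mH : forall a, measurable_fun [set: S] (H a).
Hypothesis HK : forall a x, 0 <= H a x <= K.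

(** The cells are the level sets of the values rounded to multiples of [eta]. *)
Lemma discretize (s0 : S) (eta : R) : 0 < eta -> exists (V : finType) (phi : S -> V) (rep : V -> S),
  (forall v, measurable (phi @^-1` [set v])) /\
  (forall a x, `|H a x - H a (rep (phi x))| <= eta).
Proof.
move=> eta0; pose L := Num.truncn (K / eta).
pose phi x : {ffun 'I_m -> 'I_L.+1} := [ffun a => inord (Num.truncn (H a x / eta))].
have H0 a x : 0 <= H a x / eta by rewrite divr_ge0 ?(ltW eta0)//; case/andP: (HK a x).
have phiE a x : phi x a = Num.truncn (H a x / eta) :> nat.
  rewrite ffunE inordK// ltnS; apply: le_truncn.
  by rewrite ler_pM2r ?invr_gt0//; case/andP: (HK a x).
have repP v : exists y, (exists x, phi x = v) -> phi y = v.
  by have [[x xv]|no] := pselect (exists x, phi x = v); [exists x|exists s0 => -[x xv]; case: no; exists x].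
have [rep repE] := choice repP.
exists {ffun 'I_m -> 'I_L.+1}, phi, rep; split => [v|a x].
  rewrite (_ : _ @^-1` _ = \bigcap_(a in [set: 'I_m]) [set x | (v a)%:R <= H a x / eta < (v a).+1%:R]).
    apply: fin_bigcap_measurable; first exact: finite_finset.
    move=> a _; rewrite (_ : [set _ | _] = (fun x => H a x / eta) @^-1` [set` `[(v a)%:R, (v a).+1%:R[]).
      rewrite -[X in measurable X]setTI.
      have mHe : measurable_fun [set: S] (fun x => H a x / eta) by apply: measurable_funM.
      exact: mHe.
    by apply/seteqP; split => x /=; rewrite in_itv.
  apply/seteqP; split => [x /= <- a _ /=|x h].
    by rewrite phiE truncn_itv.
  apply/ffunP => a; apply: val_inj; rewrite /= phiE; apply: truncn_def; exact: h.
have e : phi (rep (phi x)) = phi x by apply: repE; exists x.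
have /(congr1 (fun v : {ffun 'I_m -> 'I_L.+1} => nat_of_ord (v a))) := e; rewrite !phiE => e'.
have /andP[x1 x2] := truncn_itv (H0 a x).
have /andP[y1 y2] := truncn_itv (H0 a (rep (phi x))).
rewrite e' in y1 y2; move: x1 x2 y1 y2; set t := Num.truncn _.
rewrite !ler_pdivlMr// !ltr_pdivrMr// -natr1 mulrDl mul1r => *.
by rewrite ler_norml; apply/andP; split; lra.
Qed.

End discretization.

Section uniform_deviations.
Context {R : realType} d (Om : measurableType d) dS (S : measurableType dS).
Context (P : probability Om R) (X : {RV P >-> S}) (n : nat) (Xs : 'I_n -> {RV P >-> S}).
Hypothesis iid : independent_copies X Xs.
Hypothesis n0 : (0 < n)%N.
Variables (F : nat -> S -> R) (g : S -> R) (M M' rho : R).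
Hypothesis mF : forall a, measurable_fun [set: S] (F a).
Hypothesis mg : measurable_fun [set: S] g.
Hypothesis FM : forall a x, 0 <= F a x <= M.
Hypothesis gM : forall x, 0 <= g x <= M'.
Hypothesis Frho : forall (x x' : 'I_n -> S) (alpha : {ffun 'I_n -> bool} -> nat),
  Ex (@rad R 'I_n) (fun e => \sum_i sg (e i) * (F (alpha e) (x' i) - F (alpha e) (x i))) <= rho.

Local Notation mu := (distribution P X).

Let N0 : 0 < n%:R :> R. Proof. by rewrite ltr0n. Qed.

(** The function [g] is the loss of a fixed competitor, or 0. *)
Definition point_deviation (a : nat) (om : Om) : R :=
  (\int[mu]_x F a x - (\sum_i F a (Xs i om)) / n%:R) +
  ((\sum_i g (Xs i om)) / n%:R - \int[mu]_x g x).

Definition max_deviation (N : nat) (om : Om) : R :=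
  vmax (fun a : 'I_N.+1 => point_deviation a om).

Lemma measurable_point_deviation a : measurable_fun [set: Om] (point_deviation a).
Proof.
have mc (h : S -> R) : measurable_fun [set: S] h ->
    measurable_fun [set: Om] (fun om => (\sum_i h (Xs i om)) / n%:R).
  move=> mh; apply: measurable_funM => //; apply: measurable_sum => i.
  by apply: measurableT_comp => //; exact: measurable_funPT.
apply: measurable_funD; apply: measurable_funB => //; exact: mc.
Qed.

Lemma measurable_max_deviation N : measurable_fun [set: Om] (max_deviation N).
Proof. by apply: measurable_vmax => a; exact: measurable_point_deviation. Qed.

Lemma point_le_max a N om : (a <= N)%N -> point_deviation a om <= max_deviation N om.
Proof. by move=> aN; exact: (vmax_ge (fun a : 'I_N.+1 => point_deviation a om) (Ordinal (aN : (a < N.+1)%N))). Qed.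

Lemma max_deviation_nd om : nondecreasing_seq (max_deviation ^~ om).
Proof.
move=> N N' le; apply: vmax_le => a; apply: point_le_max.
by apply: leq_trans le; rewrite -ltnS.
Qed.

Let avg_bd (h : S -> R) K om : (forall x, 0 <= h x <= K) -> 0 <= (\sum_i h (Xs i om)) / n%:R <= K.
Proof.
move=> hK; rewrite divr_ge0 ?sumr_ge0//=; last by move=> i _; case/andP: (hK (Xs i om)).
rewrite ler_pdivrMr// mulrC; apply: sum_ord_le => i.
by case/andP: (hK (Xs i om)).
Qed.

Let integ (h : S -> R) K : measurable_fun [set: S] h -> (forall x, 0 <= h x <= K) ->
  mu.-integrable [set: S] (EFin \o h).
Proof.
move=> mh hK; apply: (@prob_bounded_integrable _ _ _ _ _ K) => // x.
by have /andP[? ?] := hK x; rewrite ger0_norm.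
Qed.

Let int_cst c : \int[mu]_x (fun=> c : R) x = c.
Proof.
rewrite /Rintegral integral_cst// -[RHS]mulr1 fineM//; last exact: fin_num_measure.
by congr (_ * _); exact: (congr1 fine (probability_setT mu)).
Qed.

Let int_bd (h : S -> R) K : measurable_fun [set: S] h -> (forall x, 0 <= h x <= K) ->
  0 <= \int[mu]_x h x <= K.
Proof.
move=> mh hK; rewrite Rintegral_ge0/=; last by move=> x _; case/andP: (hK x).
rewrite -[leRHS]int_cst; apply: le_Rintegral => //; first exact: integ hK.
  exact: finite_measure_integrable_cst.
by move=> x _; case/andP: (hK x).
Qed.

Lemma max_deviation_bounded N om : `|max_deviation N om| <= M + M'.
Proof.
rewrite /max_deviation; have [a ->] := vmax_ex (fun a : 'I_N.+1 => point_deviation a om).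
have /andP[? ?] := avg_bd om (FM a); have /andP[? ?] := avg_bd om gM.
have /andP[? ?] := int_bd (mF a) (FM a); have /andP[? ?] := int_bd mg gM.
by rewrite /point_deviation ler_norml; apply/andP; split; lra.
Qed.

Lemma max_deviation_integrable N : P.-integrable [set: Om] (EFin \o max_deviation N).
Proof.
apply: (@prob_bounded_integrable _ _ _ _ _ (M + M')); first exact: measurable_max_deviation.
exact: max_deviation_bounded.
Qed.

(** After rounding, the maximal deviation becomes a function of finitely valued data,
    to which the bounds on finite product spaces apply. *)
Lemma max_deviation_approx N (eta : R) : 0 < eta ->
  exists (V : finType) (w : V -> R) (D : {ffun 'I_n -> V} -> R) (c : Om -> {ffun 'I_n -> V}),
  [/\ is_dist w, forall v, measurable (c @^-1` [set v]),
      law P c =1 prodw (fun _ : 'I_n => w),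
      forall om, `|max_deviation N om - D (c om)| <= eta &
      Ex (prodw (fun _ : 'I_n => w)) D <= rho / n%:R /\
      forall t, 0 < M + M' -> 0 <= t ->
      Ex (prodw (fun _ : 'I_n => w)) (fun v => (rho / n%:R + t < D v)%R%:R) <=
        expR (- (2 * n%:R * t ^+ 2 / (M + M') ^+ 2))].
Proof.
move=> eta0.
have [s0 _] : exists s : S, true.
  apply: contrapT => no; have := probability_setT mu.
  rewrite (_ : [set: S] = set0); last by apply/seteqP; split => // x _; case: no; exists x.
  by rewrite measure0 => /eqP; rewrite eq_sym onee_eq0.
pose H (b : 'I_N.+2) : S -> R := if unlift ord0 b is Some a then F a else g.
have mH b : measurable_fun [set: S] (H b) by rewrite /H; case: unlift.
have HK b x : 0 <= H b x <= Num.max M M'.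
  rewrite /H; case: unlift => [a|].
    by have /andP[-> /le_trans->]// := FM a x; rewrite le_max lexx.
  by have /andP[-> /le_trans->]// := gM x; rewrite le_max lexx orbT.
have [|V [phi [rep [mphi close]]]] := @discretize R _ S N.+2 H _ mH HK s0 (eta / 4).
  by rewrite divr_gt0.
pose w := law mu phi; pose f (a : 'I_N.+1) v := F a (rep v); pose g' v := g (rep v).
have closeF (a : 'I_N.+1) x : `|F a x - f a (phi x)| <= eta / 4.
  by have := close (lift ord0 a) x; rewrite /H liftK.
have closeg x : `|g x - g' (phi x)| <= eta / 4.
  by have := close ord0 x; rewrite /H unlift_none.
have dw : is_dist w by exact: law_dist.
have intc (h : S -> R) K (h' : V -> R) : measurable_fun [set: S] h -> (forall x, 0 <= h x <= K) ->
    (forall x, `|h x - h' (phi x)| <= eta / 4) -> `|\int[mu]_x h x - Ex w h'| <= eta / 4.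
  move=> mh hK ch; rewrite /w -(finite_valued_integral _ mphi).
  have ih := integ mh hK; have ih' := finite_valued_integrable mu mphi h'.
  rewrite -RintegralB// ler_norml; apply/andP; split.
    rewrite -[leLHS]int_cst; apply: le_Rintegral => //.
    - exact: finite_measure_integrable_cst.
    - exact: integrable_EFinB.
    - by move=> x _; have := ch x; rewrite ler_norml => /andP[].
  rewrite -[leRHS]int_cst; apply: le_Rintegral => //.
  - exact: integrable_EFinB.
  - exact: finite_measure_integrable_cst.
  - by move=> x _; have := ch x; rewrite ler_norml => /andP[].
have avgc (h : S -> R) (h' : V -> R) om : (forall x, `|h x - h' (phi x)| <= eta / 4) ->
    `|(\sum_i h (Xs i om)) / n%:R - (\sum_i h' (codes Xs phi om i)) / n%:R| <= eta / 4.
  move=> ch; rewrite -mulrBl -sumrB normrM (gtr0_norm (x := _^-1)) ?invr_gt0//.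
  rewrite ler_pdivrMr// mulrC; apply: le_trans (ler_norm_sum _ _ _) _.
  by apply: sum_ord_le => i; rewrite ffunE.
exists V, w, (deviation w f g'), (codes Xs phi); split => //.
- exact: measurable_codes.
- by move=> v; exact: law_codes.
- move=> om; have := avgc g g' om closeg; have := intc g M' g' mg gM closeg.
  rewrite !ler_norml => /andP[? ?] /andP[? ?].
  rewrite /max_deviation /deviation; apply/andP; split.
    have [a ->] := vmax_ex (fun a => Ex w (f a) - (\sum_i f a (codes Xs phi om i)) / n%:R).
    have := vmax_ge (fun a : 'I_N.+1 => point_deviation a om) a; rewrite {1}/point_deviation.
    have := avgc (F a) (f a) om (closeF a); have := intc (F a) M (f a) (mF a) (FM a) (closeF a).
    by rewrite !ler_norml => /andP[? ?] /andP[? ?]; lra.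
  have [a ->] := vmax_ex (fun a : 'I_N.+1 => point_deviation a om); rewrite /point_deviation.
  have := vmax_ge (fun a => Ex w (f a) - (\sum_i f a (codes Xs phi om i)) / n%:R) a.
  have := avgc (F a) (f a) om (closeF a); have := intc (F a) M (f a) (mF a) (FM a) (closeF a).
  by rewrite !ler_norml => /andP[? ?] /andP[? ?]; lra.
split.
  apply: Ex_deviation => // x x' alpha; exact: (Frho (fun i => rep (x i)) (fun i => rep (x' i)) (fun e => alpha e)).
move=> t MM t0; apply: deviation_tail => //.
- by move=> a x; exact: FM.
- by move=> x; exact: gM.
- move=> x x' alpha; exact: (Frho (fun i => rep (x i)) (fun i => rep (x' i)) (fun e => alpha e)).
Qed.


Lemma max_deviation_mean N : \int[P]_om max_deviation N om <= rho / n%:R.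
Proof.
apply/ler_addgt0Pr => eta eta0.
have [V [w [D [c [dw mc lc close [ED _]]]]]] := max_deviation_approx N eta0.
apply: (@le_trans _ _ (\int[P]_om (D (c om) + eta))).
  apply: le_Rintegral => //; first exact: max_deviation_integrable.
    exact: (finite_valued_integrable P mc (fun v => D v + eta)).
  by move=> om _; have := close om; rewrite ler_norml => /andP[_]; lra.
rewrite (finite_valued_integral P mc (fun v => D v + eta)) ExD Ex_cst; last exact: law_dist.
by rewrite lerD2r /Ex; under eq_bigr do rewrite lc.
Qed.

Lemma max_deviation_tail N t eta : 0 < M + M' -> 0 <= t -> 0 < eta ->
  (P [set om | (rho / n%:R + t + eta < max_deviation N om)%R] <=
   (expR (- (2 * n%:R * t ^+ 2 / (M + M') ^+ 2)))%:E)%E.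
Proof.
move=> MM t0 eta0.
have [V [w [D [c [dw mc lc close [_ tail]]]]]] := max_deviation_approx N eta0.
apply: (@le_trans _ _ (P [set om | (rho / n%:R + t < D (c om))%R])).
  apply: le_measure; rewrite ?inE.
  - by apply: measurable_gt_set; exact: measurable_max_deviation.
  - exact: (measurable_finite_preimage mc [set v | (rho / n%:R + t < D v)%R]).
  - by move=> om /=; have := close om; rewrite ler_norml => /andP[_]; lra.
rewrite (finite_valued_proba P mc (fun v => rho / n%:R + t < D v)) lee_fin; apply: le_trans (tail t MM t0).
by rewrite /Ex le_eqVlt; apply/orP; left; apply/eqP; under eq_bigr do rewrite lc.
Qed.

(** The exceptional set is a countable increasing union, so that no uncountable
    supremum has to be measured. *)
Lemma uniform_tail t : 0 < M + M' -> 0 <= t ->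
  exists E, [/\ measurable E,
    ((1 - expR (- (2 * n%:R * t ^+ 2 / (M + M') ^+ 2)))%:E <= P E)%E &
    forall om a, E om -> point_deviation a om <= rho / n%:R + t].
Proof.
move=> MM t0; set dl := expR _.
pose Bad N := [set om | (rho / n%:R + t + N.+1%:R^-1 < max_deviation N om)%R].
have mB N : measurable (Bad N).
  by apply: measurable_gt_set; exact: measurable_max_deviation.
have mBU : measurable (\bigcup_N Bad N) by exact: bigcup_measurable.
have ndB : nondecreasing_seq Bad.
  move=> N N' le; apply/subsetPset => om; rewrite /Bad/= => /lt_le_trans h.
  apply: le_lt_trans (h _ (max_deviation_nd om le)).
  by rewrite lerD2l lef_pV2 ?posrE// ler_nat ltnS.
have PB : (P (\bigcup_N Bad N) <= dl%:E)%E.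
  have cvB := nondecreasing_cvg_mu (mu := P) mB mBU ndB.
  rewrite -(cvg_lim _ cvB)//; apply: lime_le; first exact: cvgP cvB.
  by apply: nearW => N; apply: max_deviation_tail; rewrite ?invr_gt0.
exists (~` (\bigcup_N Bad N)); split; first exact: measurableC.
  rewrite probability_setC// EFinB leeB//.
move=> om a nB; apply/ler_addgt0Pr => e e0.
pose N := maxn a (Num.truncn e^-1).
have aN : (a <= N)%N by exact: leq_maxl.
apply: le_trans (point_le_max om aN) _.
have nBN : ~ Bad N om by move=> h; apply: nB; exists N.
apply: (@le_trans _ _ (rho / n%:R + t + N.+1%:R^-1)); first by rewrite leNgt; exact/negP.
rewrite lerD2l -[leRHS]invrK lef_pV2 ?posrE ?invr_gt0//.
apply: ltW; apply: (@lt_le_trans _ _ (Num.truncn e^-1).+1%:R).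
  have e1 : 0 <= e^-1 by rewrite invr_ge0 ltW.
  by have /andP[_] := truncn_itv e1.
by rewrite ler_nat ltnS leq_maxr.
Qed.

(** The supremum over a countable family is a monotone limit of bounded maxima. *)
Lemma expected_supremum : exists Z : Om -> R,
  [/\ measurable_fun [set: Om] Z, forall om, `|Z om| <= M + M',
      \int[P]_om Z om <= rho / n%:R & forall om a, point_deviation a om <= Z om].
Proof.
have ub om : has_ubound (range (max_deviation ^~ om)).
  exists (M + M') => _ [N _ <-].
  by apply: le_trans (ler_norm _) _; exact: max_deviation_bounded.
pose Z om := sup (range (max_deviation ^~ om)).
have cvZ om : max_deviation ^~ om @ \oo --> Z om.
  by apply: nondecreasing_cvgn => //; exact: max_deviation_nd.
have leZ N om : max_deviation N om <= Z om.
  by apply: ub_le_sup => //; exists N.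
have mZ : measurable_fun [set: Om] Z.
  by apply: (measurable_fun_cvg measurable_max_deviation) => om _; exact: cvZ.
have Zb om : `|Z om| <= M + M'.
  rewrite ler_norml; apply/andP; split.
    apply: le_trans (leZ 0%N om); have := max_deviation_bounded 0 om.
    by rewrite ler_norml => /andP[].
  apply: ge_sup; first by exists (max_deviation 0 om), 0%N.
  move=> _ [N _ <-]; apply: le_trans (ler_norm _) _; exact: max_deviation_bounded.
exists Z; split => //; last by move=> om a; apply: le_trans (leZ a om); exact: point_le_max.
have [] := @dominated_convergence _ Om R P [set: Om] measurableT
  (fun N => EFin \o max_deviation N) (EFin \o Z) (EFin \o cst (M + M')).
- by move=> N; apply/measurable_EFinP; exact: measurable_max_deviation.
- exact/measurable_EFinP.
- by apply: aeW => om _; apply: cvg_EFin => //; [exact: nearW|exact: cvZ].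
- exact: finite_measure_integrable_cst.
- by apply: aeW => om N _ /=; rewrite lee_fin; exact: max_deviation_bounded.
move=> iZ _ cvI.
rewrite -lee_fin /Rintegral fineK; last exact: integrable_fin_num.
rewrite -(cvg_lim _ cvI)//; apply: lime_le; first exact: cvgP cvI.
apply: nearW => N /=.
have := max_deviation_mean N; rewrite -lee_fin /Rintegral fineK//.
by apply: integrable_fin_num => //; exact: max_deviation_integrable.
Qed.

End uniform_deviations.


(** * Versions of the conditional density *)


Section countable_pi_system.
Context {R : realType} (XX : completeMetricType R).
Hypothesis sepX : separable XX.

(** The interiors of balls of radii [1 / (m + 1)] around a dense sequence form a
    countable base, and their finite intersections a pi-system. *)
Lemma borel_countable_pi_system : exists G : nat -> set (borel XX),
  [/\ setI_closed (range G), @measurable _ (borel XX) = <<s range G >> &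
      forall i, measurable (G i)].
Proof.
have [D cD dD] := sepX.
have /countable_injP[f finj] := cD.
pose e n : XX := xget point [set c | D c /\ f c = n].
have eP c : D c -> e (f c) = c.
  move=> Dc; rewrite /e; case: xgetP => [y _ [Dy fy]|no]; last by have := no c; case.
  by apply: finj => //; rewrite inE.
pose base (nm : nat * nat) : set (borel XX) := (ball (e nm.1) nm.2.+1%:R^-1)°.
pose cap (s : seq (nat * nat)) : set (borel XX) := foldr (fun nm A => base nm `&` A) setT s.
pose dec n : seq (nat * nat) := odflt [::] (unpickle n).
pose decp n : nat * nat := odflt (0, 0)%N (unpickle n).
pose G n := cap (dec n).
have Gcap s : G (pickle s) = cap s by rewrite /G /dec pickleK.
have mbase nm : measurable (base nm) by apply: sub_sigma_algebra; exact: open_interior.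
have mcap s : measurable (cap s).
  by elim: s => [|nm s IH]; [exact: measurableT|apply: measurableI].
have capI s t : cap s `&` cap t = cap (s ++ t).
  by elim: s => [|nm s IH]; rewrite ?setTI//= -setIA IH.
exists G; split => //; last by move=> i; exact: mcap.
  by move=> _ _ [i _ <-] [j _ <-]; rewrite {1 2}/G capI -Gcap; exists (pickle (dec i ++ dec j)).
apply/seteqP; split; last first.
  apply: smallest_sub; first exact: sigma_algebra_measurable.
  by move=> _ [i _ <-]; exact: mcap.
apply: smallest_sub; first exact: smallest_sigma_algebra.
move=> U oU.
pose I := [set nm : nat * nat | base nm `<=` U].
have -> : U = \bigcup_n (if (decp n) \in I then base (decp n) else set0).
  apply/seteqP; split => [y Uy|y [n _]]; last first.
    by case: ifPn => // /[!inE] In /In.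
  have /nbhs_ballP[r /= r0 rU] : nbhs y U by apply: open_nbhs_nbhs.
  pose m := Num.truncn (2 / r).
  have m0 : 0 < m.+1%:R^-1 :> R by rewrite invr_gt0.
  have mr : 2 * m.+1%:R^-1 < r.
    rewrite -ltr_pdivlMl// mulrC -(invrK (r / 2)) ltf_pV2 ?posrE ?invr_gt0 ?divr_gt0// invf_div.
    by have /andP[] := @truncn_itv R (2 / r) (divr_ge0 (ler0n _ 2) (ltW r0)).
  have h0 : 0 < m.+1%:R^-1 / 2 :> R by rewrite divr_gt0.
  have [c [yc Dc]] : (ball y (m.+1%:R^-1 / 2))° `&` D !=set0.
    apply: dD; last exact: open_interior.
    by exists y; apply: nbhs_singleton; apply: nbhs_interior; exact: nbhsx_ballx.
  have {}yc : ball y (m.+1%:R^-1 / 2) c by exact: interior_subset yc.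
  have bU : base (f c, m) `<=` U.
    move=> z; rewrite /base/= eP// => /interior_subset cz; apply: rU.
    have le : m.+1%:R^-1 / 2 + m.+1%:R^-1 <= r by move: m0 mr; set v := m.+1%:R^-1; clearbody v; lra.
    apply: (le_ball le).
    exact: ball_triangle yc cz.
  exists (pickle (f c, m)) => //; rewrite /decp pickleK/=; case: ifPn => [_|]; last by rewrite notin_setE.
  rewrite /base/= eP//; apply/nbhs_ballP; exists (m.+1%:R^-1 / 2) => //= z yz.
  by rewrite [m.+1%:R^-1]splitr; apply: ball_triangle yz; exact: ball_sym.
have [sg0 sgC sgU] := @smallest_sigma_algebra _ [set: borel XX] (range G).
apply: sgU => n; case: ifPn => // _.
apply: sub_sigma_algebra; exists (pickle [:: decp n]) => //.
by rewrite Gcap/= setIT.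
Qed.

End countable_pi_system.


Local Open Scope ereal_scope.

Section pair_variable.
Context {R : realType} d d1 d2 (Om : measurableType d) (S : measurableType d1)
  (T : measurableType d2) (P : probability Om R) (X : {RV P >-> S}) (Y : {RV P >-> T}).

Definition pairRV (w : Om) : S * T := (X w, Y w).

Lemma measurable_pairRV : measurable_fun [set: Om] pairRV.
Proof. by apply: measurable_fun_pair; exact: measurable_funPT. Qed.

HB.instance Definition _ := isMeasurableFun.Build _ _ _ _ pairRV measurable_pairRV.

End pair_variable.

Lemma product_density {R : realType} d1 d2 (S : measurableType d1) (T : measurableType d2)
    (mu : probability S R) (nu : probability T R) (m : probability (S * T)%type R) :
  (forall A, measurable A -> (mu \x nu) A = 0 -> m A = 0) ->
  exists f : S * T -> \bar R, [/\ forall z, f z >= 0, forall z, f z \is a fin_num,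
    (mu \x nu).-integrable [set: S * T] f &
    forall A, measurable A -> m A = \int[mu \x nu]_(z in A) f z].
Proof.
move=> H; pose pm := product_subprobability (mu : subprobability S R, nu : subprobability T R).
have dom : m `<< pm by move=> N N0 A mA AN; apply: H => //; exact: N0.
have [f [f0 ffin fint fE]] := @radon_nikodym_sigma_finite _ _ R pm m dom.
by exists f; split.
Qed.

Section disintegration.
Context {R : realType} d d1 d2 (Om : measurableType d) (S : measurableType d1)
  (T : measurableType d2) (P : probability Om R) (X : {RV P >-> S}) (Y : {RV P >-> T}).
Context (kappa : R.-pker S ~> T).
Hypothesis kappaE : regular_conditional_law X Y kappa.

Local Notation mu := (distribution P X).
Local Notation m := (distribution P (pairRV X Y)).

Lemma measurable_kappa_section (E : set (S * T)) : measurable E ->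
  measurable_fun [set: S] (fun x => kappa x (xsection E x)).
Proof. by move=> mE; apply: measurable_fun_xsection_finite_kernel; rewrite inE. Qed.

Lemma law_disintegration (E : set (S * T)) : measurable E ->
  m E = \int[mu]_x kappa x (xsection E x).
Proof.
rewrite measurable_prod_measurableType.
move: E; apply: dynkin_induction; first exact: measurable_prod_measurableType.
- move=> _ _ [X1 mX1 [X2 mX2 <-]] [Y1 mY1 [Y2 mY2 <-]].
  exists (X1 `&` Y1); first exact: measurableI.
  by exists (X2 `&` Y2); [exact: measurableI|rewrite setXI].
- rewrite probability_setT.
  under eq_integral do rewrite xsectionE preimage_setT prob_kernel.
  by rewrite integral_cst// mul1e; exact/esym/(probability_setT mu).
- move=> _ [A mA [B mB <-]].
  rewrite [LHS](_ : _ = P (X @^-1` A `&` Y @^-1` B))//.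
  rewrite kappaE// [LHS]integral_mkcond; apply: eq_integral => x _.
  rewrite patchE; case: ifPn => xA; first by rewrite in_xsectionX.
  by rewrite notin_xsectionX// measure0.
- move=> E mE IH; have -> : m (~` E) = 1 - m E by exact: (probability_setC m mE).
  rewrite IH.
  have -> : \int[mu]_x kappa x (xsection (~` E) x) = \int[mu]_x (cst 1 x - kappa x (xsection E x)).
    apply: eq_integral => x _.
    have -> : xsection (~` E) x = ~` xsection E x by rewrite !xsectionE preimage_setC.
    have h := probability_setC (kernel_probability kappa x) (measurable_xsection x mE). exact: h.
  have k1 x : kappa x (xsection E x) <= 1 by exact: (probability_le1 (kernel_probability kappa x) (measurable_xsection x mE)).
  rewrite integralB//.
  - by rewrite integral_cst// mul1e; congr (_ - _); exact/esym/(probability_setT mu).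
  - exact: finite_measure_integrable_cst.
  - apply: (le_integrable measurableT _ _ (finite_measure_integrable_cst mu 1%R measurableT)).
      exact: measurable_kappa_section.
    by move=> x _ /=; rewrite gee0_abs// normr1.
- move=> F mF tF IH.
  rewrite measure_semi_bigcup//; last exact: bigcup_measurable.
  rewrite (eq_integral (fun x => \sum_(n <oo) kappa x (xsection (F n) x))); last first.
    move=> x _; rewrite xsection_bigcup measure_semi_bigcup//.
    - by move=> n; exact: measurable_xsection.
    - exact: trivIset_xsection.
    - by apply: bigcup_measurable => n _; exact: measurable_xsection.
  rewrite integral_nneseries//; last by move=> n; exact: measurable_kappa_section.
  by apply: eq_eseriesr => n _; exact: IH.
Qed.

Variable nu : probability T R.
Hypothesis kappa_nu : {ae mu, forall x, kappa x `<< nu}.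

(** A null set of the product has null sections, which almost all conditional laws
    ignore. *)
Lemma law_dominates A : measurable A -> (mu \x nu) A = 0 -> m A = 0.
Proof.
move=> mA; rewrite law_disintegration// /product_measure1 => h.
have mn : measurable_fun [set: S] (nu \o xsection A) by exact: measurable_fun_xsection.
have : ae_eq mu [set: S] (nu \o xsection A) (cst 0).
  apply/ae_eq_integral_abs => //; rewrite -[RHS]h; apply: eq_integral => x _.
  by rewrite gee0_abs.
move=> nu0.
rewrite (ge0_ae_eq_integral (g := cst 0))//; first by rewrite integral0.
  exact: measurable_kappa_section.
near=> x => _ /=.
have kx : kappa x `<< nu by near: x; exact: kappa_nu.
have n0 : nu (xsection A x) = 0 by near: x; apply: filterS nu0 => x /(_ I).
have mx : measurable (xsection A x) by exact: measurable_xsection.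
by move/null_content_dominatesP : kx; exact.
Unshelve. all: by end_near. Qed.

(** The density is taken with respect to the product of the marginal law and [nu], then
    disintegrated; the exceptional set of points depends on [B]. *)
Lemma joint_density : exists f : S * T -> R,
  [/\ measurable_fun [set: S * T] f, forall z, (0 <= f z)%R &
  forall B, measurable B ->
    {ae mu, forall x, kappa x B = \int[nu]_(y in B) (f (x, y))%:E}].
Proof.
have [f [f0 ffin /integrableP[mf _] fE]] := @product_density R d1 d2 S T mu nu m law_dominates.
have fEF z : f z = (fine (f z))%:E by rewrite fineK.
have mff : measurable_fun [set: S * T] (fine \o f).
  exact: measurableT_comp.
exists (fine \o f); split => // [z|B mB]; first exact: fine_ge0.
pose h x := \int[nu]_(y in B) f (x, y).
have mg : measurable_fun [set: S * T] (f \_ (setT `*` B)).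
  by apply/(measurable_restrictT _ (measurableX measurableT mB)); exact: measurable_funTS.
have hE x : h x = \int[nu]_y (f \_ (setT `*` B)) (x, y).
  rewrite /h integral_mkcond; apply: eq_integral => y _.
  by rewrite !patchE in_setX in_setT.
have g0 z : 0 <= (f \_ (setT `*` B)) z by rewrite patchE; case: ifPn.
have mh : measurable_fun [set: S] h.
  rewrite (_ : h = fubini_F nu (f \_ (setT `*` B))); last by apply/funext => x; rewrite hE.
  exact: measurable_fun_fubini_tonelli_F.
have mk : measurable_fun [set: S] (fun x => kappa x B) by exact: measurable_kernel.
have ik : mu.-integrable [set: S] (fun x => kappa x B).
  apply: (le_integrable measurableT _ _ (finite_measure_integrable_cst mu 1%R measurableT)) => //.
  move=> x _ /=; rewrite gee0_abs// normr1.
  exact: (probability_le1 (kernel_probability kappa x) mB).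
have : ae_eq mu [set: S] (fun x => kappa x B) h.
  apply: integral_ae_eq => // A _ mA.
  have -> : \int[mu]_(x in A) kappa x B = m (A `*` B).
    by rewrite -kappaE.
  rewrite fE; last exact: measurableX.
  transitivity (\int[mu]_x fubini_F nu (f \_ (A `*` B)) x).
    rewrite integral_mkcond; apply: fubini_tonelli1; last by move=> z; rewrite patchE; case: ifPn.
    by apply/(measurable_restrictT _ (measurableX mA mB)); exact: measurable_funTS.
  rewrite [RHS]integral_mkcond; apply: eq_integral => x _.
  rewrite /fubini_F patchE; case: ifPn => xA.
    rewrite /h [RHS]integral_mkcond; apply: eq_integral => y _.
    by rewrite !patchE in_setX xA.
  rewrite -[RHS](integral0 nu [set: T]); apply: eq_integral => y _.
  by rewrite patchE in_setX (negbTE xA).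
apply: filterS => x /(_ I) ->; rewrite /h; apply: eq_integral => y _.
by rewrite /= -fEF.
Qed.

End disintegration.

Local Close Scope ereal_scope.


Local Open Scope ereal_scope.

Section conditional_density_version.
Context {R : realType} d d1 d2 (Om : measurableType d) (S : measurableType d1)
  (T : measurableType d2) (P : probability Om R) (X : {RV P >-> S}) (Y : {RV P >-> T}).
Context (kappa : R.-pker S ~> T).
Hypothesis kappaE : regular_conditional_law X Y kappa.
Local Notation mu := (distribution P X).
Variable nu : probability T R.
Hypothesis kappa_nu : {ae mu, forall x, kappa x `<< nu}.
Variable G : nat -> set T.
Hypothesis GI : setI_closed (range G).
Hypothesis Gm : @measurable _ T = <<s range G >>.
Hypothesis mG : forall i, measurable (G i).

Local Notation p := (conditional_density nu kappa).

(** Two densities of the same probability agree almost everywhere; countably many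
    sets suffice to recognise the conditional law. *)
Lemma conditional_density_version : exists f : S * T -> R,
  [/\ measurable_fun [set: S * T] f, forall z, (0 <= f z)%R &
  {ae mu, forall x, [/\ measurable_fun [set: T] (p x),
     {ae nu, forall y, p x y = f (x, y)} & \int[nu]_y (f (x, y))%:E = 1]}].
Proof.
have [f [mf f0 fE]] := joint_density kappaE kappa_nu.
exists f; split => //.
have aeG : {ae mu, forall x, forall i, kappa x (G i) = \int[nu]_(y in G i) (f (x, y))%:E}.
  by apply: ae_foralln => i; exact: fE.
have aeT := fE setT measurableT.
near=> x.
have kx : kappa x `<< nu by near: x; exact: kappa_nu.
have kG : forall i, kappa x (G i) = \int[nu]_(y in G i) (f (x, y))%:E by near: x.
have kT : kappa x setT = \int[nu]_y (f (x, y))%:E by near: x.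
have mfx : measurable_fun [set: T] (fun y => (f (x, y))%:E).
  by apply/measurable_EFinP; exact: measurable_fun_pair2.
have k1 : kappa x setT = 1 by exact: prob_kernel.
have kB B : measurable B -> kappa x B = \int[nu]_(y in B) (f (x, y))%:E.
  rewrite {1}Gm; move: B; apply: (dynkin_induction (G := range G)) => //.
  - by move=> _ [i _ <-]; exact: kG.
  - move=> B mB IH.
    have -> : kappa x (~` B) = 1 - kappa x B.
      exact: (probability_setC (kernel_probability kappa x) mB).
    have : \int[nu]_(y in B `|` ~` B) (f (x, y))%:E = 1 by rewrite setUv -kT.
    rewrite ge0_integral_setU//.
    + rewrite -IH => <-; rewrite addeAC subee ?add0e//.
      exact: (fin_num_measure (kernel_probability kappa x) _ mB).
    + exact: measurableC.
    + by rewrite setUv.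
    + by move=> y _; rewrite lee_fin.
    + by apply/disj_setPS; rewrite setICr.
  - move=> F mF tF IH.
    rewrite (measure_semi_bigcup (kappa x))//; last exact: bigcup_measurable.
    rewrite ge0_integral_bigcup//.
    + by apply: eq_eseriesr => n _; exact: IH.
    + exact: measurable_funTS.
    + by move=> y _; rewrite lee_fin.
pose kc := charge_of_finite_measure (kernel_probability kappa x).
have kc_nu : kc `<< nu by [].
have fin y := Radon_Nikodym_fin_num y kc_nu.
have int := Radon_Nikodym_integrable kc_nu.
have mp : measurable_fun [set: T] (p x).
  by apply: measurableT_comp => //; case/integrableP : int.
split => //; last by rewrite -kT.
have : ae_eq nu [set: T] (Radon_Nikodym kc nu) (fun y => (f (x, y))%:E).
  apply: integral_ae_eq => // E _ mE.
  by rewrite -(Radon_Nikodym_integral kc_nu mE) -kB.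
by apply: filterS => y /(_ I) e; rewrite /conditional_density -/kc e.
Unshelve. all: by end_near. Qed.

End conditional_density_version.

Section essential_supremum_sqrt.
Context {R : realType} d (S : measurableType d) (mu : probability S R).

(** The square root inside the essential supremum comes out as a square. *)
Lemma ess_sup_sqrt (h : S -> \bar R) : (forall x, 0 <= h x) -> ess_sup mu h < +oo ->
  exists b : R, [/\ (0 <= b)%R, ess_sup mu (fun x => h x `^ 2^-1) = b%:E &
    {ae mu, forall x, h x <= (b ^+ 2)%:E}].
Proof.
move=> h0 hy.
have mu1 : 0 < mu [set: S] by rewrite probability_setT.
pose be := ess_sup mu (fun x => h x `^ 2^-1).
have be0 : 0 <= be by apply: ess_sup_gee => //; apply: aeW => x; exact: poweR_ge0.
have he := ess_sup_ge mu h.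
have bey : be < +oo.
  apply: (@le_lt_trans _ _ (ess_sup mu h `^ 2^-1)); last exact: poweR_lty.
  apply/ess_supP; apply: filterS he => x hx.
  by apply: gt0_ler_poweR; rewrite ?in_itv/= ?leey ?andbT// (le_trans (h0 x)).
have bfin : be \is a fin_num by rewrite ge0_fin_numE.
exists (fine be); rewrite fine_ge0// fineK//; split => //.
apply: filterS (ess_sup_ge mu (fun x => h x `^ 2^-1)) => x; rewrite -/be => hx.
rewrite -(poweRe1 (h0 x)) -[in leLHS](_ : (2^-1 * 2 = 1 :> R)%R); last by rewrite mulVf.
rewrite poweRrM; apply: (@le_trans _ _ (be `^ 2)).
  by apply: gt0_ler_poweR; rewrite ?in_itv/= ?leey ?andbT// poweR_ge0.
by rewrite -[in leLHS](fineK bfin) poweR_EFin lee_fin -powR_mulrn ?fine_ge0.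
Qed.

End essential_supremum_sqrt.

Local Close Scope ereal_scope.


Section ae_toolkit.
Context {R : realType} d (S : measurableType d) (mu : probability S R).

Lemma ae_full_set (Q : S -> Prop) : {ae mu, forall x, Q x} ->
  exists S0 : set S, [/\ measurable S0, (mu S0 = 1)%E & forall x, S0 x -> Q x].
Proof.
move=> [N [mN N0 sN]]; exists (~` N); split; first exact: measurableC.
  have -> : (mu (~` N) = 1 - mu N)%E by exact: (probability_setC mu mN).
  by rewrite N0 sube0.
by move=> x nx; apply: contrapT => nq; apply: nx; exact: sN.
Qed.

Lemma full_set_ex (S0 : set S) : (mu S0 = 1)%E -> exists s, S0 s.
Proof.
move=> h; apply: contrapT => no; have S00 : S0 = set0.
  by apply/seteqP; split => // x xS; case: no; exists x.
by move: h; rewrite S00 measure0 => /esym/eqP; rewrite onee_eq0.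
Qed.

End ae_toolkit.

Lemma measurable_sqr_lne {R : realType} d (T : measurableType d) (u : T -> R) :
  measurable_fun [set: T] u -> measurable_fun [set: T] (fun y => (lne (u y)%:E ^+ 2)%E).
Proof.
move=> mu0; rewrite [X in measurable_fun _ X](_ : _ =
    (fun y => if (0 < u y)%R then ((ln (u y)) ^+ 2)%:E else +oo%E)).
  apply: measurable_fun_ifT => //; first exact: measurable_fun_ltr.
  apply/measurable_EFinP; apply: measurable_funX.
  by apply: measurableT_comp => //; exact: measurable_ln.
apply/funext => y; case: ltP => h; first by rewrite lne_EFin// EFin_expe.
by rewrite /= h.
Qed.

Section regular_density.
Context {R : realType} d1 d2 (S : measurableType d1) (T : measurableType d2)
  (mu : probability S R) (nu : probability T R).

(** The points of a null set are sent to a fixed good point; composition with this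
    retraction keeps joint measurability and makes all the properties hold everywhere. *)
Lemma regular_density (p : S -> T -> R) (f0 : S * T -> R) (b c : R) :
  measurable_fun [set: S * T] f0 -> (forall z, 0 <= f0 z) ->
  {ae mu, forall x, [/\ measurable_fun [set: T] (p x),
     {ae nu, forall y, p x y = f0 (x, y)} & (\int[nu]_y (f0 (x, y))%:E = 1)%E]} ->
  {ae mu, forall x, (sq_mass nu p x <= (b ^+ 2)%:E)%E} ->
  {ae mu, forall x, (sq_log_mass nu p x <= (c ^+ 2)%:E)%E} ->
  exists (f : S * T -> R) (S0 : set S),
  [/\ measurable_fun [set: S * T] f, forall z, 0 < f z,
    forall x, [/\ (\int[nu]_y (f (x, y))%:E = 1)%E,
      (\int[nu]_y (f (x, y) ^+ 2)%:E <= (b ^+ 2)%:E)%E &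
      (\int[nu]_y (ln (f (x, y)) ^+ 2)%:E <= (c ^+ 2)%:E)%E],
    measurable S0 /\ (mu S0 = 1)%E &
    forall x, S0 x -> measurable_fun [set: T] (p x) /\ {ae nu, forall y, p x y = f (x, y)}].
Proof.
move=> mf0 f00 hp hb hc.
have [S0 [mS0 S01 hS0]] := ae_full_set (filterI hp (filterI hb hc)).
have [s0 s0S] := full_set_ex S01.
pose r x := if x \in S0 then x else s0.
have rS x : S0 (r x) by rewrite /r; case: ifPn => // /set_mem.
have mr : measurable_fun [set: S] r.
  apply: measurable_fun_ifT => //.
  apply: (measurable_fun_bool true) => //.
  rewrite setTI (_ : _ @^-1` _ = S0)//.
  by apply/seteqP; split => x /= => [/set_mem|/mem_set].
pose f1 (z : S * T) := f0 (r z.1, z.2).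
have mf1 : measurable_fun [set: S * T] f1.
  apply: (measurableT_comp mf0); apply: measurable_fun_pair => //.
  exact: measurableT_comp.
pose f z := if 0 < f1 z then f1 z else 1.
have mf : measurable_fun [set: S * T] f.
  by apply: measurable_fun_ifT => //; apply: measurable_fun_ltr.
have fP z : 0 < f z by rewrite /f; case: ifPn.
have mfx x : measurable_fun [set: T] (fun y => f (x, y)) by exact: measurable_fun_pair2.
have key x : [/\ measurable_fun [set: T] (p (r x)), {ae nu, forall y, p (r x) y = f (x, y)} &
     (\int[nu]_y (f (x, y))%:E = 1)%E].
  have [[mp pf f1E] [_ lp]] := hS0 _ (rS x).
  have mL := measurable_sqr_lne mp.
  have : nu.-integrable [set: T] (fun y => (lne (p (r x) y)%:E ^+ 2)%E).
    apply/integrableP; split=> //.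
    under eq_integral => y _ do rewrite gee0_abs ?sqre_ge0//.
    exact: (le_lt_trans lp (ltry _)).
  move=> /(integrable_ae measurableT) lfin.
  have aef : {ae nu, forall y, p (r x) y = f (x, y)}.
    apply: filterS2 pf lfin => y e /(_ I); rewrite /f /f1/= -e.
    by case: (ltP 0 (p (r x) y)) => h.
  split => //; transitivity (\int[nu]_y (f0 (r x, y))%:E)%E; last exact: f1E.
  apply: ge0_ae_eq_integral => //.
  - by apply/measurable_EFinP; exact: mfx.
  - by apply/measurable_EFinP; exact: measurable_fun_pair2.
  - by move=> y _; rewrite lee_fin ltW.
  - by move=> y _; rewrite lee_fin.
  - by apply: filterS2 pf aef => y e1 e2 _; rewrite -e2 e1.
exists f, S0; split => //.
- move=> x; have [mp aef f1E] := key x; have [_ [bp lp]] := hS0 _ (rS x); split => //.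
  + apply: le_trans bp; rewrite le_eqVlt; apply/orP; left; apply/eqP.
    apply: ge0_ae_eq_integral => //.
    * by apply/measurable_EFinP; apply: measurable_funX; exact: mfx.
    * by apply/measurable_EFinP; exact: measurable_funX.
    * by move=> y _; rewrite lee_fin sqr_ge0.
    * by move=> y _; rewrite lee_fin sqr_ge0.
    * by apply: filterS aef => y -> _.
  + apply: le_trans lp; rewrite le_eqVlt; apply/orP; left; apply/eqP.
    apply: ge0_ae_eq_integral => //.
    * apply/measurable_EFinP; apply: measurable_funX.
      by apply: measurableT_comp; [exact: measurable_ln|exact: mfx].
    * exact: measurable_sqr_lne.
    * by move=> y _; rewrite lee_fin sqr_ge0.
    * by move=> y _; rewrite sqre_ge0.
    * by apply: filterS aef => y -> _; rewrite lne_EFin// EFin_expe.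
- move=> x xS; have [mp aef _] := key x.
  by move: mp aef; rewrite /r mem_set.
Qed.
End regular_density.


(** * Square-integrable functions *)


Section square_integrable.
Context {R : realType} d (T : measurableType d) (nu : probability T R).
Implicit Types u v : T -> R.

Definition L2 u := measurable_fun [set: T] u /\ (\int[nu]_y (u y ^+ 2)%:E < +oo)%E.

Definition inner u v := \int[nu]_y (u y * v y).

Lemma L2_sqr_integrable u : L2 u -> nu.-integrable [set: T] (EFin \o (fun y => u y ^+ 2)).
Proof.
move=> [mu0 uy]; apply/integrableP; split.
  by apply/measurable_EFinP; exact: measurable_funX.
by under eq_integral => y _ do rewrite /= ger0_norm ?sqr_ge0//.
Qed.

Lemma L2_sqrE u : L2 u -> (\int[nu]_y (u y ^+ 2)%:E = (inner u u)%:E)%E.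
Proof.
move=> hu; rewrite /inner /Rintegral fineK; first by apply: eq_integral => y _; rewrite expr2.
have := integrable_fin_num measurableT (L2_sqr_integrable hu).
by rewrite /comp; under eq_integral do rewrite expr2.
Qed.

Lemma L2M u v : L2 u -> L2 v -> nu.-integrable [set: T] (EFin \o (fun y => u y * v y)).
Proof.
move=> hu hv; have i2 := integrableD measurableT (L2_sqr_integrable hu) (L2_sqr_integrable hv).
apply: le_integrable i2 => //.
  by apply/measurable_EFinP; apply: measurable_funM; [case: hu|case: hv].
move=> y _ /=; rewrite lee_fin normrM (ger0_norm (addr_ge0 (sqr_ge0 _) (sqr_ge0 _))).
rewrite -(real_normK (num_real (u y))) -(real_normK (num_real (v y))).
by have := sqr_ge0 (`|u y| - `|v y|); have := normr_ge0 (u y); have := normr_ge0 (v y); nra.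
Qed.

Lemma L2_cst (c : R) : L2 (cst c).
Proof.
split; first exact: measurable_cst.
have /integrableP[_] := finite_measure_integrable_cst nu (c ^+ 2) measurableT.
by under eq_integral => y _ do rewrite /= ger0_norm ?sqr_ge0//.
Qed.

Lemma L2_integrable u : L2 u -> nu.-integrable [set: T] (EFin \o u).
Proof.
move=> hu; have := L2M hu (L2_cst 1); rewrite /comp.
by under eq_fun do rewrite mulr1.
Qed.

Lemma L2_le u v : measurable_fun [set: T] u -> (forall y, `|u y| <= `|v y|) -> L2 v -> L2 u.
Proof.
move=> mu0 uv [mv vy]; split=> //; apply: le_lt_trans vy.
apply: ge0_le_integral => //.
- by move=> y _; rewrite lee_fin sqr_ge0.
- by apply/measurable_EFinP; exact: measurable_funX.
- by apply/measurable_EFinP; exact: measurable_funX.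
- move=> y _; rewrite lee_fin -(real_normK (num_real (u y))) -(real_normK (num_real (v y))).
  by rewrite lerXn2r ?nnegrE.
Qed.

Lemma innerC u v : inner u v = inner v u.
Proof. by apply: eq_Rintegral => y _; rewrite mulrC. Qed.

Lemma innerBl u v w : L2 u -> L2 v -> L2 w ->
  inner (fun y => u y - v y) w = inner u w - inner v w.
Proof.
move=> hu hv hw; rewrite /inner -RintegralB//; try exact: L2M.
by apply: eq_Rintegral => y _; rewrite mulrBl.
Qed.

Lemma inner_ge0 u : 0 <= inner u u.
Proof. by apply: Rintegral_ge0 => y _; rewrite -expr2 sqr_ge0. Qed.

Lemma inner_psd (J : finType) (v : J -> T -> R) : (forall i, L2 (v i)) ->
  psd (fun i j => inner (v i) (v j)).
Proof.
move=> hv c.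
have ii i j : nu.-integrable [set: T] (EFin \o (fun y => v i y * v j y)) by exact: L2M.
have ic i j : nu.-integrable [set: T] (fun y => (c i * c j * (v i y * v j y))%:E).
  have := integrableZl measurableT (c i * c j) (ii i j).
  by rewrite /comp; under eq_fun do rewrite -EFinM.
suff -> : \sum_i \sum_j c i * c j * inner (v i) (v j) =
    \int[nu]_y (\sum_i c i * v i y) ^+ 2.
  by apply: Rintegral_ge0 => y _; rewrite sqr_ge0.
apply: EFin_inj; rewrite -sumEFin.
under eq_bigr => i _ do rewrite -sumEFin.
have -> : (\sum_i \sum_j (c i * c j * inner (v i) (v j))%:E =
    \sum_i \sum_j \int[nu]_y (c i * c j * (v i y * v j y))%:E)%E.
  apply: eq_bigr => i _; apply: eq_bigr => j _.
  rewrite EFinM /inner /Rintegral fineK; last exact: (integrable_fin_num measurableT (ii i j)).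
  by rewrite -(integralZl measurableT (ii i j)); apply: eq_integral => y _; rewrite -EFinM.
under eq_bigr => i _ do rewrite -integral_sum//.
rewrite -integral_sum//; last by move=> i; apply: integrable_sum.
rewrite [in RHS]/Rintegral.
have e y : (\sum_i \sum_j (c i * c j * (v i y * v j y))%:E)%E = ((\sum_i c i * v i y) ^+ 2)%:E.
  rewrite expr2 mulr_suml -sumEFin; apply: eq_bigr => i _; rewrite sumEFin mulr_sumr; congr (_%:E).
  by apply: eq_bigr => j _; ring.
rewrite fineK; first by apply: eq_integral => y _; exact: e.
rewrite -(eq_integral _ _ (fun y _ => e y)); apply: integrable_fin_num => //.
by apply: integrable_sum => // i _; apply: integrable_sum.
Qed.

Lemma inner_cauchy_schwarz u v (a b : R) : L2 u -> L2 v -> 0 <= a -> 0 <= b ->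
  inner u u <= a ^+ 2 -> inner v v <= b ^+ 2 -> `|inner u v| <= a * b.
Proof.
move=> hu hv a0 b0 ua vb.
have key (c1 c2 : R) : 0 <= c1 ^+ 2 * inner u u + 2 * c1 * c2 * inner u v + c2 ^+ 2 * inner v v.
  have huv (e : bool) : L2 (if e then u else v) by case: e.
  have := inner_psd huv (fun e : bool => if e then c1 else c2).
  by rewrite !big_bool/= (innerC v u); congr (_ <= _); ring.
have i0 := inner_ge0 u; have j0 := inner_ge0 v.
have : inner u v ^+ 2 <= inner u u * inner v v.
  have [v0|v0] := eqVneq (inner v v) 0.
    have [w0|w0] := eqVneq (inner u v) 0; first by rewrite w0 v0 expr0n mulr0.
    have := key 1 (- (inner u u + 1) / (2 * inner u v)).
    rewrite v0 mulr0 addr0 expr1n mul1r mulr1.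
    rewrite (_ : _ + _ = -1); last by field.
    by lra.
  have {}v0 : 0 < inner v v by rewrite lt_def v0.
  have := key (inner v v) (- inner u v).
  rewrite (_ : _ + _ = inner v v * (inner u u * inner v v - inner u v ^+ 2)); last by ring.
  by rewrite pmulr_rge0// subr_ge0.
move=> h; rewrite -ler_sqr ?nnegrE ?mulr_ge0// real_normK ?num_real//.
by apply: (le_trans h); rewrite exprMn ler_pM.
Qed.

Lemma L2D u v : L2 u -> L2 v -> L2 (fun y => u y + v y).
Proof.
move=> hu hv; split; first by apply: measurable_funD; [case: hu|case: hv].
have i2 := integrableD measurableT (L2_sqr_integrable hu) (L2_sqr_integrable hv).
have i4 := integrableZl measurableT 2 i2.
have mw : measurable_fun [set: T] (EFin \o (fun y => (u y + v y) ^+ 2)).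
  apply/measurable_EFinP; apply: measurable_funX.
  by apply: measurable_funD; [case: hu|case: hv].
have := le_integrable measurableT mw _ i4; case/(_ _)/integrableP => [y _ /=|_].
  rewrite lee_fin ger0_norm ?sqr_ge0// ger0_norm; first by have := sqr_ge0 (u y - v y); nra.
  by rewrite mulr_ge0// addr_ge0 ?sqr_ge0.
by under eq_integral => y _ do rewrite /= ger0_norm ?sqr_ge0//.
Qed.

Lemma L2N u : L2 u -> L2 (fun y => - u y).
Proof.
move=> hu; apply: (L2_le _ _ hu) => [|y]; last by rewrite normrN.
by apply: measurableT_comp => //; case: hu.
Qed.

Lemma L2Z (r : R) u : L2 u -> L2 (fun y => r * u y).
Proof.
move=> hu; split; first by apply: measurable_funM => //; case: hu.
have := integrableZl measurableT (r ^+ 2) (L2_sqr_integrable hu).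
case/integrableP => _; apply: le_lt_trans; apply: ge0_le_integral => //.
- by move=> y _; rewrite lee_fin sqr_ge0.
- by apply/measurable_EFinP; apply: measurable_funX; apply: measurable_funM => //; case: hu.
- apply: measurableT_comp => //; apply/measurable_EFinP; apply: measurable_funM => //.
  by apply: measurable_funX; case: hu.
- by move=> y _ /=; rewrite exprMn lee_fin ler_norm.
Qed.

Lemma innerZ (r : R) u : L2 u ->
  inner (fun y => r * u y) (fun y => r * u y) = r ^+ 2 * inner u u.
Proof.
move=> hu; rewrite /inner -RintegralZl//; last exact: L2M.
by apply: eq_Rintegral => y _; ring.
Qed.

Lemma L2B u v : L2 u -> L2 v -> L2 (fun y => u y - v y).
Proof. by move=> hu hv; apply: L2D => //; exact: L2N. Qed.

End square_integrable.


(** * Integrals of non-measurable functions *)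


Local Open Scope ereal_scope.

(** The integral of a function that need not be measurable is a supremum over the
    simple functions below its positive part, minus the same for its negative part;
    it still does not see null sets. *)
Section lower_integral.
Context {R : realType} d (T : measurableType d) (mu : {measure set T -> \bar R}).
Implicit Types f g : T -> \bar R.
Import HBNNSimple.

Lemma ge0_ae_le_lower_integral f g : (forall x, 0 <= f x) -> (forall x, 0 <= g x) ->
  {ae mu, forall x, f x <= g x} -> \int[mu]_x f x <= \int[mu]_x g x.
Proof.
move=> f0 g0 [N [mN N0 sN]]; rewrite ge0_integralTE//.
apply: ge_ereal_sup => _ [h hf <-].
pose h' := proj_nnsfun h (measurableC mN).
have -> : sintegral mu h = sintegral mu h'.
  rewrite -!integralT_nnsfun; apply: ge0_ae_eq_integral => //.
  - by apply/measurable_EFinP; exact: measurable_funP.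
  - by apply/measurable_EFinP; exact: measurable_funP.
  - by move=> x _; rewrite lee_fin fun_ge0.
  - by move=> x _; rewrite lee_fin fun_ge0.
  exists N; split => // x /=; apply: contra_notP => nx _.
  by rewrite /= mindicE mem_set// mulr1.
rewrite ge0_integralTE//; apply: ereal_sup_ubound; exists h' => // x.
rewrite /= mindicE; have [/set_mem nx|_] := boolP (x \in ~` N); last by rewrite mulr0.
rewrite mulr1; apply: (le_trans (hf x)).
by apply: contrapT => nfg; apply: nx; exact: sN.
Qed.

Lemma ae_eq_lower_integral f g : {ae mu, forall x, f x = g x} ->
  \int[mu]_x f x = \int[mu]_x g x.
Proof.
move=> fg; rewrite integralE [RHS]integralE; congr (_ - _); apply/eqP; rewrite eq_le;
  apply/andP; split; apply: ge0_ae_le_lower_integral => //;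
  by apply: filterS fg => x; rewrite ?funeposE ?funenegE => ->.
Qed.

Lemma ae_le_lower_integral f g : (forall x, 0 <= g x) ->
  {ae mu, forall x, f x <= g x} -> \int[mu]_x f x <= \int[mu]_x g x.
Proof.
move=> g0 fg; rewrite integralE.
apply: (@le_trans _ _ (\int[mu]_x f^\+ x)).
  by rewrite -[leRHS]adde0 leeD2l// oppe_le0 integral_ge0.
apply: ge0_ae_le_lower_integral => //; apply: filterS fg => x fg.
by rewrite funeposE ge_max fg g0.
Qed.

End lower_integral.

Local Close Scope ereal_scope.


(** * The divergence *)


Section bent.
Context {R : realType}.

(** The integrand of the divergence, made nonnegative by adding a function of
    integral zero. *)
Definition bent (a b : R) : R := a * (ln a - ln b) - a + b.

Lemma bent_ge0 a b : 0 <= a -> 0 < b -> 0 <= bent a b.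
Proof.
rewrite /bent le_eqVlt => /predU1P[<- b0|a0 b0].
  by rewrite mul0r oppr0 !add0r ltW.
have := ln_le_subr1 (divr_gt0 b0 a0); rewrite ln_div// => h.
have := ler_wpM2l (ltW a0) h; rewrite [in leRHS]mulrBr mulr1 [a * (b / a)]mulrCA divff ?gt_eqF// mulr1.
by lra.
Qed.

Lemma bentxx a : bent a a = a - a.
Proof. by rewrite /bent subrr mulr0 sub0r addrC. Qed.

Lemma measurable_bent d (T : measurableType d) (u v : T -> R) :
  measurable_fun [set: T] u -> measurable_fun [set: T] v ->
  measurable_fun [set: T] (fun y => bent (u y) (v y)).
Proof.
move=> hu hv; rewrite /bent; apply: measurable_funD => //; apply: measurable_funB => //.
apply: measurable_funM => //; apply: measurable_funB; apply: measurableT_comp => //;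
  exact: measurable_ln.
Qed.

Lemma xlnx_bounds (a : R) : 0 <= a -> `|a * ln a| <= a ^+ 2 + 1.
Proof.
rewrite le_eqVlt => /predU1P[<-|a0]; first by rewrite mul0r normr0 expr0n add0r.
have ub := ler_wpM2l (ltW a0) (ln_le_subr1 a0).
have := ln_le_subr1 (x := a^-1); rewrite invr_gt0 lnV ?posrE// => /(_ a0) h.
have := ler_wpM2l (ltW a0) h; rewrite mulrBr divff ?gt_eqF// mulrN mulr1 => lb.
by rewrite ler_norml; apply/andP; split; nra.
Qed.

End bent.

Section shift.
Context {R : realType} d (T : measurableType d) (nu : {measure set T -> \bar R}).

(** When the first function has infinite integral, so has the sum: its negative part is
    dominated by that of [g]. *)
Lemma ge0_integralD_integrable (u g : T -> R) : measurable_fun [set: T] u ->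
  (forall y, 0 <= u y) -> nu.-integrable [set: T] (EFin \o g) ->
  (\int[nu]_y (u y + g y)%:E = \int[nu]_y (u y)%:E + \int[nu]_y (g y)%:E)%E.
Proof.
move=> mu0 u0 gi.
have [uy|] := ltP (\int[nu]_y (u y)%:E)%E +oo%E.
  have ui : nu.-integrable [set: T] (EFin \o u).
    apply/integrableP; split; first exact/measurable_EFinP.
    by under eq_integral => y _ do rewrite /= ger0_norm//.
  by rewrite -(integralD measurableT ui gi); apply: eq_integral => y _; rewrite EFinD.
rewrite leye_eq => /eqP uy.
have gfin := integrable_fin_num measurableT gi.
have mg : measurable_fun [set: T] g by case/integrableP : gi => /measurable_EFinP.
rewrite uy addye; last by move: gfin; rewrite fin_numE => /andP[].
set w := fun y => (u y + g y)%:E.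
have neg : (\int[nu]_y w^\- y < +oo)%E.
  have := integrable_funeneg measurableT gi; case/integrableP => mn.
  under eq_integral do rewrite gee0_abs//.
  apply: le_lt_trans; apply: ge0_le_integral => //.
  - by apply: measurable_funeneg; apply/measurable_EFinP; exact: measurable_funD.
  - move=> y _; rewrite !funenegE /w/= -!EFin_max lee_fin ge_max !le_max lexx orbT andbT.
    by rewrite lerN2 lerDr u0.
have pos : (\int[nu]_y w^\+ y = +oo)%E.
  apply/eqP; rewrite -leye_eq -uy.
  have [_ gn] := integrableP _ _ _ (integrable_funeneg measurableT gi).
  have h : (\int[nu]_y (u y)%:E <= \int[nu]_y (w^\+ y + (EFin \o g)^\- y))%E.
    apply: ge0_le_integral => //.
    - by move=> y _; rewrite lee_fin.
    - exact/measurable_EFinP.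
    - apply: emeasurable_funD; first by apply: measurable_funepos; apply/measurable_EFinP; exact: measurable_funD.
      by apply: measurable_funeneg; exact/measurable_EFinP.
    - move=> y _; rewrite funeposE funenegE /w/= -!EFin_max -EFinD lee_fin.
      have h1 : u y + g y <= Num.max (u y + g y) 0 by rewrite le_max lexx.
      have h2 : - g y <= Num.max (- g y) 0 by rewrite le_max lexx.
      by lra.
  move: h; rewrite ge0_integralD//.
  - have nf : (\int[nu]_y (EFin \o g)^\- y)%E \is a fin_num.
      rewrite ge0_fin_numE ?integral_ge0//; apply: le_lt_trans gn.
      by under [leRHS]eq_integral do rewrite gee0_abs//.
    by rewrite uy -(fineK nf); case: (\int[nu]_y w^\+ y)%E.
  - by apply: measurable_funepos; apply/measurable_EFinP; exact: measurable_funD.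
  - by apply: measurable_funeneg; exact/measurable_EFinP.
by rewrite integralE pos; case: (\int[nu]_y w^\- y)%E neg.
Qed.

End shift.


Section densities.
Context {R : realType} d (T : measurableType d) (nu : probability T R).

Definition pdf (q : T -> R) := [/\ measurable_fun [set: T] q, forall y, 0 <= q y
  & (\int[nu]_y (q y)%:E = 1)%E].

Lemma pdf_integrable q : pdf q -> nu.-integrable [set: T] (EFin \o q).
Proof.
move=> [mq q0 q1]; apply/integrableP; split; first exact/measurable_EFinP.
by under eq_integral => y _ do rewrite /= ger0_norm//; rewrite q1 ltry.
Qed.

Lemma pdf_densities q : pdf q -> densities nu q.
Proof.
move=> hq; have [_ q0 q1] := hq; split => //; last exact: aeW.
by apply/Lfun1_integrable; exact: pdf_integrable.
Qed.

Lemma densities_pdf q : densities nu q ->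
  exists q', pdf q' /\ {ae nu, forall y, q y = q' y}.
Proof.
move=> [/Lfun1_integrable/integrableP[/measurable_EFinP mq _] q0 q1].
have e : {ae nu, forall y, q y = Num.max (q y) 0}.
  by apply: filterS q0 => y h; rewrite max_l.
have mm : measurable_fun [set: T] (fun y => Num.max (q y) 0) by exact: measurable_maxr.
exists (fun y => Num.max (q y) 0); split=> //; split=> //.
- by move=> y; rewrite le_max lexx orbT.
- by rewrite -[RHS]q1; apply: ae_eq_lower_integral; apply: filterS e => y <-.
Qed.

Lemma KL_ae_eq q q' p p' : {ae nu, forall y, q y = q' y} -> {ae nu, forall y, p y = p' y} ->
  KL nu q p = KL nu q' p'.
Proof.
move=> hq hp; rewrite /KL.
rewrite (@ae_eq_lower_integral _ _ _ nu _ (fun y => (q' y * \1_[set z | p' z = 0] y)%:E)); last first.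
  apply: filterS2 hq hp => y -> e; rewrite !indicE.
  by rewrite (_ : (y \in _) = (y \in [set z | p' z = 0]))//; apply/idP/idP; rewrite !inE/= e.
rewrite (@ae_eq_lower_integral _ _ _ nu (fun y => (q y * ln (q y / p y))%:E)
  (fun y => (q' y * ln (q' y / p' y))%:E))//.
by apply: filterS2 hq hp => y -> ->.
Qed.

(** A nonnegative integrand makes the divergence measurable in its parameters by
    Tonelli's theorem. *)
Definition kl (q p : T -> R) : \bar R := (\int[nu]_y (bent (q y) (p y))%:E)%E.

Definition ent (q : T -> R) : R := \int[nu]_y (q y * ln (q y)).

Lemma kl_ge0 q p : pdf q -> (forall y, 0 < p y) -> (0 <= kl q p)%E.
Proof. by move=> [_ q0 _] p0; apply: integral_ge0 => y _; rewrite lee_fin bent_ge0. Qed.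

Lemma KL_kl q p : pdf q -> pdf p -> (forall y, 0 < p y) -> KL nu q p = kl q p.
Proof.
move=> hq hp p0; rewrite /KL.
have -> : (\int[nu]_y (q y * \1_[set z | p z = 0%R] y)%:E = 0)%E.
  rewrite -[RHS](integral0 nu [set: T]); apply: eq_integral => y _.
  by rewrite indicE memNset ?mulr0//= => e; have := p0 y; rewrite e ltxx.
rewrite eqxx /kl; have [mq q0 q1] := hq; have [mp _ p1] := hp.
have ig : nu.-integrable [set: T] (EFin \o (fun y => q y - p y)).
  by have := integrableB measurableT (pdf_integrable hq) (pdf_integrable hp).
have ig0 : (\int[nu]_y (q y - p y)%:E = 0)%E.
  transitivity (\int[nu]_y (EFin \o q) y - \int[nu]_y (EFin \o p) y)%E.
    by rewrite -(integralB measurableT (pdf_integrable hq) (pdf_integrable hp)).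
  by rewrite [X in (X - _)%E]q1 [X in (_ - X)%E]p1 subee.
transitivity (\int[nu]_y (bent (q y) (p y) + (q y - p y))%:E)%E; last first.
  rewrite ge0_integralD_integrable// ?ig0 ?adde0//; first exact: measurable_bent.
  by move=> y; exact: bent_ge0.
apply: eq_integral => y _; congr (_%:E); rewrite /bent.
have := q0 y; rewrite le_eqVlt => /predU1P[<-|qy]; first by rewrite !mul0r; ring.
by rewrite ln_div ?posrE//; ring.
Qed.

Lemma xlnx_integrable q : pdf q -> L2 nu q ->
  nu.-integrable [set: T] (EFin \o (fun y => q y * ln (q y))).
Proof.
move=> [mq q0 _] hq; have i2 := integrableD measurableT (L2_sqr_integrable hq)
  (finite_measure_integrable_cst nu 1 measurableT).
apply: (le_integrable measurableT _ _ i2).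
  apply/measurable_EFinP; apply: measurable_funM => //.
  by apply: measurableT_comp => //; exact: measurable_ln.
move=> y _ /=; rewrite lee_fin (le_trans (xlnx_bounds (q0 y)))//.
by rewrite ler_norm.
Qed.

Lemma kl_L2 q p : pdf q -> L2 nu q -> pdf p -> L2 nu (fun y => ln (p y)) ->
  kl q p = (ent q - inner nu q (fun y => ln (p y)))%:E.
Proof.
move=> hq q2 hp lp.
have i1 := xlnx_integrable hq q2; have i2 := L2M q2 lp.
have i3 := pdf_integrable hq; have i4 := pdf_integrable hp.
rewrite EFinB /ent /inner /Rintegral !fineK; [|exact: (integrable_fin_num measurableT i2)|
  exact: (integrable_fin_num measurableT i1)].
rewrite -(integralB measurableT i1 i2).
have i12 := integrableB measurableT i1 i2.
have i34 := integrableB measurableT i4 i3.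
transitivity (\int[nu]_y ((EFin \o (fun y => (q y * ln (q y))%R)) y -
   (EFin \o (fun y => (q y * ln (p y))%R)) y + ((EFin \o p) y - (EFin \o q) y)))%E.
  apply: eq_integral => y _ /=; rewrite -!EFinB -EFinD; congr (_%:E).
  by rewrite /bent; ring.
rewrite (integralD measurableT i12 i34) (integralB measurableT i4 i3).
have [_ _ q1] := hq; have [_ _ p1] := hp.
by rewrite [X in (_ + (X - _))%E]p1 [X in (_ + (_ - X))%E]q1 subee// adde0.
Qed.

Lemma ent_ge0 q : pdf q -> L2 nu q -> 0 <= ent q.
Proof.
move=> hq q2; have [mq q0 q1] := hq.
have i3 := pdf_integrable hq; have ic := finite_measure_integrable_cst nu 1 measurableT.
have i5 := integrableB measurableT i3 ic.
apply: (@le_trans _ _ (\int[nu]_y (q y - 1))).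
  rewrite RintegralB// /Rintegral q1/=.
  have -> : (\int[nu]_y 1%:E = 1)%E by rewrite integral_cst// mul1e; exact: probability_setT.
  by rewrite subrr.
apply: le_Rintegral => //; first exact: xlnx_integrable.
move=> y _; have := bent_ge0 (q0 y) ltr01; rewrite /bent ln1 subr0; lra.
Qed.

(** Jensen's inequality for the logarithm, through its tangent at [B ^+ 2]. *)
Lemma ent_le q B : 0 < B -> pdf q -> L2 nu q -> inner nu q q <= B ^+ 2 -> ent q <= 2 * ln B.
Proof.
move=> B0 hq q2 qB; have [mq q0 q1] := hq.
have B2 : 0 < B ^+ 2 by rewrite exprn_gt0.
have i3 := pdf_integrable hq; have i2 := L2M q2 q2.
have i6 := integrableZl measurableT (2 * ln B - 1) i3.
have i7 := integrableZl measurableT (B ^+ 2)^-1 i2.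
have e1 : \int[nu]_y q y = 1 by rewrite /Rintegral q1.
apply: (@le_trans _ _ (\int[nu]_y ((2 * ln B - 1) * q y + (B ^+ 2)^-1 * (q y * q y)))); last first.
  rewrite RintegralD// RintegralZl// RintegralZl// e1 mulr1 -[\int[nu]_y (q y * q y)]/(inner nu q q).
  have : (B ^+ 2)^-1 * inner nu q q <= 1 by rewrite mulrC ler_pdivrMr ?mul1r.
  by lra.
apply: le_Rintegral => //; first exact: xlnx_integrable.
  by have := integrableD measurableT i6 i7.
move=> y _; have := q0 y; rewrite le_eqVlt => /predU1P[<-|qy]; first by rewrite !(mul0r,mulr0) addr0.
have := ln_le_subr1 (divr_gt0 qy B2); rewrite ln_div ?posrE// lnXn// mulr_natl => h.
have := ler_wpM2l (ltW qy) h.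
rewrite (_ : q y * (q y / B ^+ 2 - 1) = (B ^+ 2)^-1 * (q y * q y) - q y); last by ring.
by rewrite -mulr_natl; lra.
Qed.

End densities.


Section density_family.
Context {R : realType} d1 d2 (S : measurableType d1) (T : measurableType d2).
Variables (nu : probability T R) (f : S * T -> R) (b c : R).

Definition dens (x : S) (y : T) : R := f (x, y).
Definition logdens (x : S) (y : T) : R := ln (f (x, y)).

Definition density_family := [/\ measurable_fun [set: S * T] f, forall z, 0 < f z,
  0 <= b, 0 <= c &
  forall x, [/\ (\int[nu]_y (f (x, y))%:E = 1)%E,
    (\int[nu]_y (f (x, y) ^+ 2)%:E <= (b ^+ 2)%:E)%E &
    (\int[nu]_y (ln (f (x, y)) ^+ 2)%:E <= (c ^+ 2)%:E)%E]].

Hypothesis hf : density_family.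

Lemma measurable_logf : measurable_fun [set: S * T] (fun z => ln (f z)).
Proof. by case: hf => mf *; apply: measurableT_comp => //; exact: measurable_ln. Qed.

Lemma pdf_dens x : pdf nu (dens x).
Proof.
case: hf => mf f0 _ _ /(_ x)[f1 _ _]; split => //; first exact: measurable_fun_pair2.
by move=> y; rewrite ltW //; exact: f0.
Qed.

Lemma dens_gt0 x y : 0 < dens x y.
Proof. by have [_ f0 _ _ _] := hf; exact: f0. Qed.

Lemma L2_dens x : L2 nu (dens x).
Proof.
case: hf => mf f0 _ _ /(_ x)[_ fb _]; split; first exact: measurable_fun_pair2.
exact: (le_lt_trans fb (ltry _)).
Qed.

Lemma L2_logdens x : L2 nu (logdens x).
Proof.
case: hf => mf f0 _ _ /(_ x)[_ _ fc]; split; last exact: (le_lt_trans fc (ltry _)).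
exact: (measurableT_comp measurable_logf (pair1_measurable x)).
Qed.

Lemma inner_dens x : inner nu (dens x) (dens x) <= b ^+ 2.
Proof.
by case: hf => _ _ _ _ /(_ x)[_ fb _]; rewrite -lee_fin -L2_sqrE//; exact: L2_dens.
Qed.

Lemma inner_logdens x : inner nu (logdens x) (logdens x) <= c ^+ 2.
Proof.
by case: hf => _ _ _ _ /(_ x)[_ _ fc]; rewrite -lee_fin -L2_sqrE//; exact: L2_logdens.
Qed.

Lemma measurable_kl q : pdf nu q -> measurable_fun [set: S] (fun x => kl nu q (dens x)).
Proof.
move=> [mq q0 _]; case: hf => mf f0 *.
pose F (z : S * T) := (bent (q z.2) (f z))%:E.
apply: (@measurable_fun_fubini_tonelli_F _ _ _ _ _ nu F).
  by apply/measurable_EFinP; apply: measurable_bent => //; exact: measurableT_comp.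
by move=> z; rewrite lee_fin bent_ge0.
Qed.

(** The real value of the divergence of a square-integrable center: up to its entropy,
    a linear form in it. *)
Definition klr (q : T -> R) (x : S) : R := ent nu q - inner nu q (logdens x).

Lemma kl_klr q x : pdf nu q -> L2 nu q -> kl nu q (dens x) = (klr q x)%:E.
Proof.
move=> hq q2; rewrite (kl_L2 hq q2 (pdf_dens x))//; exact: L2_logdens.
Qed.

Lemma measurable_klr q : pdf nu q -> L2 nu q -> measurable_fun [set: S] (klr q).
Proof.
move=> hq q2; apply/measurable_EFinP.
apply: (eq_measurable_fun (fun x => kl nu q (dens x))) => [x _|]; first by rewrite kl_klr.
exact: measurable_kl.
Qed.

Lemma klr_ge0 q x : pdf nu q -> L2 nu q -> 0 <= klr q x.
Proof. by move=> hq q2; rewrite -lee_fin -kl_klr// kl_ge0//; exact: dens_gt0. Qed.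

Lemma klr_le q x B : 0 < B -> pdf nu q -> L2 nu q -> inner nu q q <= B ^+ 2 ->
  klr q x <= B * c + 2 * ln B.
Proof.
move=> B0 hq q2 qB; rewrite /klr.
have h1 := ent_le B0 hq q2 qB.
have c0 : 0 <= c by case: hf.
have := inner_cauchy_schwarz q2 (L2_logdens x) (ltW B0) c0 qB (inner_logdens x).
by rewrite ler_norml => /andP[h2 _]; lra.
Qed.

Lemma pdf_one : pdf nu (cst 1).
Proof.
split => //; transitivity (\int[nu]_y 1%:E)%E; first by [].
by rewrite integral_cst// mul1e; exact: probability_setT.
Qed.

Lemma klr_one_le x : klr (cst 1) x <= c.
Proof.
have -> : c = 1 * c + 2 * ln 1 by rewrite ln1 mulr0 addr0 mul1r.
apply: klr_le => //; [exact: pdf_one|exact: L2_cst|].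
have [_ _ o1] := pdf_one; rewrite /inner.
by under eq_Rintegral do rewrite mulr1; rewrite /Rintegral o1 expr1n.
Qed.

Lemma density_bound_ge1 : S -> 1 <= b.
Proof.
move=> x; have b0 : 0 <= b by case: hf.
have := inner_cauchy_schwarz (L2_dens x) (L2_cst nu 1) b0 ler01 (inner_dens x).
have [_ _ f1] := pdf_dens x; have [_ _ o1] := pdf_one.
have -> : inner nu (dens x) (cst 1) = 1.
  by rewrite /inner; under eq_Rintegral do rewrite mulr1; rewrite /Rintegral f1.
have -> : inner nu (cst 1) (cst 1) = 1.
  by rewrite /inner; under eq_Rintegral do rewrite mulr1; rewrite /Rintegral o1.
by rewrite expr1n lexx normr1 mulr1; apply.
Qed.

End density_family.


(** * Centroids *)


Section centroid.
Context {R : realType} d1 d2 (S : measurableType d1) (T : measurableType d2).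
Variables (nu : probability T R) (f : S * T -> R) (b c : R).
Hypothesis hf : density_family nu f b c.
Variable pi : probability S R.

Let mf : measurable_fun [set: S * T] f. Proof. by case: hf. Qed.
Let mlf := measurable_logf hf.
Let f0 z : 0 < f z. Proof. by have [_ h _ _ _] := hf; exact: h. Qed.

Let prob_cst d (V : measurableType d) (Q : probability V R) (r : R) : (\int[Q]_y r%:E = r%:E)%E.
Proof.
have -> : (\int[Q]_y r%:E = r%:E * Q setT)%E by rewrite integral_cst.
have -> : (Q setT = 1)%E by exact: probability_setT.
by rewrite mule1.
Qed.

Lemma sqr_family_integrable :
  (pi \x nu)%E.-integrable [set: S * T] (fun z => (f z ^+ 2)%:E).
Proof.
apply/integrable12ltyP; first by apply/measurable_EFinP; exact: measurable_funX.
apply: (@le_lt_trans _ _ (\int[pi]_x (b ^+ 2)%:E)%E); last by rewrite prob_cst ltry.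
apply: ge0_le_integral => //.
- by move=> x _; exact: integral_ge0.
- apply: (@measurable_fun_fubini_tonelli_F _ _ _ _ _ nu (fun z => `|(f z ^+ 2)%:E|%E)) => //.
  by apply: measurableT_comp => //; apply/measurable_EFinP; exact: measurable_funX.
- move=> x _; have [_ _ _ _ /(_ x)[_ h _]] := hf.
  by under eq_integral do rewrite abse_EFin ger0_norm ?sqr_ge0//.
Qed.

Lemma log_family_integrable :
  (pi \x nu)%E.-integrable [set: S * T] (fun z => (ln (f z))%:E).
Proof.
apply/integrable12ltyP; first exact/measurable_EFinP.
apply: (@le_lt_trans _ _ (\int[pi]_x (c ^+ 2 + 1)%:E)%E); last by rewrite prob_cst ltry.
apply: ge0_le_integral => //.
- by move=> x _; exact: integral_ge0.
- apply: (@measurable_fun_fubini_tonelli_F _ _ _ _ _ nu (fun z => `|(ln (f z))%:E|%E)) => //.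
  by apply: measurableT_comp => //; exact/measurable_EFinP.
- move=> x _; have [_ _ _ _ /(_ x)[_ _ h]] := hf.
  apply: (@le_trans _ _ (\int[nu]_y ((ln (f (x, y)) ^+ 2)%:E + 1%:E))%E).
    apply: ge0_le_integral => //.
    + by apply: measurableT_comp => //; apply/measurable_EFinP; exact: (measurable_fun_pair2 x mlf).
    + apply/measurable_EFinP; apply: measurable_funD => //; apply: measurable_funX.
      exact: (measurable_fun_pair2 x mlf).
    + move=> y _; rewrite lee_fin -(real_normK (num_real (ln _))).
      by have := sqr_ge0 (`|ln (f (x, y))| - 1); have := normr_ge0 (ln (f (x, y))); nra.
  rewrite ge0_integralD//.
  + by rewrite prob_cst EFinD leeD2r.
  + by move=> y _; rewrite lee_fin sqr_ge0.
  + by apply/measurable_EFinP; apply: measurable_funX; exact: (measurable_fun_pair2 x mlf).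
Qed.

(** The geometric mean of the densities under [pi]; normalised, it is the density
    closest to them on average. *)
Definition logmean (y : T) : R := \int[pi]_x ln (f (x, y)).
Definition geomean (y : T) : R := expR (logmean y).
Definition geomass : R := \int[nu]_y geomean y.
Definition centroid (y : T) : R := geomean y / geomass.

Lemma measurable_logmean : measurable_fun [set: T] logmean.
Proof.
have h := measurable_fubini_G log_family_integrable.
by apply: (measurableT_comp _ h).
Qed.

Lemma measurable_geomean : measurable_fun [set: T] geomean.
Proof. by apply: measurableT_comp => //; exact: measurable_logmean. Qed.

(** Jensen's inequality, through the tangent of the exponential. *)
Lemma geomean_sqr_le : {ae nu, forall y, ((geomean y ^+ 2)%:E <= \int[pi]_x (f (x, y) ^+ 2)%:E)%E}.
Proof.
near=> y.
have i1 : pi.-integrable [set: S] (EFin \o (fun x => ln (f (x, y)))).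
  by near: y; exact: (ae_integrable2 log_family_integrable).
have i2 : pi.-integrable [set: S] (EFin \o (fun x => f (x, y) ^+ 2)).
  by near: y; exact: (ae_integrable2 sqr_family_integrable).
have i3 := integrableZl measurableT 2 i1.
have ic := finite_measure_integrable_cst pi (1 - 2 * logmean y) measurableT.
have i4 := integrableD measurableT i3 ic.
have i5 := integrableZl measurableT (geomean y ^+ 2) i4.
apply: (@le_trans _ _ (\int[pi]_x ((geomean y ^+ 2)%:E * (2%:E * (ln (f (x, y)))%:E + (1 - 2 * logmean y)%:E)))%E).
  rewrite (integralZl measurableT i4) (integralD measurableT i3 ic) (integralZl measurableT i1).
  rewrite [X in (_ * (_ + X))%E](prob_cst pi).
  have -> : (\int[pi]_x (EFin \o (fun x => ln (f (x, y)))) x = (logmean y)%:E)%E.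
    by rewrite /logmean /Rintegral fineK//; exact: (integrable_fin_num measurableT i1).
  rewrite -[leRHS]/((geomean y ^+ 2 * (2 * logmean y + (1 - 2 * logmean y)))%:E) lee_fin.
  by rewrite (_ : _ + _ = 1) ?mulr1//; ring.
apply: le_integral => // x _ /=.
rewrite -[leLHS]/((geomean y ^+ 2 * (2 * ln (f (x, y)) + (1 - 2 * logmean y)))%:E) lee_fin.
have -> : f (x, y) ^+ 2 = geomean y ^+ 2 * expR (2 * ln (f (x, y)) - 2 * logmean y).
  rewrite /geomean -expRM_natl -expRD mulr_natl -[in LHS](lnK (_ : f (x, y) \is Num.pos)) ?posrE//.
  by rewrite -expRM_natl; congr (expR _); ring.
apply: ler_wpM2l; first by rewrite sqr_ge0.
by have := expR_ge1Dx (2 * ln (f (x, y)) - 2 * logmean y); lra.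
Unshelve. all: by end_near. Qed.

Lemma geomean_sqr_integral : (\int[nu]_y (geomean y ^+ 2)%:E <= (b ^+ 2)%:E)%E.
Proof.
have mg : measurable_fun [set: T] (fun y => (geomean y ^+ 2)%:E).
  by apply/measurable_EFinP; apply: measurable_funX; exact: measurable_geomean.
have mf2 : measurable_fun [set: S * T] (fun z => (f z ^+ 2)%:E).
  by apply/measurable_EFinP; exact: measurable_funX.
apply: (@le_trans _ _ (\int[nu]_y \int[pi]_x (f (x, y) ^+ 2)%:E)%E).
  apply: ge0_ae_le_lower_integral => [y|y|]; last exact: geomean_sqr_le.
    by rewrite lee_fin sqr_ge0.
  by apply: integral_ge0 => x _; rewrite lee_fin sqr_ge0.
rewrite -(fubini_tonelli (fun z => (f z ^+ 2)%:E))//; last by move=> z; rewrite lee_fin sqr_ge0.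
rewrite -[leRHS](prob_cst pi); apply: ge0_le_integral => //.
- by move=> x _; apply: integral_ge0 => y _; rewrite lee_fin sqr_ge0.
- apply: (@measurable_fun_fubini_tonelli_F _ _ _ _ _ nu (fun z => (f z ^+ 2)%:E)) => //.
  by move=> z; rewrite lee_fin sqr_ge0.
- by move=> x _; have [_ _ _ _ /(_ x)[]] := hf.
Qed.

Lemma L2_geomean : L2 nu geomean.
Proof.
split; first exact: measurable_geomean.
exact: (le_lt_trans geomean_sqr_integral (ltry _)).
Qed.

Lemma geomass_gt0 : 0 < geomass.
Proof.
have i := L2_integrable L2_geomean.
rewrite lt_def Rintegral_ge0 ?andbT => [|y _]; last exact: expR_ge0.
apply/eqP => Z0.
have : (\int[nu]_y `|(EFin \o geomean) y| = 0)%E.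
  under eq_integral do rewrite /= ger0_norm ?expR_ge0//.
  by rewrite -(fineK (integrable_fin_num measurableT i)); congr (_%:E).
move/ae_eq_integral_abs => /(_ measurableT) h.
have {}h : ae_eq nu [set: T] (EFin \o geomean) (cst 0%E).
  by apply: h; apply/measurable_EFinP; exact: measurable_geomean.
have [E [_ E1 hE]] := ae_full_set h.
have [y Ey] := full_set_ex E1.
by have := hE _ Ey I => /= -[] /eqP; rewrite gt_eqF// expR_gt0.
Qed.

Lemma pdf_centroid : pdf nu centroid.
Proof.
have Z0 := geomass_gt0; have i := L2_integrable L2_geomean.
split.
- by apply: measurable_funM => //; exact: measurable_geomean.
- by move=> y; rewrite divr_ge0 ?expR_ge0// ltW.
- transitivity (\int[nu]_y (geomass^-1%:E * (EFin \o geomean) y))%E.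
    by apply: eq_integral => y _; rewrite /= -EFinM mulrC.
  rewrite (integralZl measurableT i) -(fineK (integrable_fin_num measurableT i)) -EFinM.
  by rewrite mulVf// gt_eqF.
Qed.

Let centroidE : centroid = fun y => geomass^-1 * geomean y.
Proof. by apply/funext => y; rewrite /centroid mulrC. Qed.

Lemma L2_centroid : L2 nu centroid.
Proof. by rewrite centroidE; apply: L2Z; exact: L2_geomean. Qed.

Lemma inner_centroid : inner nu centroid centroid <= (b / geomass) ^+ 2.
Proof.
have Z0 := geomass_gt0; rewrite centroidE innerZ; last exact: L2_geomean.
rewrite exprMn mulrC ler_pM2r ?exprn_gt0 ?invr_gt0//.
by rewrite -lee_fin -L2_sqrE; [exact: geomean_sqr_integral|exact: L2_geomean].
Qed.

(** Pythagorean identity: averaging the divergences to the family splits off the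
    divergence to the centroid. *)
Lemma centroid_pythagoras q : pdf nu q ->
  (\int[pi]_x kl nu q (dens f x) = kl nu q centroid - (ln geomass)%:E)%E.
Proof.
move=> hq; have [mq q0 q1] := hq; have Z0 := geomass_gt0.
have [mc c0 c1] := pdf_centroid.
have qi := pdf_integrable hq; have ci := pdf_integrable pdf_centroid.
pose F (z : S * T) := (bent (q z.2) (f z))%:E.
have mF : measurable_fun [set: S * T] F.
  by apply/measurable_EFinP; apply: measurable_bent => //; exact: measurableT_comp.
have F0 z : (0 <= F z)%E by rewrite lee_fin bent_ge0.
rewrite (_ : \int[pi]_x kl nu q (dens f x) = \int[pi]_x \int[nu]_y F (x, y))%E//.
rewrite fubini_tonelli//.
pose fbar y := \int[pi]_x f (x, y).
have mfE : measurable_fun [set: S * T] (fun z => (f z)%:E) by exact/measurable_EFinP.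
have fE0 z : (0 <= (f z)%:E)%E by rewrite lee_fin ltW.
have fint : (pi \x nu)%E.-integrable [set: S * T] (fun z => (f z)%:E).
  apply/integrable12ltyP => //; apply: (@le_lt_trans _ _ (\int[pi]_x 1%:E)%E); last by rewrite prob_cst ltry.
  rewrite le_eqVlt; apply/orP; left; apply/eqP; apply: eq_integral => x _.
  have [_ _ _ _ /(_ x)[h _ _]] := hf; rewrite -[RHS]h; apply: eq_integral => y _.
  by rewrite abse_EFin gtr0_norm.
have fbarE : {ae nu, forall y, (fbar y)%:E = (\int[pi]_x (f (x, y))%:E)%E}.
  apply: filterS (ae_integrable2 fint) => y i.
  by rewrite /fbar /Rintegral fineK//; exact: (integrable_fin_num measurableT i).
have mfbar : measurable_fun [set: T] fbar.
  have h := measurable_fubini_G fint; exact: (measurableT_comp _ h).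
have fbar0 y : 0 <= fbar y by apply: Rintegral_ge0 => x _; exact: ltW.
have fbar1 : (\int[nu]_y (fbar y)%:E = 1)%E.
  rewrite (ae_eq_lower_integral fbarE) -(fubini_tonelli (fun z => (f z)%:E))//.
  transitivity (\int[pi]_x 1%:E)%E; last exact: prob_cst.
  by apply: eq_integral => x _; have [_ _ _ _ /(_ x)[]] := hf.
have fbari : nu.-integrable [set: T] (EFin \o fbar) by apply: pdf_integrable; split.
pose g y := fbar y - centroid y - ln geomass * q y.
have i1 := integrableB measurableT fbari ci.
have i2 := integrableZl measurableT (ln geomass) qi.
have gi : nu.-integrable [set: T] (EFin \o g).
  by have := integrableB measurableT i1 i2.
have g1 : (\int[nu]_y (g y)%:E = - (ln geomass)%:E)%E.
  transitivity (\int[nu]_y ((EFin \o fbar) y - (EFin \o centroid) y) -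
      \int[nu]_y ((ln geomass)%:E * (EFin \o q) y))%E.
    by rewrite -(integralB measurableT i1 i2).
  rewrite (integralB measurableT fbari ci) (integralZl measurableT qi).
  by rewrite [X in (X - _ - _)%E]fbar1 [X in (_ - X - _)%E]c1 [X in (_ * X)%E]q1 subee// add0e mule1.
transitivity (\int[nu]_y (bent (q y) (centroid y) + g y)%:E)%E; last first.
  rewrite ge0_integralD_integrable//; first by rewrite g1.
    exact: measurable_bent.
  by move=> y; apply: bent_ge0 => //; rewrite divr_gt0// expR_gt0.
apply: ae_eq_lower_integral; near=> y.
have j1 : pi.-integrable [set: S] (EFin \o (fun x => ln (f (x, y)))).
  by near: y; exact: (ae_integrable2 log_family_integrable).
have j2 : pi.-integrable [set: S] (EFin \o (fun x => f (x, y))).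
  by near: y; exact: (ae_integrable2 fint).
have j3 := integrableZl measurableT (- q y) j1.
have j4 := integrableD measurableT j3 j2.
have jc := finite_measure_integrable_cst pi (q y * ln (q y) - q y) measurableT.
transitivity (\int[pi]_x (((- q y)%:E * (ln (f (x, y)))%:E + (f (x, y))%:E) +
    (q y * ln (q y) - q y)%:E))%E.
  apply: eq_integral => x _; rewrite /F /bent/=.
  rewrite -[RHS]/((- q y * ln (f (x, y)) + f (x, y) + (q y * ln (q y) - q y))%:E).
  by congr (_%:E); ring.
rewrite (integralD measurableT j4 jc) (integralD measurableT j3 j2) (integralZl measurableT j1).
rewrite [X in (_ + X)%E](prob_cst pi).
rewrite -(fineK (integrable_fin_num measurableT j1)) -(fineK (integrable_fin_num measurableT j2)).
rewrite -[LHS]/((- q y * logmean y + fbar y + (q y * ln (q y) - q y))%:E).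
congr (_%:E); rewrite /bent /g /centroid ln_div ?posrE ?expR_gt0// /geomean expRK.
by ring.
Unshelve. all: by end_near. Qed.

Lemma centroid_gt0 y : 0 < centroid y.
Proof. by rewrite divr_gt0 ?expR_gt0// geomass_gt0. Qed.

Lemma klxx q : kl nu q q = 0%E.
Proof. by rewrite /kl; under eq_integral do rewrite bentxx subrr; exact: integral0. Qed.

Lemma centroid_le q : pdf nu q ->
  (\int[pi]_x kl nu centroid (dens f x) <= \int[pi]_x kl nu q (dens f x))%E.
Proof.
move=> hq; rewrite !centroid_pythagoras//; last exact: pdf_centroid.
by rewrite klxx leeD2r// kl_ge0// => y; exact: centroid_gt0.
Qed.

Lemma geomass_ge q r : pdf nu q -> {ae pi, forall x, (kl nu q (dens f x) <= r%:E)%E} ->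
  expR (- r) <= geomass.
Proof.
move=> hq hr; have : (\int[pi]_x kl nu q (dens f x) <= \int[pi]_x r%:E)%E.
  have r0 : 0 <= r.
    have [E [_ E1 hE]] := ae_full_set hr; have [z Ez] := full_set_ex E1.
    by rewrite -lee_fin (le_trans _ (hE _ Ez))// kl_ge0// => y; exact: (dens_gt0 hf).
  apply: ge0_ae_le_lower_integral => //.
  by move=> z; apply: kl_ge0 => // y; exact: (dens_gt0 hf).
rewrite centroid_pythagoras// prob_cst => h.
have : (- (ln geomass)%:E <= r%:E)%E.
  by apply: le_trans h; rewrite -[leLHS]add0e leeD2r// kl_ge0// => y; exact: centroid_gt0.
by rewrite lee_fin => h'; rewrite -[leRHS](lnK geomass_gt0) ler_expR; lra.
Qed.

End centroid.


Local Open Scope ereal_scope.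

Section conditioning.
Context {R : realType} d (S : measurableType d) (mu : probability S R).

(** Integrals over a cell are integrals under a probability, to which the results on
    averages of the whole family apply. *)
Lemma conditioned_law (A : set S) : measurable A -> mu A != 0 ->
  exists pi : probability S R,
    (forall E, measurable E -> mu E = 0 -> pi E = 0) /\
    (forall g : S -> \bar R, measurable_fun [set: S] g -> (forall x, 0 <= g x) ->
       \int[mu]_(x in A) g x = mu A * \int[pi]_x g x).
Proof.
move=> mA A0; pose a := fine (mu A).
have Afin : mu A \is a fin_num by exact: fin_num_measure.
have aE : mu A = a%:E by rewrite /a fineK.
have a0 : (0 < a)%R.
  by rewrite -lte_fin -aE lt_def A0 measure_ge0.
pose m := mrestr mu mA.
have ia0 : (0 <= a^-1)%R by rewrite invr_ge0 ltW.
pose sm := mscale (NngNum ia0) m.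
pose pi := mnormalize m mu.
have piE E : pi E = sm E.
  rewrite /pi /mnormalize /sm /mscale /= /m /mrestr setTI aE.
  by rewrite eqe gt_eqF//= muleC.
exists pi; split=> [E mE E0|g mg g0].
  transitivity (sm E); first exact: piE.
  rewrite /sm /mscale/= /m /mrestr.
  have -> : mu (E `&` A) = 0 by apply: (subset_measure0 (mu := mu) _ _ _ E0) => //; exact: measurableI.
  by rewrite mule0.
have -> : \int[mnormalize m mu]_x g x = \int[sm]_x g x.
  by apply: eq_measure_integral => E mE _; exact: piE.
rewrite ge0_integral_mscale// muleA aE -EFinM divff ?gt_eqF// mul1e.
rewrite -(setUv A) ge0_integral_setU//.
- rewrite [X in _ + X](_ : _ = 0) ?adde0.
    apply: eq_measure_integral => E mE EA.
    by rewrite /m/= /mrestr setIidl.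
  apply: null_set_integral; first exact: measurableC.
    exact: measurable_funTS.
  by rewrite /m/= /mrestr setICl measure0.
- exact: measurableC.
- by rewrite setUv.
- by apply/disj_setPS; rewrite setICr.
Qed.

End conditioning.

Section first_minimum.
Context {R : realType} d (S : measurableType d) (k : nat) (g : 'I_k.+1 -> S -> \bar R).
Hypothesis mg : forall j, measurable_fun [set: S] (g j).

(** Ties go to the smallest index, so that the cells are disjoint. *)
Definition cell (j : 'I_k.+1) : set S :=
  [set x | forall i, g j x <= g i x /\ ((i < j)%N -> g j x < g i x)].

Lemma measurable_cell j : measurable (cell j).
Proof.
pose C i := [set x | g j x <= g i x] `&` (if (i < j)%N then [set x | g j x < g i x] else setT).
rewrite (_ : cell j = \bigcap_(i in [set: 'I_k.+1]) C i).
  apply: fin_bigcap_measurable => [|i _]; first exact: finite_finset.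
  apply: measurableI.
    by have := measurable_lee measurableT (mg j) (mg i); rewrite setTI.
  case: ifPn => // _.
  by have := measurable_lte measurableT (mg j) (mg i); rewrite setTI.
apply/seteqP; split => x /= h i.
  by move=> _; have [h1 h2] := h i; split => //; case: ifPn => //; exact: h2.
have [h1 h2] := h i I; split => //; move: h2; by case: ifPn.
Qed.

Lemma cell_inj i j x : cell i x -> cell j x -> i = j.
Proof.
move=> hi hj; have [l1 h1] := hi j; have [l2 h2] := hj i.
case: (ltngtP i j) => [ij|ji|/val_inj//].
- by have := lt_le_trans (h2 ij) l1; rewrite ltxx.
- by have := lt_le_trans (h1 ji) l2; rewrite ltxx.
Qed.

Lemma cell_ex x : exists j, cell j x.
Proof.
pose P n := [exists j : 'I_k.+1, (val j == n) && [forall i, g j x <= g i x]].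
have exP : exists n, P n.
  case: (@Order.TotalTheory.arg_minP _ _ _ (ord0 : 'I_k.+1) xpredT (fun j => g j x) isT) => j _ hj.
  exists (val j); apply/existsP; exists j; rewrite eqxx/=.
  by apply/forallP => i; exact: hj.
case: (ex_minnP exP) => m /existsP[j /andP[/eqP jE /forallP hj]] hm.
exists j => i; split => // ij; rewrite ltNge; apply/negP => ij'.
have : P (val i).
  apply/existsP; exists i; rewrite eqxx/=; apply/forallP => i'.
  exact: (le_trans ij').
by move/hm; rewrite -jE leqNgt ij.
Qed.

Lemma cell_minE j x : cell j x -> \big[mine/+oo]_(i < k.+1) g i x = g j x.
Proof.
move=> h; apply/eqP; rewrite eq_le; apply/andP; split; first exact: bigmin_le.
by apply: le_bigmin => [|i _]; [exact: leey|have [] := h i].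
Qed.

End first_minimum.

Local Close Scope ereal_scope.


Local Open Scope ereal_scope.

Section quantizer.
Context {R : realType} d1 d2 (S : measurableType d1) (T : measurableType d2).
Variables (mu : probability S R) (nu : probability T R) (f : S * T -> R) (b c r : R).
Hypothesis hf : density_family nu f b c.
Hypothesis hr : forall rho, (r < rho)%R -> exists q, pdf nu q /\
  {ae mu, forall x, kl nu q (dens f x) <= rho%:E}.

Definition ball (B : R) (q : T -> R) := [/\ pdf nu q, L2 nu q & (inner nu q q <= B ^+ 2)%R].

Let dens0 x y : (0 < dens f x y)%R. Proof. exact: (dens_gt0 hf). Qed.

(** The centroid of the law conditioned on the cell; its norm is controlled by the mass
    of the geometric mean, hence by the radius. *)
Lemma cell_centroid (A : set S) : measurable A -> mu A != 0 ->
  exists q', ball (b * expR r) q' /\ forall q, pdf nu q ->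
    \int[mu]_(x in A) kl nu q' (dens f x) <= \int[mu]_(x in A) kl nu q (dens f x).
Proof.
move=> mA A0; have [pi [pi_mu piE]] := conditioned_law mA A0.
have pq := pdf_centroid hf pi; have Z0 := geomass_gt0 hf pi.
exists (centroid nu f pi); split; last first.
  move=> q hq; rewrite !piE.
  - by apply: lee_wpmul2l; [exact: measure_ge0|exact: (centroid_le hf pi hq)].
  - exact: (measurable_kl hf hq).
  - by move=> x; exact: kl_ge0.
  - exact: (measurable_kl hf pq).
  - by move=> x; exact: kl_ge0.
split=> //; first exact: (L2_centroid hf pi).
have b0 : (0 <= b)%R by case: hf.
apply: (le_trans (inner_centroid hf pi)).
rewrite lerXn2r ?nnegrE ?mulr_ge0 ?invr_ge0 ?expR_ge0 ?(ltW Z0)//.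
apply: ler_wpM2l => //.
rewrite -[leLHS](lnK (_ : _ \is Num.pos)) ?posrE ?invr_gt0// ler_expR lnV ?posrE//.
apply/ler_addgt0Pr => e e0.
have [q [hq [N [mN N0 sN]]]] : exists q, pdf nu q /\
    {ae mu, forall x, kl nu q (dens f x) <= (r + e)%:E} by apply: hr; rewrite ltrDl.
have : {ae pi, forall x, kl nu q (dens f x) <= (r + e)%:E}.
  by exists N; split => //; exact: pi_mu.
move/(geomass_ge hf hq) => h.
have : (ln (expR (- (r + e))) <= ln (geomass nu f pi))%R by rewrite ler_ln ?posrE ?expR_gt0.
by rewrite expRK; lra.
Qed.

Lemma ball_ex : exists q, ball (b * expR r) q.
Proof.
have m1 : mu setT = 1 by exact: probability_setT.
have [|q [hq _]] := cell_centroid measurableT; last by exists q.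
by rewrite m1 onee_neq0.
Qed.

(** Replacing each center by the centroid of its cell decreases the risk, as in the
    update step of Lloyd's algorithm. *)
Lemma centroid_update k (q : 'I_k.+1 -> T -> R) : (forall j, pdf nu (q j)) ->
  exists q' : 'I_k.+1 -> T -> R, (forall j, ball (b * expR r) (q' j)) /\
    \int[mu]_x \big[mine/+oo]_j kl nu (q' j) (dens f x) <=
    \int[mu]_x \big[mine/+oo]_j kl nu (q j) (dens f x).
Proof.
move=> hq; pose g j x := kl nu (q j) (dens f x).
have mg j : measurable_fun [set: S] (g j) by exact: (measurable_kl hf (hq j)).
have mA j := measurable_cell mg j.
have : forall j, exists q', ball (b * expR r) q' /\
    \int[mu]_(x in cell g j) kl nu q' (dens f x) <= \int[mu]_(x in cell g j) g j x.
  move=> j; have [A0|A0] := eqVneq (mu (cell g j)) 0.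
    have [q0 hq0] := ball_ex; exists q0; split; first exact: hq0.
    rewrite null_set_integral//; first by apply: integral_ge0 => x _; exact: kl_ge0.
    by apply: measurable_funTS; apply: (measurable_kl hf); case: hq0.
  have [q' [hq' le]] := cell_centroid (mA j) A0.
  by exists q'; split; [exact: hq'|exact: le].
move/choice => [q' hq']; exists q'; split => [j|]; first by case: (hq' j).
pose g' j x := kl nu (q' j) (dens f x).
have p' j : pdf nu (q' j) by case: (hq' j) => -[].
have mg' j : measurable_fun [set: S] (g' j) by exact: (measurable_kl hf (p' j)).
have g0 j x : 0 <= g j x by exact: kl_ge0.
have g'0 j x : 0 <= g' j x by exact: kl_ge0.
have sumE (h : 'I_k.+1 -> S -> \bar R) j x : cell g j x ->
    \sum_i (h i \_ (cell g i)) x = h j x.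
  move=> jx; rewrite (bigD1 j)//= big1 ?adde0 => [|i ij]; first by rewrite patchE mem_set.
  rewrite patchE memNset// => ix; move: ij.
  by rewrite (cell_inj ix jx) eqxx.
have mr (h : 'I_k.+1 -> S -> \bar R) : (forall j, measurable_fun [set: S] (h j)) ->
    forall j, measurable_fun [set: S] (h j \_ (cell g j)).
  by move=> mh j; apply/(measurable_restrictT _ (mA j)); exact: measurable_funTS.
have r0 (h : 'I_k.+1 -> S -> \bar R) : (forall j x, 0 <= h j x) ->
    forall j x, 0 <= (h j \_ (cell g j)) x.
  by move=> h0 j x; rewrite patchE; case: ifP.
apply: (@le_trans _ _ (\int[mu]_x \sum_j (g' j \_ (cell g j)) x)).
  apply: ge0_ae_le_lower_integral => [x|x|].
  - by apply: le_bigmin => [|j _]; [exact: leey|exact: g'0].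
  - by apply: sume_ge0 => j _; exact: r0.
  - apply: aeW => x; have [j jx] := cell_ex g x.
    by rewrite (sumE g' _ _ jx); exact: bigmin_le.
rewrite ge0_integral_sum//; [|exact: mr|by move=> j x _; exact: r0].
apply: (@le_trans _ _ (\sum_j \int[mu]_x (g j \_ (cell g j)) x)).
  apply: lee_sum => j _; rewrite -!integral_mkcond.
  by case: (hq' j).
rewrite -ge0_integral_sum//; [|exact: mr|by move=> j x _; exact: r0].
rewrite le_eqVlt; apply/orP; left; apply/eqP; apply: eq_integral => x _.
by have [j jx] := cell_ex g x; rewrite (sumE g _ _ jx) (cell_minE jx).
Qed.

End quantizer.

Local Close Scope ereal_scope.


(** * A countable dense family of centers *)


Section weak_convergence.
Import HBNNSimple.
Context {R : realType} d (T : measurableType d) (nu : probability T R).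
Variables (del : nat -> T -> R) (K : R).
Hypothesis del2 : forall m, L2 nu (del m).
Hypothesis K0 : 0 <= K.
Hypothesis delK : forall m, inner nu (del m) (del m) <= K ^+ 2.

Let null (g : T -> R) := (fun m => inner nu (del m) g) @ \oo --> (0 : R).

(** Boundedness makes the functions on which the sequence is weakly null a closed set;
    countable unions and simple approximations are both limits in quadratic mean. *)
Lemma weak_null_closure (g : T -> R) : L2 nu g ->
  (forall e, 0 < e -> exists h, [/\ L2 nu h, null h &
     inner nu (fun y => g y - h y) (fun y => g y - h y) <= e ^+ 2]) -> null g.
Proof.
move=> g2 hg; apply/cvgrPdist_le => e e0.
have K10 : 0 < 2 * (K + 1) by rewrite mulr_gt0// ltr_wpDl.
have [h [h2 nh gh]] := hg (e / (2 * (K + 1))) (divr_gt0 e0 K10).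
have e20 : 0 < e / 2 by rewrite divr_gt0.
move/cvgrPdist_le : nh => /(_ _ e20); apply: filterS => m; rewrite !sub0r !normrN => hm.
have gh2 := L2B g2 h2.
have := inner_cauchy_schwarz (del2 m) gh2 K0 (ltW (divr_gt0 e0 K10)) (delK m) gh.
rewrite innerC innerBl// (innerC nu g) (innerC nu h) => cs.
have : K * (e / (2 * (K + 1))) <= e / 2.
  rewrite (_ : K * (e / (2 * (K + 1))) = (e / 2) * (K / (K + 1))); last by field; rewrite gt_eqF// ltr_wpDl.
  rewrite ler_piMr ?(ltW e20)// ler_pdivrMr ?ltr_wpDl// mul1r.
  by lra.
have := ler_normD (inner nu (del m) g - inner nu (del m) h) (inner nu (del m) h).
by rewrite subrK; lra.
Qed.

Lemma weak_null_add g h : L2 nu g -> L2 nu h -> null g -> null h -> null (fun y => g y + h y).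
Proof.
move=> g2 h2 ng nh; rewrite /null -(addr0 (0 : R)).
rewrite (_ : (fun m => _) = (fun m => inner nu (del m) g + inner nu (del m) h)); first exact: cvgD.
apply/funext => m; rewrite /inner -RintegralD//; try exact: L2M.
by apply: eq_Rintegral => y _; rewrite mulrDr.
Qed.

Lemma weak_null_scale a g : L2 nu g -> null g -> null (fun y => a * g y).
Proof.
move=> g2 ng; rewrite /null -(mulr0 a).
rewrite (_ : (fun m => _) = (fun m => a * inner nu (del m) g)); first by apply: cvgM => //; exact: cvg_cst.
apply/funext => m; rewrite /inner -RintegralZl//; last exact: L2M.
by apply: eq_Rintegral => y _; ring.
Qed.

(** Dominated convergence, with [g ^+ 2] as the dominating function. *)
Lemma quadratic_approx (g : T -> R) (h : nat -> T -> R) : L2 nu g ->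
  (forall N, measurable_fun [set: T] (h N)) -> (forall N y, 0 <= h N y <= g y) ->
  (forall y, (h ^~ y) @ \oo --> g y) ->
  forall e, 0 < e -> exists N, inner nu (fun y => g y - h N y) (fun y => g y - h N y) <= e ^+ 2.
Proof.
move=> g2 mh hb hc e e0; have mg : measurable_fun [set: T] g by case: g2.
have h2 N : L2 nu (h N).
  apply: (L2_le (mh N) _ g2) => y; have /andP[h0 hg] := hb N y.
  by rewrite !ger0_norm// (le_trans h0).
have ib N : inner nu (fun y => g y - h N y) (fun y => g y - h N y) = \int[nu]_y ((g y - h N y) ^+ 2).
  by apply: eq_Rintegral => y _; rewrite expr2.
have mgh N : measurable_fun [set: T] (EFin \o (fun y => (g y - h N y) ^+ 2)).
  by apply/measurable_EFinP; apply: measurable_funX; exact: measurable_funB.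
have [] := @dominated_convergence _ T R nu [set: T] measurableT
  (fun N => EFin \o (fun y => (g y - h N y) ^+ 2)) (cst 0%E) (EFin \o (fun y => g y ^+ 2)).
- exact: mgh.
- exact: measurable_cst.
- apply: aeW => y _; apply: cvg_EFin; first exact: nearW.
  have hd : (fun N => g y - h N y) @ \oo --> g y - g y by apply: cvgB; [exact: cvg_cst|exact: hc].
  have hm : (fun N => (g y - h N y) * (g y - h N y)) @ \oo --> (0 : R).
    by rewrite -[X in _ --> X](mulr0 (g y - g y)) -(subrr (g y)); exact: cvgM.
  apply: cvg_trans hm; apply: near_eq_cvg.
  by apply: nearW => N /=; rewrite expr2.
- exact: (L2_sqr_integrable g2).
- apply: aeW => y N _ /=; rewrite lee_fin ger0_norm ?sqr_ge0//.
  have /andP[h0 hg] := hb N y; rewrite lerXn2r ?nnegrE ?subr_ge0 ?(le_trans h0)//.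
  by rewrite lerBlDr lerDl.
move=> _ _ cvI; have e20 : 0 < e ^+ 2 by rewrite exprn_gt0.
move: cvI; rewrite integral0 => /fine_cvgP[_ /cvgrPdist_le/(_ _ e20)][N _ /(_ N (leqnn N))].
rewrite /comp/= sub0r normrN => hN; exists N; rewrite ib; apply: le_trans hN.
by rewrite ler_norm.
Qed.

Hypothesis del1 : forall m, \int[nu]_y del m y = 0.
Variable G : nat -> set T.
Hypothesis GI : setI_closed (range G).
Hypothesis Gm : @measurable _ T = <<s range G >>.
Hypothesis delG : forall i, null \1_(G i).

Let L2_indic (E : set T) : measurable E -> L2 nu \1_E.
Proof.
move=> mE; apply: (L2_le _ _ (L2_cst nu 1)) => [|y]; first exact: measurable_indic.
by rewrite indicE /= normr1; case: (_ \in _); rewrite ?normr1 ?normr0.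
Qed.

(** The pi-lambda theorem; the vanishing means give stability under complements. *)
Lemma weak_null_indic E : measurable E -> null \1_E.
Proof.
rewrite {1}Gm; move: E; apply: (dynkin_induction (G := range G)) => //.
- rewrite /null (_ : (fun m => _) = (fun _ => 0)); first exact: cvg_cst.
  apply/funext => m; rewrite -(del1 m); apply: eq_Rintegral => y _.
  by rewrite indicT mulr1.
- by move=> _ [i _ <-]; exact: delG.
- move=> E mE nE; rewrite /null (_ : (fun m => _) = (fun m => - inner nu (del m) \1_E)).
    by rewrite -oppr0; exact: cvgN.
  apply/funext => m; rewrite -[RHS]add0r -(del1 m) /inner.
  rewrite -RintegralB//; [|exact: L2_integrable|by apply: L2M => //; exact: L2_indic].
  apply: eq_Rintegral => y _; rewrite -[X in X - _]mulr1 -mulrBr; congr (_ * _).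
  rewrite !indicE; have [yE|yE] := pselect (E y).
    by rewrite memNset ?mem_set ?subrr//=; apply.
  by rewrite mem_set ?memNset ?subr0.
- move=> F mF tF nF; have mU : measurable (\bigcup_k F k) by exact: bigcup_measurable.
  apply: weak_null_closure; first exact: L2_indic.
  move=> e e0; pose h N := fun y : T => \sum_(i < N) \1_(F i) y : R.
  have hE k N y : F k y -> h N y = (k < N)%N%:R.
    move=> ky; rewrite /h (eq_bigr (fun i : 'I_N => (val i == k)%:R)) => [|i _]; last first.
      rewrite indicE; case: eqVneq => [->|ik]; first by rewrite mem_set.
      rewrite memNset// => iy; move/eqP: ik; apply.
      by apply: tF => //; exists y.
    have [kN|Nk] := ltnP k N.
      rewrite (bigD1 (Ordinal kN))//= eqxx big1 ?addr0// => i; rewrite -val_eqE/=.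
      by move=> /negbTE ->.
    by rewrite big1// => i _; case: eqVneq => // ik; move: (ltn_ord i); rewrite ik ltnNge Nk.
  have hE0 N y : (forall k, ~ F k y) -> h N y = 0.
    by move=> no; rewrite /h big1// => i _; rewrite indicE memNset.
  have mh N : measurable_fun [set: T] (h N).
    by apply: measurable_sum => i; exact: measurable_indic.
  have hb N y : 0 <= h N y <= \1_(\bigcup_k F k) y.
    have [[k ky]|no] := pselect (exists k, F k y).
      by rewrite (hE k)// indicE mem_set ?ler0n ?ler_nat ?leq_b1//; exists k.
    rewrite hE0 ?lexx ?indicE ?ler0n// => k ky; by apply: no; exists k.
  have hc y : h ^~ y @ \oo --> (\1_(\bigcup_k F k) y : R).
    have [[k ky]|no] := pselect (exists k, F k y).
      rewrite indicE mem_set; last by exists k.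
      apply: cvg_near_cst; exists k.+1 => // N /= kN.
      by rewrite (hE k)// kN.
    have no' k : ~ F k y by move=> ky; apply: no; exists k.
    rewrite indicE memNset; last by case=> k _; exact: no'.
    by rewrite (_ : h ^~ y = fun=> 0); [exact: cvg_cst|apply/funext => N; exact: hE0].
  have [N hN] := quadratic_approx (L2_indic mU) mh hb hc e0.
  have h2 M : L2 nu (h M).
    apply: (L2_le (mh M) _ (L2_indic mU)) => y; have /andP[h0 hg] := hb M y.
    by rewrite !ger0_norm// (le_trans h0).
  exists (h N); split => //; elim: (N) => [|M IH].
    rewrite (_ : h 0%N = fun y => 0 * h 0%N y).
      by rewrite /null (_ : (fun m => _) = fun=> 0); [exact: cvg_cst|
        apply/funext => m; rewrite /inner; under eq_Rintegral do rewrite mul0r mulr0;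
        rewrite /Rintegral integral0].
    by apply/funext => y; rewrite mul0r /h big_ord0.
  rewrite (_ : h M.+1 = fun y => h M y + \1_(F M) y); last first.
    by apply/funext => y; rewrite /h big_ord_recr.
  by apply: weak_null_add => //; exact: L2_indic.
Qed.

Let weak_null_ge0 g : L2 nu g -> (forall y, 0 <= g y) -> null g.
Proof.
move=> g2 g0; have mg : measurable_fun [set: T] g by case: g2.
have mge : measurable_fun [set: T] (EFin \o g) by exact/measurable_EFinP.
pose a := nnsfun_approx measurableT mge.
have a_cvg y : (a ^~ y) @ \oo --> g y.
  have := cvg_nnsfun_approx measurableT mge (fun y _ => g0 y) (I : [set: T] y).
  by move/fine_cvgP => [].
have and y : nondecreasing_seq (a ^~ y).
  by move=> m n mn; have /lefP := nd_nnsfun_approx measurableT mge mn; apply.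
have ab N y : 0 <= a N y <= g y.
  rewrite fun_ge0/= -(cvg_lim _ (a_cvg y))//.
  by apply: nondecreasing_cvgn_le => //; apply/cvg_ex; exists (g y).
have ma N : measurable_fun [set: T] (a N) by exact: measurable_funP.
apply: weak_null_closure => // e e0.
have [N hN] := quadratic_approx g2 ma ab a_cvg e0.
have a2 : L2 nu (a N).
  apply: (L2_le (ma N) _ g2) => y; have /andP[h0 hg] := ab N y.
  by rewrite !ger0_norm// (le_trans h0).
exists (a N); split=> //.
have [s sE] : exists s : seq R, (a N : T -> R) =
    fun y => \sum_(y0 <- s) y0 * \1_(a N @^-1` [set y0]) y.
  exists (finmap.enum_fset (fset_set (range (a N)))).
  by apply/funext => y; rewrite fimfunE fsbig_finite.
have mp y0 : measurable (a N @^-1` [set y0]) by exact: measurable_sfunP.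
suff : L2 nu (fun y => \sum_(y0 <- s) y0 * \1_(a N @^-1` [set y0]) y) /\
   null (fun y => \sum_(y0 <- s) y0 * \1_(a N @^-1` [set y0]) y) by rewrite -sE => -[].
elim: s {sE} => [|y0 s [IH2 IH]].
  have z : (fun y : T => \sum_(y0 <- [::]) y0 * \1_(a N @^-1` [set y0]) y) = cst (0 : R).
    by apply/funext => y; rewrite big_nil.
  rewrite z; split; first exact: L2_cst.
  rewrite /null (_ : (fun m => _) = fun=> 0); first exact: cvg_cst.
  apply/funext => m; rewrite /inner; under eq_Rintegral do rewrite mulr0.
  by rewrite /Rintegral integral0.
have z : (fun y : T => \sum_(y1 <- y0 :: s) y1 * \1_(a N @^-1` [set y1]) y) =
    fun y => y0 * \1_(a N @^-1` [set y0]) y + \sum_(y1 <- s) y1 * \1_(a N @^-1` [set y1]) y.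
  by apply/funext => y; rewrite big_cons.
have h2 : L2 nu (\1_(a N @^-1` [set y0]) : T -> R) by exact: L2_indic.
rewrite z; split; first by apply: L2D => //; exact: L2Z.
apply: weak_null_add => //; first exact: L2Z.
by apply: weak_null_scale => //; exact: weak_null_indic.
Qed.

Lemma weak_null_L2 g : L2 nu g -> null g.
Proof.
move=> g2; have mg : measurable_fun [set: T] g by case: g2.
pose p y := Num.max (g y) 0; pose q y := Num.max (- g y) 0.
have mp : measurable_fun [set: T] p by exact: measurable_maxr.
have mq : measurable_fun [set: T] q.
  by apply: measurable_maxr => //; exact: measurableT_comp.
have p2 : L2 nu p.
  apply: (L2_le mp _ g2) => y; rewrite /p maxEle; case: ifP => _; rewrite ?normr0//.
have q2 : L2 nu q.
  apply: (L2_le mq _ g2) => y; rewrite /q maxEle; case: ifP => _; rewrite ?normr0 ?normrN//.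
have -> : g = fun y => p y + (-1) * q y.
  apply/funext => y; rewrite /p /q mulN1r; case: (leP (g y) 0) => h.
    by rewrite max_l ?oppr_ge0// opprK add0r.
  by rewrite max_r ?subr0// oppr_le0 ltW.
apply: weak_null_add => //; first exact: L2Z.
  by apply: weak_null_ge0 => // y; rewrite le_max lexx orbT.
apply: weak_null_scale => //; apply: weak_null_ge0 => // y.
by rewrite le_max lexx orbT.
Qed.

End weak_convergence.


Section countable_density.
Context {R : realType}.

(** Rational approximations of finitely many coordinates are countable data, and one
    point is chosen for each of them. *)
Lemma countable_dense_coordinates (V : Type) (phi : V -> nat -> R) (A : V -> Prop) (v0 : V) :
  A v0 -> exists e : nat -> V, (forall n, A (e n)) /\
    forall v, A v -> exists s : nat -> nat, forall i,
      (fun m => phi (e (s m)) i) @ \oo --> phi v i.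
Proof.
move=> A0.
pose P (l : seq rat) v := A v /\ forall i, (i < size l)%N ->
  `|phi v i - ratr (nth 0 l i)| <= (size l)%:R^-1.
have : forall n : nat, exists v, A v /\
    forall l : seq rat, unpickle n = Some l -> (exists v', P l v') -> P l v.
  move=> n; case E : (unpickle n) => [l|]; last by exists v0.
  have [[v hv]|no] := pselect (exists v', P l v').
    by exists v; split; [case: hv|move=> _ [<-]].
  by exists v0; split => // _ [<-] h; case: no.
move/choice => [e he]; exists e; split=> [n|v Av]; first by case: (he n).
have rat_approx (x eps : R) : 0 < eps -> exists r : rat, `|x - ratr r| <= eps.
  move=> e0; have /rat_in_itvoo[r] : x - eps < x + eps by lra.
  rewrite in_itv/= => /andP[h1 h2]; exists r.
  by rewrite ler_norml; apply/andP; split; lra.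
have : forall m : nat, exists N : nat, forall i, (i < m.+1)%N ->
    `|phi v i - phi (e N) i| <= 2 * m.+1%:R^-1.
  move=> m; have m0 : 0 < m.+1%:R^-1 :> R by rewrite invr_gt0 ltr0n.
  have [r hr] := choice (fun i => rat_approx (phi v i) _ m0).
  pose l := [seq r i | i <- iota 0 m.+1].
  have sl : size l = m.+1 by rewrite size_map size_iota.
  have nl i : (i < m.+1)%N -> nth 0 l i = r i.
    by move=> im; rewrite (nth_map 0%N) ?size_iota// nth_iota.
  have Pv : P l v by split=> // i; rewrite sl => im; rewrite nl.
  exists (pickle l) => i im.
  have [_ /(_ l)] := he (pickle l); rewrite pickleK => /(_ erefl (ex_intro _ v Pv))[_ /(_ i)].
  rewrite sl => /(_ im); rewrite nl// => h2; have h1 := hr i.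
  rewrite (_ : phi v i - _ = (phi v i - ratr (r i)) - (phi (e (pickle l)) i - ratr (r i))); last by ring.
  apply: (le_trans (ler_normB _ _)).
  by rewrite mulr_natl mulr2n lerD.
move/choice => [s hs]; exists s => i; apply/cvgrPdist_le => eps e0.
have hc : (fun m => 2 * m.+1%:R^-1 : R) @ \oo --> (0 : R).
  by rewrite -(mulr0 2); apply: cvgM; [exact: cvg_cst|exact: cvg_harmonic].
move/cvgrPdist_le : hc => /(_ _ e0) hc.
near=> m; have im : (i < m.+1)%N by near: m; exists i => // m /= im; rewrite ltnS.
apply: (le_trans (hs m i im)).
have : `|0 - 2 * m.+1%:R^-1| <= eps by near: m; exact: hc.
by rewrite sub0r normrN ger0_norm// mulr_ge0.
Unshelve. all: by end_near. Qed.

End countable_density.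

Section dense_family.
Context {R : realType} d1 d2 (S : measurableType d1) (T : measurableType d2).
Variables (mu : probability S R) (nu : probability T R) (f : S * T -> R) (b c : R).
Hypothesis hf : density_family nu f b c.
Variable G : nat -> set T.
Hypothesis GI : setI_closed (range G).
Hypothesis Gm : @measurable _ T = <<s range G >>.
Hypothesis mG : forall i, measurable (G i).
Variable B : R.
Hypothesis B0 : 0 < B.

Lemma inner_one q : pdf nu q -> \int[nu]_y q y = 1.
Proof. by move=> [_ _ h]; rewrite /Rintegral h. Qed.

(** The masses of countably many sets and the entropy determine the limits of all the
    divergences: on a ball they give weak convergence. *)
Lemma dense_ball (q0 : T -> R) : ball nu B q0 -> exists e : nat -> T -> R,
  (forall n, ball nu B (e n)) /\
  forall q, ball nu B q -> exists s : nat -> nat, forall x,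
    (fun m => klr nu f (e (s m)) x) @ \oo --> klr nu f q x.
Proof.
move=> h0; pose phi q i := if i is j.+1 then inner nu q \1_(G j) else ent nu q.
have [e [he hd]] := countable_dense_coordinates phi h0.
exists e; split => // q hq; have [s hs] := hd q hq; exists s => x.
have [pq q2 qB] := hq.
pose del m y := e (s m) y - q y.
have e2 m : L2 nu (e m) by case: (he m).
have del2 m : L2 nu (del m) by exact: L2B.
have K0 : 0 <= 2 * B by rewrite mulr_ge0// ltW.
have delK m : inner nu (del m) (del m) <= (2 * B) ^+ 2.
  have [_ _ eB] := he (s m).
  have := inner_cauchy_schwarz (e2 (s m)) q2 (ltW B0) (ltW B0) eB qB.
  rewrite ler_norml => /andP[h _].
  rewrite innerBl// (innerC nu (e (s m))) (innerC nu q) !innerBl// (innerC nu q (e (s m))).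
  by rewrite exprMn; move: qB eB h; rewrite expr2; nra.
have i1 m : nu.-integrable [set: T] (EFin \o e m) by exact: L2_integrable.
have i2 : nu.-integrable [set: T] (EFin \o q) by exact: L2_integrable.
have del1 m : \int[nu]_y del m y = 0.
  rewrite RintegralB// !inner_one ?subrr//; by case: (he (s m)).
have mi i : L2 nu \1_(G i).
  apply: (L2_le _ _ (L2_cst nu 1)) => [|y]; first exact: measurable_indic.
  by rewrite indicE /= normr1; case: (_ \in _); rewrite ?normr1 ?normr0.
have delG i : (fun m => inner nu (del m) \1_(G i)) @ \oo --> (0 : R).
  rewrite (_ : (fun m => _) = (fun m => phi (e (s m)) i.+1 - phi q i.+1)); last first.
    by apply/funext => m; rewrite innerBl.
  by rewrite -(subrr (phi q i.+1)); apply: cvgB; [exact: hs|exact: cvg_cst].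
have := weak_null_L2 del2 K0 delK del1 GI Gm delG (L2_logdens hf x).
move=> hw; rewrite (_ : (fun m => _) = (fun m => phi (e (s m)) 0%N - inner nu (del m) (logdens f x) - inner nu q (logdens f x))); last first.
  apply/funext => m; rewrite /klr innerBl//=; last exact: (L2_logdens hf).
  by ring.
rewrite /klr -[ent nu q]/(phi q 0%N) -[X in X - _](subr0 (phi q 0%N)).
by apply: cvgB; [apply: cvgB => //; exact: hs|exact: cvg_cst].
Qed.

End dense_family.


Lemma cvg_minr {R : realType} (u v : nat -> R) (a b : R) : u @ \oo --> a -> v @ \oo --> b ->
  (fun m => Num.min (u m) (v m)) @ \oo --> Num.min a b.
Proof.
move=> ua vb; have mE (x y : R) : Num.min x y = (x + y - `|x - y|) / 2 by exact: minr_absE.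
rewrite mE (_ : (fun m => _) = fun m => (u m + v m - `|u m - v m|) / 2); last by apply/funext.
apply: cvgM; last exact: cvg_cst.
by apply: cvgB; [exact: cvgD|apply: cvg_norm; exact: cvgB].
Qed.

Section losses.
Context {R : realType} d1 d2 (S : measurableType d1) (T : measurableType d2).
Variables (mu : probability S R) (nu : probability T R) (f : S * T -> R) (b c B : R).
Hypothesis hf : density_family nu f b c.
Hypothesis B1 : 1 <= B.
Variable k : nat.

Definition balls (q : 'I_k.+1 -> T -> R) := forall j, ball nu B (q j).
Definition loss (q : 'I_k.+1 -> T -> R) (x : S) : R := vmin (fun j => klr nu f (q j) x).
Definition loss_bound : R := B * c + 2 * ln B.
Definition mean_loss (q : 'I_k.+1 -> T -> R) : R := \int[mu]_x loss q x.

Let B0 : 0 < B. Proof. exact: lt_le_trans B1. Qed.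
Let c0 : 0 <= c. Proof. by case: hf. Qed.
Let H0 : 0 <= 2 * ln B. Proof. by rewrite mulr_ge0// ln_ge0. Qed.

Lemma loss_bound_ge0 : 0 <= loss_bound.
Proof. by rewrite addr_ge0// mulr_ge0// ltW. Qed.

Lemma loss_bounds q x : balls q -> 0 <= loss q x <= loss_bound.
Proof.
move=> hq; rewrite /loss; have [j ->] := vmin_ex (fun j => klr nu f (q j) x).
have [pq q2 qB] := hq j.
by rewrite (klr_ge0 hf)//= (klr_le hf).
Qed.

Lemma measurable_loss q : balls q -> measurable_fun [set: S] (loss q).
Proof.
move=> hq; apply: (@measurable_vmin _ S R k (fun j => klr nu f (q j))) => j.
by have [pq q2 _] := hq j; exact: (measurable_klr hf).
Qed.

Lemma loss_integrable q : balls q -> mu.-integrable [set: S] (EFin \o loss q).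
Proof.
move=> hq; apply: (@prob_bounded_integrable _ _ _ _ _ loss_bound); first exact: measurable_loss.
by move=> x; have /andP[h0 h1] := loss_bounds x hq; rewrite ger0_norm.
Qed.

Lemma mean_loss_bounds q : balls q -> 0 <= mean_loss q <= loss_bound.
Proof.
move=> hq; apply/andP; split.
  by apply: Rintegral_ge0 => x _; case/andP: (loss_bounds x hq).
have ic := finite_measure_integrable_cst mu loss_bound measurableT.
apply: (@le_trans _ _ (\int[mu]_x loss_bound)).
  apply: le_Rintegral => //; first exact: loss_integrable.
  by move=> x _; case/andP: (loss_bounds x hq).
rewrite /Rintegral (_ : (\int[mu]_x loss_bound%:E)%E = (loss_bound%:E * mu setT)%E); last by rewrite integral_cst.
by rewrite (_ : mu setT = 1%E) ?mule1//; exact: probability_setT.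
Qed.

Let V := {u : T -> R | L2 nu u}.
Let form (u v : V) : R := inner nu (sval u) (sval v).
Let toV q (h : L2 nu q) : V := exist _ q h.

(** Rademacher complexity of the losses: each divergence is affine in the center, with
    linear part in the Hilbert space of square-integrable functions. *)
Lemma rademacher_loss n (A : Type) (q : A -> 'I_k.+1 -> T -> R)
    (x x' : 'I_n -> S) (alpha : {ffun 'I_n -> bool} -> A) :
  (1 <= k)%N -> (2 * k.+1 <= n)%N -> rate R n k.+1 < 1 -> (forall a, balls (q a)) ->
  Ex (@rad R 'I_n) (fun e => \sum_i sg (e i) * (loss (q (alpha e)) (x' i) - loss (q (alpha e)) (x i)))
    <= n%:R * rate R n k.+1 * loss_bound.
Proof.
move=> k1 kn r1 hq.
have q2 a j : L2 nu (q a j) by case: (hq a j).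
pose Q a j : V := toV (q2 a j).
pose u i : V := toV (L2_logdens hf (x i)); pose u' i : V := toV (L2_logdens hf (x' i)).
set E := Ex _ _.
have key eta : 0 < eta -> E <= n%:R * rate R n k.+1 * (B * (c + eta) + (2 * ln B + eta)).
  move=> eta0.
  have ce : c <= c + eta by rewrite lerDl ltW.
  have ce0 : 0 <= c + eta by exact: le_trans ce.
  apply: (@rademacher_min_affine R V form _ _ k n A Q (fun a j => ent nu (q a j)) u u') => //.
  - by move=> v w; exact: innerC.
  - by move=> J v; apply: inner_psd => i; exact: (svalP (v i)).
  - by rewrite ltr_wpDl.
  - by rewrite ltr_wpDl.
  - by move=> a j; case: (hq a j).
  - move=> a j; have [pq qq qB] := hq a j.
    by rewrite ger0_norm ?ent_ge0//; have := ent_le B0 pq qq qB; lra.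
  - move=> i; apply: (le_trans (inner_logdens hf (x i))).
    by rewrite lerXn2r ?nnegrE.
  - move=> i; apply: (le_trans (inner_logdens hf (x' i))).
    by rewrite lerXn2r ?nnegrE.
(* c and ln B may vanish: they are enlarged, and the enlargement removed in the limit *)
apply/ler_addgt0Pr => eps eps0.
pose K := `|n%:R * rate R n k.+1| * (B + 1) + 1.
have K0 : 0 < K by rewrite ltr_wpDl// mulr_ge0// addr_ge0// ltW.
have := key (eps / K) (divr_gt0 eps0 K0).
have h1 : n%:R * rate R n k.+1 * ((B + 1) * (eps / K)) <= eps.
  apply: (@le_trans _ _ (`|n%:R * rate R n k.+1| * ((B + 1) * (eps / K)))).
    apply: ler_wpM2r; last exact: ler_norm.
    by rewrite mulr_ge0 ?addr_ge0 ?divr_ge0 ?ltW.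
  rewrite (_ : `|n%:R * rate R n k.+1| * ((B + 1) * (eps / K)) = eps * ((K - 1) / K)).
    by rewrite ler_piMr ?(ltW eps0)// ler_pdivrMr// mul1r gerBl.
  have -> : K - 1 = `|n%:R * rate R n k.+1| * (B + 1) by rewrite /K addrK.
  by ring.
rewrite /loss_bound; move: h1; set r := n%:R * _; set t := eps / K.
by move=> h1 h2; apply: (le_trans h2); rewrite (_ : r * _ = r * (B * c + 2 * ln B) + r * ((B + 1) * t)) ?lerD2l//; ring.
Qed.

Variable G : nat -> set T.
Hypothesis GI : setI_closed (range G).
Hypothesis Gm : @measurable _ T = <<s range G >>.
Hypothesis mG : forall i, measurable (G i).

(** Losses converge pointwise along the dense family, and so do their means since they
    are bounded. *)
Lemma countable_centers q0 : ball nu B q0 -> exists Q : nat -> 'I_k.+1 -> T -> R,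
  (forall a, balls (Q a)) /\
  forall n (x : 'I_n -> S) K, (forall a, mean_loss (Q a) - (\sum_i loss (Q a) (x i)) / n%:R <= K) ->
    forall q, balls q -> mean_loss q - (\sum_i loss q (x i)) / n%:R <= K.
Proof.
move=> h0; have [e [he hd]] := dense_ball hf GI Gm mG B0 h0.
pose dec a : {ffun 'I_k.+1 -> nat} := odflt [ffun=> 0%N] (unpickle a).
pose Q a j := e (dec a j); exists Q; have hQ a : balls (Q a) by move=> j; exact: he.
split=> // n x K hK q hq.
have [s hs] := choice (fun j => hd (q j) (hq j)).
pose al m := pickle [ffun j => s j m].
have QE m j : Q (al m) j = e (s j m) by rewrite /Q /dec /al pickleK/= ffunE.
have lc y : (fun m => loss (Q (al m)) y) @ \oo --> loss q y.
  rewrite /loss /vmin.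
  have -> : (fun m => \big[Num.min/klr nu f (Q (al m) ord0) y]_(j < k.+1) klr nu f (Q (al m) j) y) =
     (fun m => \big[Num.min/klr nu f (e (s ord0 m)) y]_(j < k.+1) klr nu f (e (s j m)) y).
    by apply/funext => m; rewrite QE; under eq_bigr do rewrite QE.
  elim: (index_enum _) => [|j l IH].
    by under eq_fun do rewrite big_nil; rewrite big_nil; exact: hs.
  under eq_fun do rewrite big_cons; rewrite big_cons.
  by apply: cvg_minr => //; exact: hs.
have mc : (fun m => mean_loss (Q (al m))) @ \oo --> mean_loss q.
  have [] := @dominated_convergence _ S R mu [set: S] measurableT
    (fun m => EFin \o loss (Q (al m))) (EFin \o loss q) (EFin \o cst loss_bound).
  - by move=> m; apply/measurable_EFinP; exact: measurable_loss.
  - by apply/measurable_EFinP; exact: measurable_loss.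
  - by apply: aeW => y _; apply: cvg_EFin; [exact: nearW|exact: lc].
  - exact: finite_measure_integrable_cst.
  - apply: aeW => y m _ /=; have /andP[h1 h2] := loss_bounds y (hQ (al m)).
    by rewrite lee_fin ger0_norm.
  move=> iq _; rewrite -(fineK (integrable_fin_num measurableT iq)).
  by move/fine_cvgP => [].
have ec : (fun m => mean_loss (Q (al m)) - (\sum_i loss (Q (al m)) (x i)) / n%:R) @ \oo -->
    mean_loss q - (\sum_i loss q (x i)) / n%:R.
  apply: cvgB => //; apply: cvgM; last exact: cvg_cst.
  elim: (index_enum _) => [|i l IH].
    by under eq_fun do rewrite big_nil; rewrite big_nil; exact: cvg_cst.
  under eq_fun do rewrite big_cons; rewrite big_cons.
  by apply: cvgD => //; exact: lc.
rewrite -(cvg_lim _ ec)//; apply: limr_le; first exact: cvgP ec.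
by apply: nearW => m; exact: hK.
Qed.
End losses.


(** * Excess risk *)


Lemma excess_of_deviation {R : realType} (m s m' s' K e : R) :
  m - s <= K + m' - s' -> s <= s' + e -> m <= m' + K + e.
Proof. by lra. Qed.

Section learning.
Context {R : realType} d d1 d2 (Om : measurableType d) (S : measurableType d1)
  (T : measurableType d2) (P : probability Om R) (X : {RV P >-> S}) (n : nat)
  (Xs : 'I_n -> {RV P >-> S}).
Hypothesis iid : independent_copies X Xs.
Local Notation mu := (distribution P X).
Variables (nu : probability T R) (f : S * T -> R) (b c B : R).
Hypothesis hf : density_family nu f b c.
Hypothesis B1 : 1 <= B.
Variable k : nat.
Hypothesis k1 : (1 <= k)%N.
Hypothesis kn : (2 * k.+1 <= n)%N.
Variable G : nat -> set T.
Hypothesis GI : setI_closed (range G).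
Hypothesis Gm : @measurable _ T = <<s range G >>.
Hypothesis mG : forall i, measurable (G i).

Local Notation M := (loss_bound c B).
Local Notation r := (rate R n k.+1).

Definition sample_loss (om : Om) (q : 'I_k.+1 -> T -> R) : R :=
  (\sum_i loss nu f q (Xs i om)) / n%:R.

Let n0 : (0 < n)%N. Proof. by apply: leq_trans kn; rewrite muln_gt0. Qed.
Let N0 : 0 < n%:R :> R. Proof. by rewrite ltr0n. Qed.
Let M0 : 0 <= M. Proof. exact: (loss_bound_ge0 hf B1). Qed.

Lemma sample_loss_ge0 om q : balls nu B q -> 0 <= sample_loss om q.
Proof.
move=> hq; rewrite divr_ge0 ?sumr_ge0 ?ler0n// => i _.
by have /andP[] := loss_bounds hf B1 (Xs i om) hq.
Qed.

Let bounded (q : 'I_k.+1 -> T -> R) : balls nu B q -> forall x, 0 <= loss nu f q x <= M.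
Proof. by move=> hq x; exact: (loss_bounds hf B1). Qed.

Let measurable_l (q : 'I_k.+1 -> T -> R) : balls nu B q -> measurable_fun [set: S] (loss nu f q).
Proof. by move=> hq; exact: (measurable_loss hf hq). Qed.

Let rho_n : n%:R * r * M / n%:R = r * M.
Proof. by field; rewrite gt_eqF. Qed.

Let ln_inv_ge0 (delta : R) : 0 < delta < 1 -> 0 <= ln delta^-1.
Proof. by move=> /andP[d0 d1']; rewrite ln_ge0// invf_ge1// ltW. Qed.

(** A rate of at least 1, or a vanishing range of the losses, makes the bound trivial. *)
Lemma risk_tail (delta : R) (q0 : T -> R) : 0 < delta < 1 -> ball nu B q0 ->
  exists E, [/\ measurable E, ((1 - delta)%:E <= P E)%E &
    forall om, E om -> forall q, balls nu B q ->
      mean_loss mu nu f q - sample_loss om q <=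
      (r + Num.sqrt (ln delta^-1 / (2 * n%:R))) * M].
Proof.
move=> hd h0; have /andP[d0 d1'] := hd; have l0 := ln_inv_ge0 hd.
have P1 : P setT = 1%E by exact: probability_setT.
have [triv|] := boolP ((M == 0) || (1 <= r)).
  exists setT; split=> // [|om _ q hq].
    by rewrite P1 lee_fin lerBlDr lerDl ltW.
  have /andP[_ h1] := mean_loss_bounds mu hf B1 hq; have h2 := sample_loss_ge0 om hq.
  apply: (@le_trans _ _ M); first by rewrite lerBlDr (le_trans h1)// lerDl.
  have s0 := sqrtr_ge0 (ln delta^-1 / (2 * n%:R)).
  case/orP : triv => [/eqP ->|r1]; first by rewrite mulr0.
  by rewrite ler_peMl// (le_trans r1)// lerDl.
rewrite negb_or -ltNge => /andP[Mn0 r1].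
have Mp : 0 < M by rewrite lt_def Mn0.
have [Q [hQ close]] := countable_centers mu hf B1 k GI Gm mG h0.
pose t := Num.sqrt (ln delta^-1 / (2 * n%:R)) * M.
have t0 : 0 <= t by rewrite mulr_ge0 ?sqrtr_ge0.
have Frho x x' (alpha : {ffun 'I_n -> bool} -> nat) :=
  rademacher_loss hf B1 (q := Q) x x' alpha k1 kn r1 hQ.
have g00 (x : S) : 0 <= (cst 0 : S -> R) x <= 0 by rewrite /= lexx.
have MM : 0 < M + 0 by rewrite addr0.
have [E [mE PE hE]] := uniform_tail iid n0 (fun a => measurable_l (hQ a))
  (measurable_cst (0 : R)) (fun a => bounded (hQ a)) g00 Frho MM t0.
exists E; split => //.
  apply: le_trans PE; rewrite lee_fin lerB// addr0 /t exprMn sqr_sqrtr; last first.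
    by rewrite divr_ge0// mulr_ge0// ltW.
  rewrite (_ : 2 * n%:R * _ / _ = ln delta^-1).
    by rewrite lnV ?posrE// opprK lnK ?posrE.
  by field; rewrite !gt_eqF.
move=> om Eom; rewrite mulrDl -/t; apply: close => a.
have := hE om a Eom; rewrite /point_deviation rho_n.
rewrite big1_eq mul0r (_ : \int[mu]_x cst 0 x = 0) ?subrr ?addr0//.
by rewrite /Rintegral integral0.
Qed.

(** Comparing with a fixed competitor inside the deviation keeps its fluctuations out of
    the bound on expectations. *)
Lemma excess_tail (delta : R) (qs : 'I_k.+1 -> T -> R) : 0 < delta < 1 -> balls nu B qs ->
  exists E, [/\ measurable E, ((1 - delta)%:E <= P E)%E &
    forall om, E om -> forall q, balls nu B q -> forall eps, 0 <= eps ->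
      sample_loss om q <= sample_loss om qs + eps ->
      mean_loss mu nu f q <= mean_loss mu nu f qs +
        (r + Num.sqrt (2 * ln delta^-1 / n%:R)) * M + eps].
Proof.
move=> hd hqs; have /andP[d0 d1'] := hd; have l0 := ln_inv_ge0 hd.
have P1 : P setT = 1%E by exact: probability_setT.
have [triv|] := boolP ((M == 0) || (1 <= r)).
  exists setT; split=> // [|om _ q hq eps e0 _].
    by rewrite P1 lee_fin lerBlDr lerDl ltW.
  have /andP[_ h1] := mean_loss_bounds mu hf B1 hq.
  have /andP[h2 _] := mean_loss_bounds mu hf B1 hqs.
  apply: (le_trans h1); rewrite -addrA -[leLHS]add0r lerD// -[leLHS]addr0 lerD//.
  case/orP : triv => [/eqP ->|r1]; first by rewrite mulr0.
  by rewrite ler_peMl// (le_trans r1)// lerDl sqrtr_ge0.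
rewrite negb_or -ltNge => /andP[Mn0 r1].
have Mp : 0 < M by rewrite lt_def Mn0.
have [Q [hQ close]] := countable_centers mu hf B1 k GI Gm mG (hqs ord0).
pose t := Num.sqrt (2 * ln delta^-1 / n%:R) * M.
have t0 : 0 <= t by rewrite mulr_ge0 ?sqrtr_ge0.
have Frho x x' (alpha : {ffun 'I_n -> bool} -> nat) :=
  rademacher_loss hf B1 (q := Q) x x' alpha k1 kn r1 hQ.
have MM : 0 < M + M by rewrite addr_gt0.
have [E [mE PE hE]] := uniform_tail iid n0 (fun a => measurable_l (hQ a))
  (measurable_l hqs) (fun a => bounded (hQ a)) (bounded hqs) Frho MM t0.
exists E; split => //.
  apply: le_trans PE; rewrite lee_fin lerB// /t exprMn sqr_sqrtr; last first.
    by rewrite divr_ge0// ?mulr_ge0// ltW.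
  rewrite (_ : 2 * n%:R * _ / _ = ln delta^-1).
    by rewrite lnV ?posrE// opprK lnK ?posrE.
  by field; rewrite ?(gt_eqF MM) ?(gt_eqF N0) ?(gt_eqF Mp).
move=> om Eom q hq eps e0 hs; rewrite mulrDl -/t; apply: excess_of_deviation hs.
rewrite -addrA; apply: (close _ _ _ _ q hq) => a; have := hE om a Eom; rewrite /point_deviation rho_n.
by rewrite -[\int[mu]_x loss nu f qs x]/(mean_loss mu nu f qs) -lerBrDr opprB.
Qed.

Lemma excess_mean (qs : 'I_k.+1 -> T -> R) : balls nu B qs ->
  exists Z : Om -> R, [/\ measurable_fun [set: Om] Z, exists K, forall om, `|Z om| <= K,
    \int[P]_om Z om <= r * M &
    forall om q, balls nu B q -> forall eps, 0 <= eps ->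
      sample_loss om q <= sample_loss om qs + eps ->
      mean_loss mu nu f q <= mean_loss mu nu f qs + Z om + eps].
Proof.
move=> hqs; have P1 : P setT = 1%E by exact: probability_setT.
have [triv|] := boolP ((M == 0) || (1 <= r)).
  exists (cst M); split=> //; first by exists M => om; rewrite ger0_norm.
    have -> : \int[P]_om (cst M) om = M.
      have e : (\int[P]_om (cst M om)%:E)%E = (M%:E * P setT)%E.
        exact: (integral_cst P measurableT M%:E).
      by rewrite /Rintegral e P1 mule1.
    by case/orP : triv => [/eqP ->|r1]; rewrite ?mulr0// ler_peMl.
  move=> om q hq eps e0 _.
  have /andP[_ h1] := mean_loss_bounds mu hf B1 hq.
  have /andP[h2 _] := mean_loss_bounds mu hf B1 hqs.
  by apply: (le_trans h1); rewrite -addrA -[leLHS]add0r lerD// -[leLHS]addr0 lerD.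
rewrite negb_or -ltNge => /andP[Mn0 r1].
have [Q [hQ close]] := countable_centers mu hf B1 k GI Gm mG (hqs ord0).
have Frho x x' (alpha : {ffun 'I_n -> bool} -> nat) :=
  rademacher_loss hf B1 (q := Q) x x' alpha k1 kn r1 hQ.
have [Z [mZ ZK ZI hZ]] := expected_supremum iid n0 (fun a => measurable_l (hQ a))
  (measurable_l hqs) (fun a => bounded (hQ a)) (bounded hqs) Frho.
exists Z; split => //; [by exists (M + M)|by rewrite -rho_n|].
move=> om q hq eps e0 hs; apply: excess_of_deviation hs.
rewrite -addrA; apply: (close _ _ _ _ q hq) => a; have := hZ om a; rewrite /point_deviation.
by rewrite -[\int[mu]_x loss nu f qs x]/(mean_loss mu nu f qs) -lerBrDr opprB.
Qed.

End learning.


Local Open Scope ereal_scope.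

Lemma big_mine_vmin {R : realType} k (F : 'I_k.+1 -> R) :
  \big[mine/+oo]_(j < k.+1) (F j)%:E = (vmin F)%:E.
Proof.
apply/eqP; rewrite eq_le; apply/andP; split.
  by have [j ->] := vmin_ex F; exact: bigmin_le.
by apply: le_bigmin => [|j _]; [exact: leey|rewrite lee_fin vmin_le].
Qed.

Lemma L2_Lfun {R : realType} d (T : measurableType d) (nu : probability T R) (u : T -> R) :
  L2 nu u -> u \in Lfun nu 2%:E.
Proof.
move=> [mu0 uy]; rewrite inE; apply/andP; split; rewrite inE//=.
rewrite /finite_norm unlock /=; apply: poweR_lty.
apply: le_lt_trans uy; rewrite le_eqVlt; apply/orP; left; apply/eqP.
apply: eq_integral => y _.
by rewrite ?poweR_EFin powR_mulrn// real_normK ?num_real.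
Qed.

Section version.
Context {R : realType} d1 d2 (S : measurableType d1) (T : measurableType d2).
Variables (mu : probability S R) (nu : probability T R) (p : S -> T -> R).
Variables (f : S * T -> R) (b c : R) (S0 : set S).
Hypothesis hf : density_family nu f b c.
Hypothesis mS0 : measurable S0.
Hypothesis S01 : mu S0 = 1.
Hypothesis hS0 : forall x, S0 x ->
  measurable_fun [set: T] (p x) /\ {ae nu, forall y, p x y = f (x, y)}.

Lemma ae_of_full (Q : S -> Prop) : (forall x, S0 x -> Q x) -> {ae mu, forall x, Q x}.
Proof.
move=> hQ; exists (~` S0); split; first exact: measurableC.
  have -> : mu (~` S0) = 1 - mu S0 by exact: (probability_setC mu mS0).
  by rewrite S01 subee.
by move=> x nq xS; apply: nq; exact: hQ.
Qed.

Lemma KL_version q q' x : S0 x -> pdf nu q' -> {ae nu, forall y, q y = q' y} ->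
  KL nu q (p x) = kl nu q' (dens f x).
Proof.
move=> xS hq' qq'; have [_ pf] := hS0 xS.
rewrite (KL_ae_eq (p' := dens f x) qq' pf); apply: KL_kl => //; first exact: (pdf_dens hf).
exact: (dens_gt0 hf).
Qed.

Lemma risk_version k (q q' : 'I_k -> T -> R) : (forall j, pdf nu (q' j)) ->
  (forall j, {ae nu, forall y, q j y = q' j y}) ->
  risk mu nu p q = \int[mu]_x \big[mine/+oo]_j kl nu (q' j) (dens f x).
Proof.
move=> hq' qq'; apply: ae_eq_lower_integral; apply: ae_of_full => x xS.
by rewrite /min_KL; apply: eq_bigr => j _; exact: KL_version.
Qed.

Variable B : R.
Hypothesis B1 : (1 <= B)%R.

Lemma min_kl_loss k (q : 'I_k.+1 -> T -> R) x : balls nu B q ->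
  \big[mine/+oo]_j kl nu (q j) (dens f x) = (loss nu f q x)%:E.
Proof.
move=> hq; rewrite -big_mine_vmin; apply: eq_bigr => j _.
by have [pq q2 _] := hq j; exact: (kl_klr hf).
Qed.

Lemma mean_lossE k (q : 'I_k.+1 -> T -> R) : balls nu B q ->
  \int[mu]_x \big[mine/+oo]_j kl nu (q j) (dens f x) = (mean_loss mu nu f q)%:E.
Proof.
move=> hq; under eq_integral do rewrite (min_kl_loss _ hq).
by rewrite /mean_loss /Rintegral fineK//; apply: integrable_fin_num => //;
  exact: (loss_integrable mu hf B1).
Qed.

Lemma empirical_version k n (xs : 'I_n -> S) (q q' : 'I_k.+1 -> T -> R) :
  (forall i, S0 (xs i)) -> balls nu B q' ->
  (forall j, {ae nu, forall y, q j y = q' j y}) ->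
  empirical_risk nu p xs q = ((\sum_i loss nu f q' (xs i)) / n%:R)%:E.
Proof.
move=> xS hq' qq'; rewrite /empirical_risk mulrC EFinM -sumEFin; congr (_ * _).
apply: eq_bigr => i _; rewrite -(min_kl_loss _ hq') /min_KL; apply: eq_bigr => j _.
by apply: KL_version => //; case: (hq' j).
Qed.

Lemma ball_ballQ q : constB mu nu p = B%:E -> ball nu B q -> ballQ mu nu p q.
Proof.
move=> BE [pq q2 qB]; split; first exact: pdf_densities.
  exact: L2_Lfun.
by rewrite BE L2_sqrE// -EFin_expe lee_fin.
Qed.

Lemma ballQ_ball q : constB mu nu p = B%:E -> ballQ mu nu p q ->
  exists q', ball nu B q' /\ {ae nu, forall y, q y = q' y}.
Proof.
move=> BE [dq _ qB]; have [q' [pq' qq']] := densities_pdf dq.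
exists q'; split => //.
have e : \int[nu]_y (q' y ^+ 2)%:E <= (B ^+ 2)%:E.
  rewrite -(ae_eq_lower_integral (f := fun y => (q y ^+ 2)%:E)).
    by apply: (le_trans qB); rewrite BE -EFin_expe.
  by apply: filterS qq' => y ->.
have q2 : L2 nu q' by split; [case: pq'|exact: (le_lt_trans e (ltry _))].
by split => //; rewrite -lee_fin -L2_sqrE.
Qed.

(** The uniform density is at divergence at most [c] from the whole family. *)
Lemma radius_finite : exists r : R, [/\ (0 <= r)%R, Defs.radius mu nu p = r%:E &
  forall rho, (r < rho)%R -> exists q, pdf nu q /\
    {ae mu, forall x, kl nu q (dens f x) <= rho%:E}].
Proof.
have mu1 : 0 < mu [set: S] by rewrite probability_setT.
have r0 : 0 <= Defs.radius mu nu p.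
  apply: le_ereal_inf_tmp => _ [q dq <-]; have [q' [pq' qq']] := densities_pdf dq.
  apply: ess_sup_gee => //; apply: ae_of_full => x xS.
  by rewrite (KL_version xS pq' qq') kl_ge0// => y; exact: (dens_gt0 hf).
have rc : Defs.radius mu nu p <= c%:E.
  apply: ge_ereal_inf; exists (ess_sup mu (fun x => KL nu (cst 1%R) (p x))).
    by exists (cst 1%R) => //; apply: pdf_densities; exact: pdf_one.
  apply/ess_supP; apply: ae_of_full => x xS.
  rewrite (KL_version xS (pdf_one nu))//; last exact: aeW.
  rewrite (kl_klr hf x (pdf_one nu) (L2_cst nu 1)) lee_fin; exact: (klr_one_le hf).
have rfin : Defs.radius mu nu p \is a fin_num.
  by rewrite ge0_fin_numE// (le_lt_trans rc) ?ltry.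
exists (fine (Defs.radius mu nu p)); rewrite fineK// fine_ge0//; split => // rho.
rewrite -lte_fin fineK// => /ereal_inf_lt[_ [q dq <-] qr].
have [q' [pq' qq']] := densities_pdf dq; exists q'; split => //.
have := ess_sup_ge mu (fun x => KL nu q (p x)).
have aeS : {ae mu, forall x, S0 x} by exact: ae_of_full.
apply: filterS2 aeS => x xS h.
by rewrite -(KL_version xS pq' qq'); apply: (le_trans h); exact: ltW.
Qed.

End version.

Local Close Scope ereal_scope.


Local Open Scope ereal_scope.

Section events.
Context {R : realType} d (Om : measurableType d) (P : probability Om R).

Lemma full_setI (E F : set Om) : measurable E -> measurable F -> P F = 1 -> P (E `&` F) = P E.
Proof.
move=> mE mF F1; have F0 : P (~` F) = 0.
  have -> : P (~` F) = 1 - P F by exact: (probability_setC P mF).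
  by rewrite F1 subee.
rewrite (measureDI P mE mF) [X in _ = X + _](_ : _ = 0) ?add0e//.
apply: (subset_measure0 _ _ _ F0); [exact: measurableD|exact: measurableC|].
by move=> x [].
Qed.

(** The event that infinitely many of the [E i] occur, by continuity along decreasing
    unions. *)
Lemma limsup_event (E : nat -> set Om) (a : \bar R) : (forall i, measurable (E i)) ->
  (forall i, a <= P (E i)) -> exists F, [/\ measurable F, a <= P F &
    forall om, F om -> forall N, exists2 m, (N <= m)%N & E m om].
Proof.
move=> mE aE; pose U N := \bigcup_(m in [set m | (N <= m)%N]) E m.
have mU N : measurable (U N) by exact: bigcup_measurable.
have mI : measurable (\bigcap_N U N) by exact: bigcapT_measurable.
exists (\bigcap_N U N); split => //.
  have ni : nonincreasing_seq U.
    by move=> N N' NN'; apply/subsetPset => om [m /= Nm Em]; exists m => //=; exact: leq_trans Nm.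
  have U0 : P (U 0%N) < +oo by rewrite ltey_eq fin_num_measure.
  have h := nonincreasing_cvg_mu U0 mU mI ni.
  rewrite -(cvg_lim _ h)//; apply: lime_ge; first exact: cvgP h.
  apply: nearW => N /=; apply: (le_trans (aE N)).
  by apply: le_measure; rewrite ?inE// => om Em; exists N => /=.
by move=> om FE N; have [m /= Nm Em] := FE N I; exists m.
Qed.

End events.

Section assembly.
Context {R : realType} d d1 d2 (Om : measurableType d) (S : measurableType d1)
  (T : measurableType d2) (P : probability Om R) (X : {RV P >-> S}) (n : nat)
  (Xs : 'I_n -> {RV P >-> S}).
Hypothesis iid : independent_copies X Xs.
Local Notation mu := (distribution P X).
Variables (nu : probability T R) (p : S -> T -> R) (f : S * T -> R) (b c r : R).
Variable S0 : set S.
Hypothesis hf : density_family nu f b c.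
Hypothesis mS0 : measurable S0.
Hypothesis S01 : mu S0 = 1.
Hypothesis hS0 : forall x, S0 x ->
  measurable_fun [set: T] (p x) /\ {ae nu, forall y, p x y = f (x, y)}.
Hypothesis hr : forall rho, (r < rho)%R -> exists q, pdf nu q /\
  {ae mu, forall x, kl nu q (dens f x) <= rho%:E}.
Local Notation B := (b * expR r)%R.
Hypothesis B1 : (1 <= B)%R.
Hypothesis BE : constB mu nu p = B%:E.
Variable k : nat.
Hypothesis k1 : (1 <= k)%N.
Hypothesis kn : (2 * k.+1 <= n)%N.
Variable G : nat -> set T.
Hypothesis GI : setI_closed (range G).
Hypothesis Gm : @measurable _ T = <<s range G >>.
Hypothesis mG : forall i, measurable (G i).

Local Notation M := (loss_bound c B).
Local Notation best := (ereal_inf [set risk mu nu p q | q in powset (k:=k.+1) (densities nu)]).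
Local Notation sample om := (fun i => Xs i om).

Lemma good_sample : {ae P, forall om, forall i, S0 (Xs i om)}.
Proof.
apply: filter_forall => i.
have mp : measurable (Xs i @^-1` (~` S0)).
  rewrite -[X in measurable X]setTI; apply: measurable_funPT => //; exact: measurableC.
exists (Xs i @^-1` (~` S0)); split => //.
have := iid.2 i (~` S0) (measurableC mS0).
rewrite /distribution/pushforward => ->.
have : mu (~` S0) = 1 - mu S0 by exact: (probability_setC mu mS0).
by rewrite S01 subee.
Qed.

Lemma ballQ_balls (q : 'I_k.+1 -> T -> R) : powset (ballQ mu nu p) q ->
  exists q', balls nu B q' /\ forall j, {ae nu, forall y, q j y = q' j y}.
Proof.
move=> hq; have [q' hq'] := choice (fun j => ballQ_ball BE (hq j)).
by exists q'; split => j; case: (hq' j).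
Qed.

Lemma risk_balls (q q' : 'I_k.+1 -> T -> R) : balls nu B q' ->
  (forall j, {ae nu, forall y, q j y = q' j y}) ->
  risk mu nu p q = (mean_loss mu nu f q')%:E.
Proof.
move=> hq' qq'; rewrite (risk_version hf mS0 S01 hS0 (q' := q'))//.
  exact: (mean_lossE mu hf B1).
by move=> j; case: (hq' j).
Qed.

(** Centroids improve on any densities and belong to the ball. *)
Lemma near_best (eta : R) : (0 < eta)%R -> exists qs : 'I_k.+1 -> T -> R,
  balls nu B qs /\ (mean_loss mu nu f qs)%:E <= best + eta%:E.
Proof.
move=> eta0.
have best0 : 0 <= best.
  apply: le_ereal_inf_tmp => _ [q dq <-].
  have [q' hq'] := choice (fun j => densities_pdf (dq j)).
  have pq' j : pdf nu (q' j) by case: (hq' j).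
  rewrite (risk_version hf mS0 S01 hS0 (q' := q'))//; last by move=> j; case: (hq' j).
  apply: integral_ge0 => x _; apply: le_bigmin => [|j _]; first exact: leey.
  by apply: kl_ge0 => // y; exact: (dens_gt0 hf).
have [q0 h0] := ball_ex hf hr.
have hb : balls nu B (fun _ : 'I_k.+1 => q0) by move=> j.
have bfin : best \is a fin_num.
  rewrite ge0_fin_numE//; apply: (@le_lt_trans _ _ (mean_loss mu nu f (fun _ : 'I_k.+1 => q0))%:E).
    apply: ereal_inf_lbound; exists (fun=> q0).
      by move=> j; apply: pdf_densities; case: h0.
    by apply: risk_balls => // j; exact: aeW.
  by rewrite ltry.
have : best < best + eta%:E by rewrite lteDl// lte_fin.
move=> /ereal_inf_lt[_ [q dq <-] lt].
have [q' hq'] := choice (fun j => densities_pdf (dq j)).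
have pq' j : pdf nu (q' j) by case: (hq' j).
have [qs [hqs le]] := centroid_update hf hr pq'.
exists qs; split => //; rewrite -(mean_lossE mu hf B1 hqs); apply: (le_trans le).
apply: le_trans (ltW lt).
rewrite (risk_version hf mS0 S01 hS0 pq'); first exact: lexx.
by move=> j; case: (hq' j).
Qed.

Lemma minimizer_excess om (eps : R) (q : 'I_k.+1 -> T -> R) : (forall i, S0 (Xs i om)) ->
  empirical_minimizer mu nu p eps (sample om) q ->
  exists q' : 'I_k.+1 -> T -> R, [/\ balls nu B q', risk mu nu p q = (mean_loss mu nu f q')%:E &
    forall qs : 'I_k.+1 -> T -> R, balls nu B qs ->
      (sample_loss Xs nu f om q' <= sample_loss Xs nu f om qs + eps)%R].
Proof.
move=> omS [qB le]; have [q' [hq' qq']] := ballQ_balls qB.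
exists q'; split => //; first exact: risk_balls.
move=> qs hqs; move: le; rewrite (empirical_version hf hS0 omS hq' qq') => le.
rewrite -lee_fin EFinD; apply: (le_trans le); rewrite leeD2r//.
apply: ereal_inf_lbound; exists qs; first by move=> j; apply: (ball_ballQ BE).
by rewrite (empirical_version hf hS0 omS hqs)// => j; exact: aeW.
Qed.

Lemma deviation_bound (delta : R) : (0 < delta < 1)%R ->
  with_proba_ge P (1 - delta)%R
    [set om | forall q : 'I_k.+1 -> T -> R, powset (ballQ mu nu p) q ->
       risk mu nu p q - empirical_risk nu p (sample om) q
       <= (rate R n k.+1 + Num.sqrt (ln delta^-1 / (2 * n%:R)))%:E * M%:E].
Proof.
move=> hd; have [q0 h0] := ball_ex hf hr.
have [E [mE PE hE]] := risk_tail iid hf B1 k1 kn GI Gm mG hd h0.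
have [F [mF F1 hF]] := ae_full_set good_sample.
exists (E `&` F); split; first exact: measurableI.
  move=> om [Eom Fom] q qB; have [q' [hq' qq']] := ballQ_balls qB.
  rewrite (risk_balls hq' qq') (empirical_version hf hS0 (hF _ Fom) hq' qq').
  by rewrite -EFinB -EFinM lee_fin; exact: hE.
by rewrite (full_setI mE mF F1).
Qed.

Variables (eps : R) (qhat : ('I_n -> S) -> 'I_k.+1 -> T -> R).
Hypothesis eps0 : (0 <= eps)%R.
Hypothesis qhatP : {ae P, forall om,
  empirical_minimizer mu nu p eps (sample om) (qhat (sample om))}.

Let near_best_seq : exists qs : nat -> 'I_k.+1 -> T -> R, forall i, balls nu B (qs i) /\
  (mean_loss mu nu f (qs i))%:E <= best + (i.+1%:R^-1)%:E.
Proof.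
have h i : exists qs : 'I_k.+1 -> T -> R, balls nu B qs /\
    (mean_loss mu nu f qs)%:E <= best + (i.+1%:R^-1)%:E.
  by apply: near_best; rewrite invr_gt0.
by have [qs hqs] := choice h; exists qs.
Qed.

Let slack (m K : R) (e' : R) : m%:E <= best + e'%:E ->
  m%:E + K%:E + eps%:E <= best + K%:E + eps%:E + e'%:E.
Proof.
move=> h; apply: (@le_trans _ _ (best + e'%:E + K%:E + eps%:E)).
  by rewrite !leeD2r.
by rewrite -!addeA leeD2l// addeC addeA.
Qed.

Lemma excess_risk_tail (delta : R) : (0 < delta < 1)%R ->
  with_proba_ge P (1 - delta)%R
    [set om | risk mu nu p (qhat (sample om)) <= best
       + (rate R n k.+1 + Num.sqrt (2 * ln delta^-1 / n%:R))%:E * M%:E + eps%:E].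
Proof.
move=> hd; have [qs hqs] := near_best_seq.
have [E hE] := choice (fun i => excess_tail iid hf B1 k1 kn GI Gm mG hd (hqs i).1).
have mE i : measurable (E i) by case: (hE i).
have PE i : (1 - delta)%:E <= P (E i) by case: (hE i).
have [D [mD PD hD]] := limsup_event mE PE.
have [F [mF F1 hF]] := ae_full_set (filterI good_sample qhatP).
exists (D `&` F); split; first exact: measurableI.
  move=> om [Dom Fom] /=; have [omS hq] := hF _ Fom.
  have [q' [hq' -> hmin]] := minimizer_excess omS hq.
  apply/lee_addgt0Pr => e e0.
  have [N hN] : exists N, (N.+1%:R^-1 <= e :> R)%R.
    have := @cvg_harmonic R => /cvgrPdist_le/(_ _ e0)[N _ /(_ N (leqnn N))].
    by rewrite sub0r normrN /= ger0_norm// => h; exists N.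
  have [m Nm Em] := hD om Dom N; have [_ _ hEm] := hE m.
  have [hqm best_m] := hqs m.
  have := hEm om Em q' hq' eps eps0 (hmin _ hqm); rewrite -lee_fin => h.
  apply: (le_trans h); rewrite EFinD [X in X + _]EFinD EFinM -EFinM; apply: slack.
  apply: (le_trans best_m); rewrite leeD2l// lee_fin; apply: le_trans hN.
  by rewrite lef_pV2 ?posrE// ler_nat ltnS.
by rewrite (full_setI mD mF F1).
Qed.

(** The competitor is fixed before the expectation is taken, so that its own deviation
    has mean zero. *)
Lemma excess_risk_mean :
  \int[P]_om risk mu nu p (qhat (sample om)) <= best + (rate R n k.+1)%:E * M%:E + eps%:E.
Proof.
apply/lee_addgt0Pr => e e0.
have [qs [hqs best_qs]] := near_best e0.
have [Z [mZ [K ZK] ZI hZ]] := excess_mean iid hf B1 k1 kn GI Gm mG hqs.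
pose g om := (mean_loss mu nu f qs + Z om + eps)%R.
have Zi : P.-integrable [set: Om] (EFin \o Z) by apply: (@prob_bounded_integrable _ _ _ P _ K).
have ic := finite_measure_integrable_cst P (mean_loss mu nu f qs + eps)%R measurableT.
have hg : {ae P, forall om, 0 <= risk mu nu p (qhat (sample om)) <= (g om)%:E}.
  apply: filterS2 good_sample qhatP => om omS hq.
  have [q' [hq' -> hmin]] := minimizer_excess omS hq.
  rewrite !lee_fin; have /andP[-> _] /= := mean_loss_bounds mu hf B1 hq'.
  exact: hZ (hmin _ hqs).
apply: (@le_trans _ _ (\int[P]_om maxe (g om)%:E 0)).
  apply: ae_le_lower_integral => [om|]; first by rewrite le_max lexx orbT.
  by apply: filterS hg => om /andP[h0 h]; rewrite le_max h.
rewrite (ae_eq_lower_integral (g := fun om => (g om)%:E)); last first.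
  by apply: filterS hg => om /andP[h0 h]; rewrite max_l// (le_trans h0).
have gE : \int[P]_om (g om)%:E = (\int[P]_om Z om)%R%:E + (mean_loss mu nu f qs + eps)%:E.
  transitivity (\int[P]_om ((EFin \o Z) om + (EFin \o cst (mean_loss mu nu f qs + eps)%R) om)).
    by apply: eq_integral => om _; rewrite /= -EFinD; congr (_%:E); rewrite /g; ring.
  rewrite (integralD measurableT Zi ic); congr (_ + _).
    by rewrite /Rintegral fineK//; exact: integrable_fin_num.
  have P1 : P setT = 1 by exact: probability_setT.
  have h : \int[P]_om (cst (mean_loss mu nu f qs + eps)%:E) om = (mean_loss mu nu f qs + eps)%:E * P setT.
    exact: (integral_cst P measurableT).
  by rewrite -[RHS]mule1 -P1 -h.
rewrite gE; apply: (@le_trans _ _ ((mean_loss mu nu f qs)%:E + (rate R n k.+1 * M)%:E + eps%:E)).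
  by rewrite -!EFinD lee_fin addrCA addrA lerD2r lerD2l.
by rewrite EFinM -EFinM; exact: slack.
Qed.

End assembly.

Local Close Scope ereal_scope.


Local Open Scope ereal_scope.

Theorem proposition22 (R : realType) (XX YY : completeMetricType R)
    (sepX : separable XX) (sepY : separable YY)
    (d : measure_display) (Omega : measurableType d) (P : probability Omega R)
    (X : {RV P >-> borel XX}) (Y : {RV P >-> borel YY})
    (kappa : R.-pker borel XX ~> borel YY)
    (kappaE : regular_conditional_law X Y kappa)
    (nu : probability (borel YY) R)
    (kappa_nu : {ae distribution P X, forall x, kappa x `<< nu}) :
  let mu := distribution P X in
  let p := conditional_density nu kappa in
  let B := constB mu nu p in
  let C := constC mu nu p in
  ess_sup mu (sq_mass nu p) < +oo ->
  ess_sup mu (sq_log_mass nu p) < +oo ->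
  forall k n : nat, (2 <= k)%N -> (2 * k <= n)%N ->
  forall Xs : 'I_n -> {RV P >-> borel XX}, independent_copies X Xs ->
  let sample (w : Omega) := fun i => Xs i w in
  let QB := powset (k:=k) (ballQ mu nu p) in
  let best := ereal_inf [set risk mu nu p q | q in powset (k:=k) (densities nu)] in
  (forall delta : R, (0 < delta < 1)%R ->
    with_proba_ge P (1 - delta)%R
      [set w | forall q, QB q ->
         risk mu nu p q - empirical_risk nu p (sample w) q
         <= (rate R n k + Num.sqrt (ln delta^-1 / (2 * n%:R)))%:E
            * (B * C + 2%:E * lne B)])
  /\
  (forall (eps : R) (qhat : ('I_n -> borel XX) -> 'I_k -> borel YY -> R),
    (0 <= eps)%R ->
    {ae P, forall w,
       empirical_minimizer mu nu p eps (sample w) (qhat (sample w))} ->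
    (forall delta : R, (0 < delta < 1)%R ->
      with_proba_ge P (1 - delta)%R
        [set w | risk mu nu p (qhat (sample w))
           <= best
              + (rate R n k + Num.sqrt (2 * ln delta^-1 / n%:R))%:E
                * (B * C + 2%:E * lne B)
              + eps%:E])
    /\
    \int[P]_w risk mu nu p (qhat (sample w))
      <= best + (rate R n k)%:E * (B * C + 2%:E * lne B) + eps%:E).
Proof.
move=> mu p B C hsq hlog k n k2 kn Xs iid sample QB best.
have [G [GI Gm mG]] := borel_countable_pi_system sepY.
have [f0 [mf0 f00 hp]] := conditional_density_version kappaE kappa_nu GI Gm mG.
have sq0 x : 0 <= sq_mass nu p x by apply: integral_ge0 => y _; rewrite lee_fin sqr_ge0.
have lg0 x : 0 <= sq_log_mass nu p x by apply: integral_ge0 => y _; rewrite sqre_ge0.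
have [b [b0 bE hb]] := ess_sup_sqrt sq0 hsq.
have [c [c0 cE hc]] := ess_sup_sqrt lg0 hlog.
have [f [S0 [mf fP fx [mS0 S01] hS0]]] := regular_density mf0 f00 hp hb hc.
have hf : density_family nu f b c by split.
have [r [r0 rE hr]] := radius_finite hf mS0 S01 hS0.
have [x0 _] := full_set_ex S01.
have B1 : (1 <= b * expR r)%R.
  rewrite -[leLHS]mulr1; apply: ler_pM => //; first exact: (density_bound_ge1 hf x0).
  by rewrite -expR0 ler_expR.
have BE : constB mu nu p = (b * expR r)%:E by rewrite /constB bE rE EFinM.
have boundE : B * C + 2%:E * lne B = (loss_bound c (b * expR r))%:E.
  rewrite /B /C BE [constC _ _ _]cE lne_EFin; last exact: lt_le_trans B1.
  by rewrite /loss_bound EFinD !EFinM.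
case: k k2 kn @QB @best => [//|k] k1 kn QB best.
rewrite boundE; split=> [delta hd|eps qhat eps0 hq].
  exact: (deviation_bound iid hf mS0 S01 hS0 hr B1 BE k1 kn GI Gm mG hd).
split=> [delta hd|].
  exact: (excess_risk_tail iid hf mS0 S01 hS0 hr B1 BE k1 kn GI Gm mG eps0 hq hd).
exact: (excess_risk_mean iid hf mS0 S01 hS0 hr B1 BE k1 kn GI Gm mG eps0 hq).
Qed.
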